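(* Let $G$ be a contact Carnot group. There exist constants $C_1',C_2'>0$ and $R_1',R_2'\in\mathbb{R}$ such that for every $p=(x,z)\in G$ with $p\neq(0,0)$: $$C_1'\frac{|z|}{\|x\|^2}+R_1'\;\le\;\hat\beta(p)\;\le\;C_2'\frac{|z|}{\|x\|^2}+R_2',$$ where $\hat\beta(p)$ is the sum of the Betti numbers of the set of geodesics from the origin to $p$ (with the convention $\frac{|z|}{0}=\infty$ when $x=0$, $z\neq0$).
   Context: A contact Carnot group $G$ is a connected, simply connected Lie group of dimension $2n+1$ whose Lie algebra of left-invariant vector fields splits as $\mathfrak g=\mathfrak g_1\oplus\mathfrak g_2$ with $\dim\mathfrak g_2=1$, $[\mathfrak g_1,\mathfrak g_1]=\mathfrak g_2$, $[\mathfrak g_1,\mathfrak g_2]=[\mathfrak g_2,\mathfrak g_2]=0$, with a scalar product on $\mathfrak g_1$ having orthonormal basis $f_1,\dots,f_{2n}$. Fix a generator $f_0$ of $\mathfrak g_2$; then $[f_i,f_j]=A_{ij}f_0$ for a skew-symmetric matrix $A$, which is required to be non-degenerate. Exponential coordinates: $p=(x,z)\in\mathbb{R}^{2n}\times\mathbb{R}$ means $p=\exp_G(\sum_i x_if_i+zf_0)$; $p_0=(0,0)$ is the identity (origin). A geodesic is a non-constant Lipschitz curve $\gamma:[0,1]\to G$, tangent a.e. to $\mathfrak g_1$, locally minimizing the energy $J(\gamma)=\frac12\int_0^1\|\dot\gamma\|^2dt$. Geodesics starting from $p_0$ are parametrized by their initial covector: with $H(\eta)=\frac12\sum_{i=1}^{2n}\langle\eta,f_i\rangle^2$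 on $T^*G$, Hamiltonian vector field $\vec H$ and projection $\pi:T^*G\to G$, the exponential map is $\hat E(\eta)=\pi(e^{\vec H}(\eta))$, $\eta\in T^*_{p_0}G$, and for $p\neq p_0$ the set of geodesics from $p_0$ to $p$ is $\Gamma(p)=\hat E^{-1}(p)\subset T^*_{p_0}G$ with the subspace topology. Then $\hat\beta(p)=\sum_i\operatorname{rank}H_i(\Gamma(p);\mathbb{Z})\in\mathbb{N}\cup\{\infty\}$. *)

(* Defs.v *)
From HB Require Import structures.
From mathcomp Require Import all_boot all_order all_algebra.
From mathcomp Require Import all_classical all_reals all_analysis.
From mathcomp Require Import freeg.

Set Implicit Arguments.
Unset Strict Implicit.
Unset Printing Implicit Defensive.

Import Order.TTheory GRing.Theory Num.Theory.
Import numFieldNormedType.Exports.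

Local Open Scope classical_set_scope.
Local Open Scope ring_scope.

Definition std_simplex (R : realType) (k : nat) : set 'rV[R]_k.+1 :=
  [set x | (forall i, 0 <= x 0 i) /\ \sum_i x 0 i = 1].
Arguments std_simplex R k : clear implicits.

Section SingularSimplices.
Variable R : realType.

(* The affine inclusion of the i-th face inserts a zero coordinate at
   index i. *)
Definition face_row (k : nat) (i : 'I_k.+2) (x : 'rV[R]_k.+1) : 'rV[R]_k.+2 :=
  \row_j oapp (fun j' => x 0 j') 0 (unlift i j).

Lemma face_row_std_simplex k (i : 'I_k.+2) x :
  std_simplex R k x -> std_simplex R k.+1 (face_row i x).
Proof.
case=> x0 x1; split=> [j|].
  by rewrite mxE; case: unlift => [j'|] //=.
rewrite (bigD1_ord i) //= mxE unlift_none /= add0r -[RHS]x1.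
by apply: eq_bigr => j _; rewrite mxE liftK.
Qed.

Lemma face_row_continuous k (i : 'I_k.+2) : continuous (@face_row k i).
Proof.
move=> x; have FF : Filter (face_row i y @[y --> x]).
  by apply: fmap_filter; exact: nbhs_filter.
have /cvg_mx_entourageP xx : nbhs x --> x by [].
apply/(@cvg_mx_entourageP R _ _ _ FF) => A entA.
rewrite near_map; apply: filterS (xx A entA) => y yA a j.
rewrite (ord1 a) !mxE; case: (unlift i j) => [j'|] /=; first exact: yA.
by rewrite inE; exact: entourage_refl.
Qed.

Definition face_map (k : nat) (i : 'I_k.+2) (x : std_simplex R k) :
    std_simplex R k.+1 :=
  SigSub (mem_set (face_row_std_simplex i (set_mem (valP x)))).

Lemma face_map_continuous k (i : 'I_k.+2) : continuous (@face_map k i).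
Proof.
apply: (@continuous_comp_initial _ _ _ (@set_val _ (std_simplex R k.+1))).
move=> x; apply: (@continuous_comp _ _ _ set_val (face_row i)).
  exact: initial_continuous.
exact: face_row_continuous.
Qed.

HB.instance Definition _ (k : nat) (i : 'I_k.+2) :=
  isContinuous.Build _ _ (@face_map k i) (@face_map_continuous k i).

End SingularSimplices.

Section SingularHomology.
Variables (R : realType) (X : topologicalType).

Definition sing_simplex (k : nat) : choiceType :=
  continuousType (std_simplex R k) X.

Definition sing_face (k : nat) (i : 'I_k.+2) (s : sing_simplex k.+1) :
    sing_simplex k :=
  (s : continuousType _ _) \o @face_map R k i.

Definition sing_chain (k : nat) : lmodType int :=
  {freeg (sing_simplex k) / int}.

Definition sing_boundary (k : nat) : sing_chain k.+1 -> sing_chain k :=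
  fglift (fun s => \sum_(i < k.+2) << (-1) ^+ i *g sing_face i s >>).

Lemma boundary_is_zmod_morphism k : zmod_morphism (@sing_boundary k).
Proof. exact: lift_is_additive. Qed.

HB.instance Definition _ (k : nat) :=
  GRing.isZmodMorphism.Build _ _ (@sing_boundary k) (@boundary_is_zmod_morphism k).

Definition is_cycle (k : nat) : {pred sing_chain k} :=
  match k with
  | 0 => fun=> true
  | k'.+1 => fun c : sing_chain k'.+1 => sing_boundary c == 0
  end.

Lemma is_cycle_zmod_closed k : zmod_closed (@is_cycle k).
Proof.
case: k => [|k]; split=> //= [|c d].
  by rewrite unfold_in (raddf0 (@sing_boundary k)).
rewrite !unfold_in => /eqP c0 /eqP d0; apply/eqP.
by rewrite boundary_is_zmod_morphism c0 d0 subrr.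
Qed.

HB.instance Definition _ (k : nat) :=
  GRing.isZmodClosed.Build _ (@is_cycle k) (@is_cycle_zmod_closed k).

Definition sing_cycle (k : nat) := {c : sing_chain k | @is_cycle k c}.

HB.instance Definition _ (k : nat) := SubChoice.on (sing_cycle k).
HB.instance Definition _ (k : nat) := [SubChoice_isSubZmodule of sing_cycle k by <:].

Definition is_boundary (k : nat) : {pred sing_cycle k} :=
  fun z => `[< exists c : sing_chain k.+1, sing_boundary c = val z >].

Lemma is_boundary_zmod_closed k : zmod_closed (@is_boundary k).
Proof.
split=> [|y z].
  by rewrite unfold_in; apply/asboolP; exists 0; rewrite raddf0.
rewrite !unfold_in => /asboolP[c cy] /asboolP[d dz]; apply/asboolP.
by exists (c - d); rewrite boundary_is_zmod_morphism cy dz.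
Qed.

HB.instance Definition _ (k : nat) :=
  GRing.isZmodClosed.Build _ (@is_boundary k) (@is_boundary_zmod_closed k).

Definition homology (k : nat) : zmodType :=
  Quotient.quot (@is_boundary k : zmodClosed (sing_cycle k)).

End SingularHomology.

Section BettiNumbers.
Variable R : realType.
Local Open Scope ereal_scope.

Definition int_free (V : zmodType) (m : nat) (v : 'I_m -> V) :=
  forall a : 'I_m -> int, (\sum_i v i *~ a i)%R = 0%R -> forall i, a i = 0%R.

(* Rank of an abelian group, with value in the natural numbers extended by
   +oo: the supremum of the sizes of its Z-linearly independent families. *)
Definition zmod_rank (V : zmodType) : \bar R :=
  ereal_sup [set (m%:R)%:E | m in
    [set m : nat | exists v : 'I_m -> V, int_free v]].

Definition betti (X : topologicalType) (k : nat) : \bar R :=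
  zmod_rank (homology R X k).

Definition total_betti (X : topologicalType) : \bar R :=
  \sum_(0 <= k <oo) betti X k.

End BettiNumbers.

Fixpoint Ck (R : realType) (U V : normedModType R) (k : nat) (f : U -> V) :
    Prop :=
  match k with
  | 0 => continuous f
  | k'.+1 => (forall x, differentiable f x) /\
             (forall v, Ck k' (fun x => 'D_v f x))
  end.

Definition smooth (R : realType) (U V : normedModType R) (f : U -> V) :=
  forall k, Ck k f.

(* [X, Y] = DY(X) - DX(Y), i.e. XY - YX on functions. *)
Definition lie_bracket (R : realType) (U : normedModType R) (X Y : U -> U) :
    U -> U :=
  fun p => 'D_(X p) Y p - 'D_(Y p) X p.

Section Coordinates.
Variables (R : realType) (n : nat).

Definition cpoint : normedModType R := ('rV[R]_(n.*2) * R)%type.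

Definition horizontal_dir (i : 'I_(n.*2)) : cpoint := (delta_mx 0 i, 0).
Definition vertical_dir : cpoint := (0, 1).

(* The left-invariant field of the group law m (with identity 0) whose value
   at the identity is v. *)
Definition left_invariant_field (m : cpoint -> cpoint -> cpoint) (v : cpoint) :
    cpoint -> cpoint :=
  fun p => 'D_v (m p) 0.

(* The group in exponential coordinates: (x, z) stands for
   exp (\sum_i x_i f_i + z f_0), which is what ccg_exp says: t |-> t v is the
   one-parameter subgroup with velocity v at the identity.  The scalar product
   on g_1 is the one for which the f_i are orthonormal. *)
Record contactCarnotGroup := ContactCarnotGroup {
  ccg_mul : cpoint -> cpoint -> cpoint ;
  ccg_inv : cpoint -> cpoint ;
  ccg_form : 'M[R]_(n.*2) ;
  ccg_f (i : 'I_(n.*2)) := left_invariant_field ccg_mul (horizontal_dir i) ;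
  ccg_f0 := left_invariant_field ccg_mul vertical_dir ;
  ccg_mulA : associative ccg_mul ;
  ccg_mul0p : left_id 0 ccg_mul ;
  ccg_mulVp : left_inverse 0 ccg_inv ccg_mul ;
  ccg_mul_smooth : smooth (fun pq : cpoint * cpoint => ccg_mul pq.1 pq.2) ;
  ccg_inv_smooth : smooth ccg_inv ;
  ccg_exp : forall (v : cpoint) (s t : R),
    ccg_mul (s *: v) (t *: v) = (s + t) *: v ;
  ccg_bracket : forall i j p,
    lie_bracket (ccg_f i) (ccg_f j) p = ccg_form i j *: ccg_f0 p ;
  ccg_bracket0 : forall i p, lie_bracket (ccg_f i) ccg_f0 p = 0 ;
  ccg_form_skew : ccg_form^T = - ccg_form ;
  ccg_form_unit : ccg_form \in unitmx ;
  (* [g_1, g_1] = g_2; in particular n > 0 *)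
  ccg_form_neq0 : exists i j, ccg_form i j != 0
}.

(* Covectors are identified with points through dual coordinates, and
   T^*G with cpoint * cpoint. *)
Definition pairing (eta v : cpoint) : R :=
  \sum_i eta.1 0 i * v.1 0 i + eta.2 * v.2.

Definition partials (F : cpoint -> R) (p : cpoint) : cpoint :=
  (\row_i 'D_(horizontal_dir i) F p, 'D_vertical_dir F p).

Definition hamiltonian_field (H : cpoint * cpoint -> R) (l : cpoint * cpoint) :
    cpoint * cpoint :=
  (partials (fun eta => H (l.1, eta)) l.2,
   - partials (fun q => H (q, l.2)) l.1).

Variable G : contactCarnotGroup.

Definition sub_riemannian_H (l : cpoint * cpoint) : R :=
  2^-1 * \sum_i (pairing l.2 (ccg_f G i l.1)) ^+ 2.

Definition integral_curve (l : R -> cpoint * cpoint) :=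
  forall t : R, is_derive t (1 : R) l (hamiltonian_field sub_riemannian_H (l t)).

(* The graph of the exponential map eta |-> pi (e^H (0, eta)); the flow is
   complete, so asking for a curve defined on all of R is no restriction. *)
Definition exp_map_graph (eta p : cpoint) :=
  exists l, [/\ integral_curve l, l 0 = (0, eta) & (l 1).1 = p].

Definition geodesics_to (p : cpoint) : set cpoint :=
  [set eta | exp_map_graph eta p].

Definition beta_hat (p : cpoint) : \bar R := total_betti R (geodesics_to p).

End Coordinates.

Definition sqnorm (R : realType) (m : nat) (x : 'rV[R]_m) : R :=
  \sum_i x 0 i ^+ 2.

Definition height_ratio (R : realType) (m : nat) (x : 'rV[R]_m) (z : R) :
    \bar R :=
  if x == 0 then +oo%E else (`|z| / sqnorm x)%:E.

(* Main.v *)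
(** Associativity and the bracket relations force the frame to be
    f_i (x, z) = (e_i, (x A)_i / 2), where A is the bracket form; the Hamiltonian system is
    then solved explicitly.  Writing -A^2 = sum_k a_k^2 P_k with orthogonal
    projectors P_k, a covector (xi, zeta) with zeta <> 0 reaches (x, z) iff xi
    is a solution of a linear system that is invertible on the range of P_k
    exactly when zeta a_k is not in 2 pi Z, together with one quadratic
    equation.  Hence each level Gamma_zeta of the set Gamma of geodesics is
    empty, a point, or a round sphere, and Gamma_zeta is nonempty at a
    nonresonant zeta iff z = sum_k |x P_k|^2 a_k G (zeta a_k), where
    G t = (t - sin t) / (4 (1 - cos t)).

    G is strictly convex between consecutive positive poles and odd, so between
    two consecutive resonances there are at most two such zeta.  Since |zeta| is
    bounded by an affine function of |z| / |x|^2 on Gamma, there are finitely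
    many levels, their number being affine in |z| / |x|^2; each is covered by
    contractible open pieces with contractible or empty intersections (the sign
    conditions on the coordinates), and the Mayer-Vietoris argument bounds the
    Betti numbers.  Conversely every window of a fixed length on which the
    height function starts below |z| contains a nonempty level; as every
    interval contains a zeta with empty level, distinct levels are in distinct
    components, so H_0 already has rank at least the number of windows, which is
    affine in |z| / |x|^2, and infinite if x = 0. *)

Require Import Defs.
From HB Require Import structures.
From mathcomp Require Import all_boot all_order all_algebra.
From mathcomp Require Import generic_quotient complex.
From mathcomp Require Import all_classical all_reals all_analysis.
From mathcomp Require Import freeg.
From mathcomp Require Import ring lra zify.

Set Implicit Arguments.
Unset Strict Implicit.
Unset Printing Implicit Defensive.

Import Order.TTheory GRing.Theory Num.Theory.
Import numFieldNormedType.Exports.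

Local Open Scope classical_set_scope.
Local Open Scope ring_scope.

(** * Barycentric subdivision and small chains *)

(** Two obstacles shape the argument. The group law comes without a formula: the frame is recovered
    by differentiating the one-parameter-subgroup axiom along rays and comparing with the brackets,
    which gives a linear differential equation with zero initial value. Homology is bounded from the
    definition of singular chains: all chains live in one fixed space and are supported in subsets,
    and only numbers of generators are tracked, so that the generation half of Mayer-Vietoris
    suffices. For the lower bound, the height need not blow up at a resonance, because x may have no
    component in the resonant eigenspaces; the resonance itself then carries geodesics once the
    remaining height is at most |z|. A window therefore has a first stretch containing a point
    uniformly far from all resonances, where the height is at most a constant times (zeta + 1)
    |x|^2, and then one full period of a single frequency, which is certain to contain a resonance.
    The slope C1 is the inverse of that constant times the window length; C2 counts levels up to the
    bound on |zeta|, each weighted by the cover bound of one sphere. *)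

Section FreeAbelianGroups.
Variables (K : choiceType).

HB.instance Definition _ (M : lmodType int) (f : K -> M) :=
  GRing.isZmodMorphism.Build {freeg K / int} M (fglift f) (lift_is_additive f).


Lemma freegU_Mz (k : int) (s : K) : << k *g s >> = << s >> *~ k :> {freeg K / int}.
Proof. by rewrite freegU_mulz intz. Qed.

Lemma freegUZ (k : int) (s : K) : << k *g s >> = k *: << s >> :> {freeg K / int}.
Proof. by apply/eqP/freeg_eqP => x; rewrite coeffZ !coeffU mul1r. Qed.

Lemma fglift1 (M : lmodType int) (f : K -> M) s : fglift f << s >> = f s.
Proof. by rewrite liftU scale1r. Qed.

(** Encodes subcomplexes: chains of a subspace are chains of the whole space whose simplices satisfy
    a predicate, which avoids inclusion maps between chain groups. *)
Definition supported (P : set K) (D : {freeg K / int}) :=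
  forall s, s \in dom D -> P s.

(** Chain identities are reduced to single simplices through this; the support condition matters for
    maps that take a default value on other simplices. *)
Lemma freeg_morph_ext_in (M : zmodType) (f g : {additive {freeg K / int} -> M})
    (P : set K) D :
  (forall s, P s -> f << s >> = g << s >>) -> supported P D -> f D = g D.
Proof.
move=> fg PD; rewrite -[D]freeg_sumE !raddf_sum !big_seq.
by apply: eq_bigr => s /PD Ps; rewrite freegU_Mz !raddfMz fg.
Qed.

Lemma freeg_morph_ext (M : zmodType) (f g : {additive {freeg K / int} -> M}) :
  (forall s, f << s >> = g << s >>) -> f =1 g.
Proof. by move=> fg D; apply: (@freeg_morph_ext_in _ _ _ setT). Qed.

Lemma supported0 P : supported P 0.
Proof. by move=> s; rewrite dom0. Qed.

Lemma supportedD P D1 D2 :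
  supported P D1 -> supported P D2 -> supported P (D1 + D2).
Proof.
move=> h1 h2 s /domD_subset; rewrite mem_cat => /orP[]; [exact: h1|exact: h2].
Qed.

Lemma supportedN P D : supported P D -> supported P (- D).
Proof. by move=> h s; rewrite domN => /h. Qed.

Lemma supportedB P D1 D2 :
  supported P D1 -> supported P D2 -> supported P (D1 - D2).
Proof. by move=> h1 h2; apply: supportedD => //; exact: supportedN. Qed.

Lemma supportedZ P c D : supported P D -> supported P (c *: D).
Proof. by move=> h s /domZ_subset /h. Qed.

Lemma supportedMz P c D : supported P D -> supported P (D *~ c).
Proof. by move=> h; rewrite -scaler_int; exact: supportedZ. Qed.

Lemma supported_sum (I : Type) (r : seq I) (p : pred I) P
    (F : I -> {freeg K / int}) :
  (forall i, p i -> supported P (F i)) -> supported P (\sum_(i <- r | p i) F i).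
Proof. by move=> h; elim/big_ind: _ => //; [exact: supported0|exact: supportedD]. Qed.

Lemma supportedU (P : set K) c s : P s -> supported P << c *g s >>.
Proof.
move=> Ps t; have [->|c0] := eqVneq c 0; first by rewrite freegU0 dom0.
by rewrite domU // inE => /eqP->.
Qed.

Lemma supportedW (P Q : set K) D : P `<=` Q -> supported P D -> supported Q D.
Proof. by move=> PQ h s /h /PQ. Qed.

Lemma supportedI P Q D : supported P D -> supported Q D -> supported (P `&` Q) D.
Proof. by move=> hP hQ s sD; split; [exact: hP|exact: hQ]. Qed.

End FreeAbelianGroups.

Lemma supported_fglift (K K' : choiceType) (f : K -> {freeg K' / int})
    (P : set K) (Q : set K') D :
  (forall s, P s -> supported Q (f s)) -> supported P D ->
  supported Q (fglift f D).
Proof.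
move=> PQ hD; rewrite -[D]freeg_sumE raddf_sum /= big_seq; apply: supported_sum.
by move=> s sD; rewrite liftU; apply: supportedZ; apply: PQ; exact: hD.
Qed.

(** * Linear chains in a vector space and barycentric subdivision *)

Section LinearChains.
Variable (R : realType).

Definition barycenter (E : lmodType R) (s : seq E) : E :=
  (size s)%:R^-1 *: \sum_(x <- s) x.

Section Operators.
Variable (E : lmodType R).

Local Notation L := {freeg (seq E) / int}.

Definition lcone (b : E) : L -> L := fglift (fun s => << b :: s >> : L).

HB.instance Definition _ b := GRing.Additive.copy (lcone b)
  (fglift (fun s => << b :: s >> : L)).

(** A list of k+1 points is an affine k-simplex. The cone formula d(b s) = s - b ds is taken as the
    definition; the empty list has degree -1, so the complex is augmented and the formula covers
    single vertices too. *)
Fixpoint lbd_seq (s : seq E) : L :=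
  if s is b :: s' then << s' >> - lcone b (lbd_seq s') else 0.

Definition lbd : L -> L := fglift lbd_seq.

HB.instance Definition _ := GRing.Additive.copy lbd (fglift lbd_seq).

Lemma lcone1 b s : lcone b << s >> = << b :: s >>.
Proof. exact: fglift1. Qed.

Lemma lbd1 s : lbd << s >> = lbd_seq s.
Proof. exact: fglift1. Qed.

Lemma lbd_cone b c : lbd (lcone b c) = c - lcone b (lbd c).
Proof.
apply: (@freeg_morph_ext _ _ (lbd \o lcone b : {additive _ -> _})
  (idfun \- (lcone b \o lbd) : {additive _ -> _})
  _ c) => s /=.
by rewrite lcone1 !lbd1.
Qed.

Lemma lbd_lbd c : lbd (lbd c) = 0.
Proof.
apply: (@freeg_morph_ext _ _ (lbd \o lbd : {additive _ -> _})
  (\0 : {additive _ -> _})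
  _ c) => s /=.
rewrite lbd1.
elim: s => [|b s ih]; first exact: raddf0.
by rewrite /= raddfB /= lbd_cone ih raddf0 subr0 lbd1 subrr.
Qed.

(* The size of the simplex bounds the recursion; as the cone formula holds for
   the empty simplex too, the identities need no homogeneity assumption. *)
Fixpoint lsd (n : nat) : L -> L :=
  if n is n'.+1 then
    fglift (fun s => lcone (barycenter s) (lsd n' (lbd << s >>)))
  else id.

(** The homotopy from the identity to [lsd], by the cone recursion T s = b (s - T ds). The depth is
    meant to be the number of vertices, which is why it drops by one across [lbd]. *)
Fixpoint ltel (n : nat) : L -> L :=
  if n is n'.+1 then
    fglift (fun s => lcone (barycenter s) (<< s >> - ltel n' (lbd << s >>)))
  else fun=> 0.

Arguments lsd : simpl never.
Arguments ltel : simpl never.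

Lemma lsdS1 n s :
  lsd n.+1 << s >> = lcone (barycenter s) (lsd n (lbd << s >>)).
Proof. exact: fglift1. Qed.

Lemma ltelS1 n s :
  ltel n.+1 << s >> =
  lcone (barycenter s) (<< s >> - ltel n (lbd << s >>)).
Proof. exact: fglift1. Qed.

Lemma lsd_zmod_morphism n : zmod_morphism (lsd n).
Proof. by case: n => [//|n]; exact: lift_is_additive. Qed.

HB.instance Definition _ n :=
  GRing.isZmodMorphism.Build L L (lsd n) (lsd_zmod_morphism n).

Lemma ltel_zmod_morphism n : zmod_morphism (ltel n).
Proof.
by case: n => [|n]; [move=> ? ?; rewrite /ltel subr0|exact: lift_is_additive].
Qed.

HB.instance Definition _ n :=
  GRing.isZmodMorphism.Build L L (ltel n) (ltel_zmod_morphism n).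

(** The cone formula gives Sd ds minus the cone over d Sd ds; by induction the latter is a cone over
    Sd dds = 0. *)
Lemma lbd_lsd n c : lbd (lsd n.+1 c) = lsd n (lbd c).
Proof.
elim: n c => [|n ih] c.
  apply: (@freeg_morph_ext _ _ (lbd \o lsd 1 : {additive _ -> _})
    (lbd : {additive _ -> _})
    _ c) => s /=.
  by rewrite lsdS1 lbd_cone lbd_lbd raddf0 subr0.
apply: (@freeg_morph_ext _ _ (lbd \o lsd n.+2 : {additive _ -> _})
    (lsd n.+1 \o lbd : {additive _ -> _})
  _ c) => s /=.
by rewrite lsdS1 lbd_cone ih lbd_lbd raddf0 raddf0 subr0.
Qed.

Lemma lbd_ltel n c : lbd (ltel n.+1 c) = c - ltel n (lbd c) - lsd n.+1 c.
Proof.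
elim: n c => [|n ih] c.
  rewrite /(ltel 0 _) subr0.
  apply: (@freeg_morph_ext _ _ (lbd \o ltel 1 : {additive _ -> _})
    (idfun \- lsd 1 : {additive _ -> _})
    _ c) => s /=.
  by rewrite ltelS1 lsdS1 lbd_cone /ltel /lsd subr0.
apply: (@freeg_morph_ext _ _ (lbd \o ltel n.+2 : {additive _ -> _})
    (idfun \- (ltel n.+1 \o lbd) \- lsd n.+2 : {additive _ -> _})
  _ c) => s /=.
rewrite ltelS1 lsdS1 lbd_cone [in X in lcone _ X]raddfB /=.
rewrite ih lbd_lbd raddf0 subr0 subKr.
by [].
Qed.

(* Iterated subdivision and the chain homotopy from the identity to it. *)
Fixpoint ltels (r n : nat) (c : L) : L :=
  if r is r'.+1 then ltel n c + ltels r' n (lsd n c) else 0.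

Lemma ltels_zmod_morphism r n : zmod_morphism (ltels r n).
Proof.
elim: r => [|r ih] c d /=; first by rewrite subr0.
by rewrite !raddfB /= ih opprD addrACA.
Qed.

HB.instance Definition _ r n :=
  GRing.isZmodMorphism.Build L L (ltels r n) (ltels_zmod_morphism r n).

Lemma lbd_ltels r n c :
  lbd (ltels r n.+1 c) = c - ltels r n (lbd c) - iter r (lsd n.+1) c.
Proof.
elim: r c => [|r ih] c /=; first by rewrite raddf0 subr0 subrr.
by rewrite raddfD /= ih lbd_ltel lbd_lsd -iterSr /= opprD !addrA subrK.
Qed.

End Operators.

Arguments lsd : simpl never.
Arguments ltel : simpl never.

(** * Naturality under linear maps, applied later to the face inclusions *)

Section Naturality.
Variables (E E' : lmodType R) (f : {linear E -> E'}).

Definition lmap : {freeg (seq E) / int} -> {freeg (seq E') / int} :=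
  fglift (fun s => << map f s >>).

HB.instance Definition _ := GRing.Additive.copy lmap
  (fglift (fun s => << map f s >> : {freeg (seq E') / int})).

Lemma lmap1 s : lmap << s >> = << map f s >>.
Proof. exact: fglift1. Qed.

Lemma lmap_cone b c : lmap (lcone b c) = lcone (f b) (lmap c).
Proof.
apply: (@freeg_morph_ext _ _ (lmap \o lcone b : {additive _ -> _})
    (lcone (f b) \o lmap : {additive _ -> _})
  _ c) => s /=.
by rewrite !(lmap1, lcone1).
Qed.

Lemma lmap_lbd c : lmap (lbd c) = lbd (lmap c).
Proof.
apply: (@freeg_morph_ext _ _ (lmap \o @lbd E : {additive _ -> _})
    (@lbd E' \o lmap : {additive _ -> _})
  _ c) => s /=.
rewrite lmap1 !lbd1.
elim: s => [|b s ih] /=; first exact: raddf0.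
by rewrite raddfB /= lmap_cone ih lmap1.
Qed.

Lemma lmap_barycenter s : f (barycenter s) = barycenter (map f s).
Proof. by rewrite /barycenter linearZ /= raddf_sum big_map size_map. Qed.

Lemma lmap_lsd n c : lmap (lsd n c) = lsd n (lmap c).
Proof.
elim: n c => [//|n ih] c.
apply: (@freeg_morph_ext _ _ (lmap \o @lsd E n.+1 : {additive _ -> _})
    (@lsd E' n.+1 \o lmap : {additive _ -> _})
  _ c) => s /=.
rewrite lmap1 !lsdS1 lmap_cone lmap_barycenter.
by rewrite ih lmap_lbd lmap1.
Qed.

Lemma lmap_ltel n c : lmap (ltel n c) = ltel n (lmap c).
Proof.
elim: n c => [|n ih] c; first exact: raddf0.
apply: (@freeg_morph_ext _ _ (lmap \o @ltel E n.+1 : {additive _ -> _})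
    (@ltel E' n.+1 \o lmap : {additive _ -> _})
  _ c) => s /=.
rewrite lmap1 !ltelS1 lmap_cone lmap_barycenter raddfB /=.
by rewrite ih lmap_lbd lmap1.
Qed.

Lemma lmap_ltels r n c : lmap (ltels r n c) = ltels r n (lmap c).
Proof.
elim: r c => [|r ih] c /=; first exact: raddf0.
by rewrite raddfD /= lmap_ltel ih lmap_lsd.
Qed.

End Naturality.

End LinearChains.

(** * Shrinking of diameters under subdivision *)

Section SubdivisionEstimates.
Variables (R : realType) (E : normedModType R).
Implicit Types (s t : seq E).

Local Notation L := {freeg (seq E) / int}.

(** A stand-in for the convex hull of [s]: distance bounds are all that is used, and this form
    passes to barycenters and faces without convex coefficients. *)
Definition in_balls s (y : E) :=
  forall c r, (forall v, v \in s -> `|v - c| <= r) -> `|y - c| <= r.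

Lemma supported_lcone b (P Q : set (seq E)) (c : L) :
  (forall t, P t -> Q (b :: t)) -> supported P c -> supported Q (lcone b c).
Proof.
by move=> PQ; apply: supported_fglift => t Pt; apply: supportedU; exact: PQ.
Qed.

Lemma supported_lbd s :
  supported [set t | (size t).+1 = size s /\ {subset t <= s}] (lbd << s >>).
Proof.
rewrite lbd1; elim: s => [|b s ih] /=; first exact: supported0.
apply: supportedB.
  by apply: supportedU; split => // x xs; rewrite inE xs orbT.
apply: supported_lcone ih => t [ts st]; split => [/=|x]; first by rewrite ts.
by rewrite !inE => /orP[->//|/st->]; rewrite orbT.
Qed.

Lemma barycenterB s c : s != [::] ->
  barycenter s - c = (size s)%:R^-1 *: \sum_(x <- s) (x - c).
Proof.
move=> s0; rewrite big_split /= big_const_seq count_predT iter_addr_0 scalerDr.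
congr (_ + _); rewrite -[X in _ *: X]scaler_nat scalerA mulVf ?scale1r // pnatr_eq0.
by case: s s0.
Qed.

Lemma norm_barycenterB s c r : s != [::] ->
  \sum_(x <- s) `|x - c| <= (size s)%:R * r -> `|barycenter s - c| <= r.
Proof.
move=> s0 le_r; rewrite barycenterB // normrZ normfV normr_nat.
rewrite ler_pdivrMl ?ltr0n; last by case: s s0 le_r.
exact: le_trans (ler_norm_sum _ _ _) le_r.
Qed.

Lemma barycenter_in_balls s : s != [::] -> in_balls s (barycenter s).
Proof.
move=> s0 c r h; apply: norm_barycenterB => //.
rewrite big_seq; apply: le_trans (ler_sum _ h) _.
by rewrite -big_seq big_const_seq count_predT iter_addr_0 mulr_natl.
Qed.

(** Among the differences averaged, the one at v itself vanishes, so one term in [size s] is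
    saved. *)
Lemma norm_barycenter_vertex s d v : v \in s ->
  (forall x y, x \in s -> y \in s -> `|x - y| <= d) ->
  `|barycenter s - v| <= (1 - (size s)%:R^-1) * d.
Proof.
move=> vs h; have s0 : s != [::] by case: s vs h.
apply: norm_barycenterB => //; rewrite (big_rem v) //= subrr normr0 add0r.
rewrite mulrA mulrBr mulr1 divff; last by rewrite pnatr_eq0; case: s s0 vs h.
have hs : size s = (size (rem v s)).+1 by rewrite size_rem // prednK //; case: s s0 vs h.
rewrite hs -natr1 addrK big_seq.
apply: le_trans (ler_sum _ (fun x xs => h x v (mem_rem xs) vs)) _.
by rewrite -big_seq big_const_seq count_predT iter_addr_0 mulr_natl.
Qed.

(** A simplex of the subdivision is the barycenter joined to a simplex of a subdivided face. Pairs
    within the face shrink by the smaller factor of the induction; pairs with the barycenter are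
    handled by [norm_barycenter_vertex]. *)
Lemma lsd_small n s d : size s = n ->
  (forall x y, x \in s -> y \in s -> `|x - y| <= d) ->
  supported [set t | [/\ size t = n, (forall y, y \in t -> in_balls s y) &
    forall x y, x \in t -> y \in t -> `|x - y| <= (1 - n%:R^-1) * d]]
  (lsd n << s >>).
Proof.
elim: n s => [|n ih] s sn h; first by case: s sn h => // _ _; apply: supportedU.
have s0 : s != [::] by case: s sn h.
have d0 : 0 <= d.
  by case: s sn h s0 => // v s _ h _; have := h v v; rewrite subrr normr0; apply; rewrite inE eqxx.
have hn : 0 <= (1 - n.+1%:R^-1) * d.
  by rewrite mulr_ge0 // subr_ge0 invf_le1 ?ltr0n // ler1n.
rewrite lsdS1; apply: (@supported_lcone _ [set t | [/\ size t = n,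
   (forall y, y \in t -> in_balls s y) &
    forall x y, x \in t -> y \in t -> `|x - y| <= (1 - n.+1%:R^-1) * d]]).
  move=> t [tn tb td]; split => [/=|y|x y].
  - by rewrite tn.
  - by rewrite inE => /orP[/eqP->|/tb//]; exact: barycenter_in_balls.
  (* A ball about the barycenter that contains the vertices of [s] contains every point of the
     subdivided faces. *)
  have key z : z \in t -> `|barycenter s - z| <= (1 - n.+1%:R^-1) * d.
    move=> /tb zs; rewrite distrC; apply: zs => v vs.
    by rewrite distrC -sn; exact: norm_barycenter_vertex.
  rewrite !inE => /orP[/eqP->|xt] /orP[/eqP->|yt].
  - by rewrite subrr normr0.
  - exact: key.
  - by rewrite distrC; exact: key.
  - exact: td.
have /= := @supported_fglift _ _ (fun u => lsd n << u >>) _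
  [set t | [/\ size t = n,
   (forall y, y \in t -> in_balls s y) &
    forall x y, x \in t -> y \in t -> `|x - y| <= (1 - n.+1%:R^-1) * d]]
  (lbd << s >>) _ (@supported_lbd s).
rewrite (_ : fglift _ _ = lsd n (lbd << s >>)); last first.
  apply: (@freeg_morph_ext _ _ (fglift (fun u => lsd n << u >>))
    (lsd n : {additive _ -> _})) => u /=.
  by rewrite fglift1.
apply=> u [us usub].
have un : size u = n by move: us; rewrite sn => -[].
apply: supportedW (ih u un _) => [t [tn tb td]|x y xu yu]; last first.
  by apply: h; exact: usub.
split => //.
  by move=> y yt c r hc; apply: tb => // v vu; apply: hc; exact: usub.
move=> x y xt yt; apply: le_trans (td _ _ xt yt) _.
rewrite ler_wpM2r // lerB //.
case: n {ih un sn hn td us} tn xt => [|n] tn xt; first by case: t tn xt {yt tb}.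
by rewrite lef_pV2 ?posrE ?ltr0n // ler_nat.
Qed.

Lemma iter_lsd_small r n s d : size s = n ->
  (forall x y, x \in s -> y \in s -> `|x - y| <= d) ->
  supported [set t | size t = n /\
    forall x y, x \in t -> y \in t -> `|x - y| <= (1 - n%:R^-1) ^+ r * d]
  (iter r (lsd n) << s >>).
Proof.
elim: r => [|r ih] sn h /=.
  by apply: supportedU; split => // x y xs ys; rewrite expr0 mul1r; exact: h.
rewrite (_ : lsd n _ = fglift (fun u => lsd n << u >>) (iter r (lsd n) << s >>)).
  apply: supported_fglift (ih sn h) => u [un hu].
  apply: supportedW (lsd_small un hu) => t [tn _ ht]; split => // x y xt yt.
  by rewrite exprS -mulrA; exact: ht.
apply: (@freeg_morph_ext _ _ (lsd n : {additive _ -> _})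
  (fglift (fun u => lsd n << u >>))) => u /=.
by rewrite fglift1.
Qed.

Section Convex.
Variable (K : set E).
Hypothesis K_barycenter :
  forall s, s != [::] -> (forall x, x \in s -> K x) -> K (barycenter s).

Let inK n := [set s : seq E | size s = n /\ forall x, x \in s -> K x].

Lemma lbd_inK n s : inK n.+1 s -> supported (inK n) (lbd << s >>).
Proof.
move=> [sn sK]; apply: supportedW (@supported_lbd s) => t [].
by rewrite sn => -[tn] ts; split => // x /ts /sK.
Qed.

Lemma lcone_inK n s (c : L) : inK n.+1 s -> supported (inK n) c ->
  supported (inK n.+1) (lcone (barycenter s) c).
Proof.
move=> [sn sK]; apply: supported_lcone => t [tn tK]; split => [/=|x].
  by rewrite tn.
rewrite inE => /orP[/eqP->|/tK//]; apply: K_barycenter => //.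
by case: s sn {sK}.
Qed.

Lemma lsd_convex n (c : L) : supported (inK n) c -> supported (inK n) (lsd n c).
Proof.
elim: n c => [//|n ih] c; apply: supported_fglift => s sK.
by apply: lcone_inK => //; apply: ih; exact: lbd_inK.
Qed.

Lemma ltel_convex n (c : L) : supported (inK n) c -> supported (inK n.+1) (ltel n c).
Proof.
elim: n c => [|n ih] c; first by move=> _; exact: supported0.
apply: supported_fglift => s sK.
apply: (@supported_lcone _ (inK n.+1)) => [t [tn tK]|]; last first.
  by apply: supportedB; [exact: supportedU|apply: ih; exact: lbd_inK].
split => [/=|x]; first by rewrite tn.
case: sK => sn sK; rewrite inE => /orP[/eqP->|/tK//]; apply: K_barycenter => //.
by case: s sn {sK}.
Qed.

Lemma iter_lsd_convex r n (c : L) :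
  supported (inK n) c -> supported (inK n) (iter r (lsd n) c).
Proof. by move=> h; elim: r => [//|r ih] /=; exact: lsd_convex. Qed.

Lemma ltels_convex r n (c : L) :
  supported (inK n) c -> supported (inK n.+1) (ltels r n c).
Proof.
elim: r c => [|r ih] c h /=; first exact: supported0.
by apply: supportedD; [exact: ltel_convex|apply: ih; exact: lsd_convex].
Qed.

End Convex.

End SubdivisionEstimates.

(** * Affine simplices inside the standard simplex *)

Section StandardSimplex.
Variable (R : realType).

Lemma std_simplex_le1 m (x : 'rV[R]_m.+1) i : std_simplex R m x -> x 0 i <= 1.
Proof.
move=> [x0 <-]; rewrite (bigD1 i) //= lerDl; apply: sumr_ge0 => j _; exact: x0.
Qed.

Lemma std_simplex_barycenter m (s : seq 'rV[R]_m.+1) : s != [::] ->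
  (forall x, x \in s -> std_simplex R m x) -> std_simplex R m (barycenter s).
Proof.
move=> s0 sD; rewrite /barycenter; split => [i|].
  rewrite mxE mulr_ge0 ?invr_ge0 // summxE big_seq; apply: sumr_ge0 => x xs.
  by have [+ _] := sD x xs; apply.
under eq_bigr do rewrite mxE summxE.
rewrite -mulr_sumr exchange_big /= big_seq.
under eq_bigr => x xs do rewrite (sD x xs).2.
rewrite -big_seq big_const_seq count_predT iter_addr_0 mulVf // pnatr_eq0.
by case: s s0 sD.
Qed.

Lemma face_row_is_linear k (i : 'I_k.+2) : linear (@face_row R k i).
Proof.
move=> a x y; apply/rowP => j; rewrite !mxE.
by case: unlift => [j'|] /=; rewrite ?mxE // mulr0 addr0.
Qed.

HB.instance Definition _ k (i : 'I_k.+2) :=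
  GRing.isLinear.Build R 'rV[R]_k.+1 'rV[R]_k.+2 _ (@face_row R k i)
    (@face_row_is_linear k i).

Definition aff_row m k (s : seq 'rV[R]_m.+1) (t : 'rV[R]_k.+1) : 'rV[R]_m.+1 :=
  \sum_(i < k.+1) t 0 i *: nth 0 s i.

Definition simplex_seq m k : set (seq 'rV[R]_m.+1) :=
  [set s | size s = k.+1 /\ forall x, x \in s -> std_simplex R m x].

Lemma aff_row_simplex m k (s : seq 'rV[R]_m.+1) t : simplex_seq k s ->
  std_simplex R k t -> std_simplex R m (aff_row s t).
Proof.
move=> [sk sD] [t0 t1].
have nD (i : 'I_k.+1) : std_simplex R m (nth 0 s i).
  by apply: sD; rewrite mem_nth // sk.
split => [j|].
  rewrite summxE; apply: sumr_ge0 => i _; rewrite mxE mulr_ge0 //.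
  by have [+ _] := nD i; apply.
under eq_bigr do rewrite summxE.
rewrite exchange_big /= -t1; apply: eq_bigr => i _.
under eq_bigr do rewrite mxE.
by rewrite -mulr_sumr (nD i).2 mulr1.
Qed.

Lemma aff_row_continuous m k (s : seq 'rV[R]_m.+1) :
  continuous (@aff_row m k s).
Proof.
apply: continuous_big => [|i _ t]; first exact: add_continuous.
by apply: cvgZr_tmp; [exact: nbhs_filter|exact: (@coord_continuous R 1 k.+1 0 i t)].
Qed.

Definition aff_map m k (s : seq 'rV[R]_m.+1) (sD : simplex_seq k s)
    (t : std_simplex R k) : std_simplex R m :=
  SigSub (mem_set (aff_row_simplex sD (set_mem (valP t)))).

Lemma aff_map_continuous m k (s : seq 'rV[R]_m.+1) (sD : simplex_seq k s) :
  continuous (aff_map sD).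
Proof.
apply: (@continuous_comp_initial _ _ _ (@set_val _ (std_simplex R m))).
move=> x; apply: (@continuous_comp _ _ _ set_val (@aff_row m k s)).
  exact: initial_continuous.
exact: aff_row_continuous.
Qed.

HB.instance Definition _ m k s sD :=
  isContinuous.Build _ _ (@aff_map m k s sD) (@aff_map_continuous m k s sD).

Definition del_nth (T : Type) i (s : seq T) := take i s ++ drop i.+1 s.

Lemma nth_del_nth (T : Type) (x0 : T) i s j : (i < size s)%N ->
  nth x0 (del_nth i s) j = nth x0 s (bump i j).
Proof.
move=> si; rewrite /del_nth nth_cat size_take si /bump nth_drop.
have [ji|ij] := ltnP j i; first by rewrite nth_take // add0n.
by rewrite add1n; congr nth; lia.
Qed.

Lemma size_del_nth (T : Type) i (s : seq T) : (i < size s)%N ->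
  size (del_nth i s) = (size s).-1.
Proof. by move=> si; rewrite size_cat size_take si size_drop; lia. Qed.

(** Matches the recursive boundary with the alternating sum of singular homology: each cone step
    contributes one minus sign and shifts the deleted index by one. *)
Lemma lbd_sum (E : lmodType R) (s : seq E) : lbd << s >> =
  \sum_(i < size s) << (-1) ^+ i *g del_nth i s >> :> {freeg (seq E) / int}.
Proof.
rewrite lbd1; elim: s => [|b s ih] /=; first by rewrite big_ord0.
rewrite big_ord_recl /= /del_nth /= drop0 ih; congr (_ + _).
rewrite raddf_sum -sumrN; apply: eq_bigr => i _ /=.
by rewrite /lcone liftU -freegUZ freegUN /bump add1n exprS mulN1r.
Qed.

Lemma aff_row_face m k (s : seq 'rV[R]_m.+1) (i : 'I_k.+2) (t : 'rV[R]_k.+1) :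
  size s = k.+2 -> aff_row s (face_row i t) = aff_row (del_nth i s) t.
Proof.
move=> sk; rewrite /aff_row (bigD1_ord i) //= mxE unlift_none /= scale0r add0r.
apply: eq_bigr => j _; rewrite mxE liftK /= nth_del_nth //.
by rewrite sk.
Qed.

Definition vertices m : seq 'rV[R]_m.+1 :=
  [seq delta_mx 0 i | i <- enum 'I_m.+1].

Lemma delta_simplex m (i : 'I_m.+1) : std_simplex R m (delta_mx 0 i).
Proof.
split => [j|]; first by rewrite mxE.
rewrite (bigD1 i) //= big1 => [|j ji]; rewrite mxE eqxx ?eqxx ?addr0 //=.
by rewrite (negbTE ji).
Qed.

Lemma size_vertices m : size (vertices m) = m.+1.
Proof. by rewrite size_map size_enum_ord. Qed.

Lemma nth_vertices m (i : 'I_m.+1) : nth 0 (vertices m) i = delta_mx 0 i.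
Proof. by rewrite (nth_map i) ?size_enum_ord // nth_ord_enum. Qed.

Lemma vertices_simplex m : simplex_seq m (vertices m).
Proof.
split; first exact: size_vertices.
by move=> x /mapP[i _ ->]; exact: delta_simplex.
Qed.

Lemma aff_row_vertices m (t : 'rV[R]_m.+1) : aff_row (vertices m) t = t.
Proof.
rewrite {2}[t]row_sum_delta /aff_row.
by apply: eq_bigr => i _; rewrite nth_vertices.
Qed.

Lemma face_row_delta k (i : 'I_k.+2) j :
  face_row i (delta_mx 0 j) = delta_mx 0 (fintype.lift i j) :> 'rV[R]_k.+2.
Proof.
apply/rowP => l; rewrite !mxE /=; case: unliftP => [l' ->|->] /=.
  by rewrite mxE /= (inj_eq lift_inj).
by rewrite (negbTE (neq_lift _ _)).
Qed.

Lemma map_face_vertices k (i : 'I_k.+2) :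
  map (face_row i) (vertices k) = del_nth i (vertices k.+1).
Proof.
have si : (i < size (vertices k.+1))%N by rewrite size_vertices.
apply: (@eq_from_nth _ 0) => [|j].
  by rewrite size_map size_del_nth // !size_vertices.
rewrite size_map size_vertices => jk.
rewrite (nth_map 0) ?size_vertices // nth_del_nth //.
by rewrite (nth_vertices (Ordinal jk)) face_row_delta -nth_vertices.
Qed.

End StandardSimplex.

Arguments vertices R m : clear implicits.
Arguments simplex_seq R m k : clear implicits.

(** * Subdivision of singular chains *)

Section Pushforward.
Variables (R : realType) (X : topologicalType).

Local Notation simp := (sing_simplex R X).
Local Notation chain := (sing_chain R X).
Local Notation L m := {freeg (seq 'rV[R]_m.+1) / int}.

Definition simplex_in (A : set X) k : set (simp k) :=
  [set s | forall t, A ((s : continuousType _ _) t)].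

(** The default 0 on lists that are not simplices makes [push] total and additive; identities that
    rely on genuine simplices carry a support hypothesis. *)
Definition push1 m (sg : simp m) k (s : seq 'rV[R]_m.+1) : chain k :=
  if pselect (simplex_seq R m k s) is left sD
  then << ((sg : continuousType _ _) \o aff_map sD : simp k) >> else 0.

Definition push m (sg : simp m) k : L m -> chain k := fglift (push1 sg k).

HB.instance Definition _ m sg k := GRing.Additive.copy (@push m sg k)
  (fglift (push1 sg k)).

Lemma pushE m (sg : simp m) k s (sD : simplex_seq R m k s) :
  push sg k << s >> = << ((sg : continuousType _ _) \o aff_map sD : simp k) >>.
Proof.
rewrite /push fglift1 /push1; case: pselect => // sD'.
by rewrite (Prop_irrelevance sD sD').
Qed.

Lemma push_in A m (sg : simp m) k c :
  simplex_in A sg -> supported (@simplex_in A k) (push sg k c).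
Proof.
move=> sA; apply: (@supported_fglift _ _ _ setT) => // s _.
rewrite /push1; case: pselect => [sD|_]; last exact: supported0.
by apply: supportedU => t; exact: sA.
Qed.

Lemma sing_boundary1 k (s : simp k.+1) :
  sing_boundary (<< s >> : chain k.+1) =
  \sum_(i < k.+2) << (-1) ^+ i *g sing_face i s >>.
Proof. exact: fglift1. Qed.

Lemma push_boundary m (sg : simp m) k (c : L m) :
  supported (simplex_seq R m k.+1) c ->
  sing_boundary (push sg k.+1 c) = push sg k (lbd c).
Proof.
apply: (@freeg_morph_ext_in _ _
  (@sing_boundary R X k \o push sg k.+1 : {additive _ -> _})
  (push sg k \o @lbd R _ : {additive _ -> _})) => s sD /=.
rewrite (pushE _ sD) sing_boundary1 lbd_sum raddf_sum /=.
have [sk sS] := sD; rewrite sk; apply: eq_bigr => i _.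
rewrite [in LHS]freegU_Mz [in RHS]freegU_Mz raddfMz; congr (_ *~ _).
have si : (i < size s)%N by rewrite sk.
have dD : simplex_seq R m k (del_nth i s).
  split; first by rewrite size_del_nth // sk.
  by move=> x; rewrite mem_cat => /orP[/mem_take|/mem_drop]; exact: sS.
rewrite /= (pushE _ dD); congr << _ >>; apply/continuousEP => t /=.
congr (_ _); apply: val_inj; exact: aff_row_face.
Qed.

Lemma push_face m (sg : simp m.+1) (i : 'I_m.+2) k (c : L m) :
  supported (simplex_seq R m k) c ->
  push (sing_face i sg) k c = push sg k (lmap (face_row i) c).
Proof.
apply: (@freeg_morph_ext_in _ _
  (push (sing_face i sg) k : {additive _ -> _})
  (push sg k \o lmap (face_row i) : {additive _ -> _})) => s sD /=.
have fD : simplex_seq R m.+1 k (map (face_row i) s).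
  have [sk sS] := sD; split; first by rewrite size_map.
  by move=> x /mapP[y /sS ys ->]; exact: face_row_std_simplex.
rewrite lmap1 (pushE _ sD) (pushE _ fD); congr << _ >>.
apply/continuousEP => t /=; congr (_ _); apply: val_inj => /=.
rewrite /aff_row linear_sum; apply: eq_bigr => j _.
rewrite linearZ /= (nth_map 0) //.
by have [-> _] := sD.
Qed.

Lemma push_vertices m (sg : simp m) : push sg m << vertices R m >> = << sg >>.
Proof.
rewrite (pushE _ (vertices_simplex R m)); congr << _ >>.
apply/continuousEP => t /=; congr (_ _); apply: val_inj => /=.
exact: aff_row_vertices.
Qed.

(** The universal simplex is subdivided once and transported along [sg]; compatibility with faces is
    then [push_face] and naturality of the linear operators. *)
Definition sing_sd r m : chain m -> chain m :=
  fglift (fun sg : simp m => push sg m (iter r (lsd m.+1) << vertices R m >>)).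

HB.instance Definition _ r m := GRing.Additive.copy (@sing_sd r m)
  (fglift (fun sg : simp m => push sg m (iter r (lsd m.+1) << vertices R m >>))).

Definition sing_tel r m : chain m -> chain m.+1 :=
  fglift (fun sg : simp m => push sg m.+1 (ltels r m.+1 << vertices R m >>)).

HB.instance Definition _ r m := GRing.Additive.copy (@sing_tel r m)
  (fglift (fun sg : simp m => push sg m.+1 (ltels r m.+1 << vertices R m >>))).

Lemma ltels_vertices r m :
  supported (simplex_seq R m m.+1) (ltels r m.+1 << vertices R m >>).
Proof.
apply: (@ltels_convex R _ (std_simplex R m)).
  exact: std_simplex_barycenter.
by apply: supportedU; exact: vertices_simplex.
Qed.

(** For one simplex the homotopy formula has a correction term, which naturality under the face
    inclusions identifies with the homotopy applied to the boundary; on cycles it vanishes. *)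
Lemma sing_tel_boundary r m (c : chain m) : is_cycle c ->
  sing_boundary (sing_tel r c) = c - sing_sd r c.
Proof.
have gen (sg : simp m) : sing_boundary (sing_tel r << sg >>) =
    << sg >> - sing_sd r << sg >>
    - push sg m (ltels r m (lbd << vertices R m >>)).
  rewrite {1}/sing_tel fglift1 push_boundary; last exact: ltels_vertices.
  by rewrite lbd_ltels !raddfB /= push_vertices /sing_sd fglift1 addrAC.
case: m c gen => [|m] c gen cc.
  have H : (fun c => sing_boundary (sing_tel r c)) =1 (fun c : chain 0%N => c - sing_sd r c).
    apply: (@freeg_morph_ext _ _ (@sing_boundary R X 0%N \o @sing_tel r 0%N : {additive _ -> _})
      (idfun \- @sing_sd r 0 : {additive _ -> _})) => sg /=.
    rewrite gen -[RHS]subr0; congr (_ - _).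
    (* The linear complex is augmented: the boundary of a vertex is the empty list and not 0. Depth
       0 removes it. *)
    have -> : forall c : L 0%N, ltels r 0%N c = 0.
      by elim: r {gen} => [//|r ih] d /=; rewrite ih addr0.
    exact: raddf0.
  exact: H.
have H : (fun c => sing_boundary (sing_tel r c)) =1
   (fun c : chain m.+1 => c - sing_sd r c - sing_tel r (sing_boundary c)).
  apply: (@freeg_morph_ext _ _ (@sing_boundary R X m.+1 \o @sing_tel r m.+1 : {additive _ -> _})
    (idfun \- @sing_sd r m.+1 \- (@sing_tel r m \o @sing_boundary R X m) : {additive _ -> _})) => sg /=.
  rewrite gen; congr (_ - _).
  rewrite sing_boundary1 lbd_sum size_vertices !raddf_sum /= ?raddf_sum /=.
  apply: eq_bigr => i _; rewrite [in LHS]freegU_Mz [in RHS]freegU_Mz !raddfMz /= ?raddfMz.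
  congr (_ *~ _); rewrite -map_face_vertices -lmap1 -lmap_ltels -push_face.
    by rewrite /sing_tel fglift1.
  exact: ltels_vertices.
rewrite [LHS]H; move: cc; rewrite /is_cycle => /eqP ->.
by rewrite raddf0 subr0.
Qed.

End Pushforward.

(** * Cycles subordinate to two open sets *)

Section SmallChains.
Variables (R : realType) (X : topologicalType).

Local Notation simp := (sing_simplex R X).
Local Notation chain := (sing_chain R X).

Lemma coord_le_norm m (x : 'rV[R]_m) i : `|x 0 i| <= `|x|.
Proof.
rewrite [leRHS]/Num.Def.normr /= mx_normrE; apply/bigmax_geP; right => /=.
by exists (0, i).
Qed.

Lemma norm_le_coord m (x : 'rV[R]_m) r : 0 <= r ->
  (forall i, `|x 0 i| <= r) -> `|x| <= r.
Proof.
move=> r0 h; rewrite [leLHS]/Num.Def.normr /= mx_normrE; apply/bigmax_leP; split => //.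
by move=> [i j] _ /=; rewrite (ord1 i); exact: h.
Qed.

Lemma std_simplex_compact m : compact (std_simplex R m).
Proof.
apply: bounded_closed_compact.
  exists 1; split => // r r1 x xD; apply: norm_le_coord => [|i].
    by apply: le_trans (ltW r1).
  rewrite ger0_norm; last by have [+ _] := xD; apply.
  by apply: le_trans (ltW r1); exact: std_simplex_le1.
have -> : std_simplex R m =
    (\bigcap_(i : 'I_m.+1) (fun x : 'rV[R]_m.+1 => x 0 i) @^-1` [set r | 0 <= r])
    `&` (fun x : 'rV[R]_m.+1 => \sum_i x 0 i) @^-1` [set 1].
  by apply/seteqP; split => [x [x0 x1]|x [x0 x1]]; split => // i; [move=> _|]; exact: x0.
apply: closedI.
  apply: closed_bigI => i _; apply: closed_comp; last exact: closed_ge.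
  by move=> x _; exact: (@coord_continuous R 1 m.+1 0 i x).
apply: closed_comp; last exact: closed_eq.
move=> x _; apply: (@continuous_big _ _ _ 0 xpredT); first exact: add_continuous.
by move=> i _ y; exact: (@coord_continuous R 1 m.+1 0 i y).
Qed.

(** The Lebesgue number lemma, from the near-covering form of compactness: half of the radius that
    works at x serves all nearby centers and all small e. *)
Lemma simplex_lebesgue (O1 O2 : set X) m (sg : simp m) :
  open O1 -> open O2 -> (forall t, (O1 `|` O2) ((sg : continuousType _ _) t)) ->
  exists2 e : R, 0 < e & forall x : 'rV[R]_m.+1, std_simplex R m x ->
    (forall y : std_simplex R m, `|val y - x| < e -> O1 ((sg : continuousType _ _) y)) \/
    (forall y : std_simplex R m, `|val y - x| < e -> O2 ((sg : continuousType _ _) y)).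
Proof.
move=> oO1 oO2 cov.
pose P (e : R) (x : 'rV[R]_m.+1) :=
  (forall y : std_simplex R m, `|val y - x| < e -> O1 ((sg : continuousType _ _) y)) \/
  (forall y : std_simplex R m, `|val y - x| < e -> O2 ((sg : continuousType _ _) y)).
have key (O : set X) (x : std_simplex R m) : open O -> O ((sg : continuousType _ _) x) ->
    exists2 d : R, 0 < d & forall y : std_simplex R m, `|val y - val x| < d ->
      O ((sg : continuousType _ _) y).
  move=> oO Ox.
  have : open ((sg : continuousType _ _) @^-1` O).
    by apply: open_comp => // y _; exact: cts_fun.
  move=> [W oW WO].
  have : nbhs (val x) W.
    apply: open_nbhs_nbhs; split => //.
    have : (set_val @^-1` W) x by rewrite WO.
    by [].
  move=> /nbhs_ballP[d d0 dW]; exists d => // y yx.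
  suff : (set_val @^-1` W) y by rewrite WO.
  by apply: dW; rewrite -ball_normE /= distrC.
have : \forall e \near 0^'+, std_simplex R m `<=` P e.
  have /compact_near_coveringP/near_covering_withinP := @std_simplex_compact m.
  apply => x xD; pose xx : std_simplex R m := SigSub (mem_set xD).
  have half d : 0 < d -> (\forall e \near 0^'+, e < d / 2 :> R).
    by move=> d0; apply: nbhs_right_lt; rewrite divr_gt0.
  case: (cov xx) => [/(key _ _ oO1)|/(key _ _ oO2)] [d d0 hd];
    exists (ball x (d / 2), [set e | e < d / 2]) => /=.
  - by split; [apply: nbhsx_ballx; rewrite divr_gt0|exact: half].
  - move=> [x' e] /= [xx' ed] _; left => y yx'; apply: hd.
    move: xx'; rewrite -ball_normE /= => xx'.
    rewrite (splitr d) -(subrK x' (val y)) -addrA.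
    apply: le_lt_trans (ler_normD _ _) _; apply: ltrD; last by rewrite distrC.
    exact: lt_trans yx' ed.
  - by split; [apply: nbhsx_ballx; rewrite divr_gt0|exact: half].
  - move=> [x' e] /= [xx' ed] _; right => y yx'; apply: hd.
    move: xx'; rewrite -ball_normE /= => xx'.
    rewrite (splitr d) -(subrK x' (val y)) -addrA.
    apply: le_lt_trans (ler_normD _ _) _; apply: ltrD; last by rewrite distrC.
    exact: lt_trans yx' ed.
move=> h; have : \forall e \near 0^'+, 0 < e /\ std_simplex R m `<=` P e.
  by near=> e; split; [near: e; exact: nbhs_right_gt|near: e].
move=> /filter_ex[e [e0 he]]; by exists e.
Unshelve. all: by end_near. Qed.

Lemma aff_row_dist m k (s : seq 'rV[R]_m.+1) (t : 'rV[R]_k.+1) d :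
  simplex_seq R m k s -> std_simplex R k t ->
  (forall x y, x \in s -> y \in s -> `|x - y| <= d) ->
  `|aff_row s t - nth 0 s 0| <= d.
Proof.
move=> [sk sD] [t0 t1] h.
have -> : aff_row s t - nth 0 s 0 = \sum_(i < k.+1) t 0 i *: (nth 0 s i - nth 0 s 0).
  under eq_bigr do rewrite scalerBr.
  by rewrite big_split /= sumrN -scaler_suml t1 scale1r.
apply: le_trans (ler_norm_sum _ _ _) _.
rewrite -[d]mul1r -t1 mulr_suml; apply: ler_sum => i _.
rewrite normrZ ger0_norm // ler_wpM2l // h // mem_nth ?sk //.
Qed.

Lemma sing_sd_small1 (O1 O2 : set X) m (sg : simp m) :
  open O1 -> open O2 -> (forall t, (O1 `|` O2) ((sg : continuousType _ _) t)) ->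
  \forall r \near \oo, supported (simplex_in O1 (k := m) `|` simplex_in O2 (k := m))
    (sing_sd r << sg >>).
Proof.
move=> oO1 oO2 cov.
have [e e0 he] := simplex_lebesgue oO1 oO2 cov.
(* The row norm is the maximum norm and coordinates lie in [0, 1], so 1 bounds the distances between
   vertices. *)
pose d : R := 1.
have hd x y : x \in vertices R m -> y \in vertices R m -> `|x - y| <= d.
  move=> xv yv; have [_ /(_ _ xv) xD] := vertices_simplex R m.
  have [_ /(_ _ yv) yD] := vertices_simplex R m.
  apply: norm_le_coord => // i; rewrite !mxE ler_norml.
  have := std_simplex_le1 i xD; have := std_simplex_le1 i yD.
  have [/(_ i) + _] := xD; have [/(_ i) + _] := yD; rewrite /d; lra.
have k1 : `|1 - (m.+1%:R : R)^-1| < 1.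
  have i0 : 0 < (m.+1%:R : R)^-1 by rewrite invr_gt0 ltr0n.
  have i1 : (m.+1%:R : R)^-1 <= 1 by rewrite invf_le1 ?ltr0n // ler1n.
  by rewrite ger0_norm ?subr_ge0 // ltrBlDr ltrDl.
have : \forall r \near \oo, `|(1 - (m.+1%:R : R)^-1) ^+ r| < e.
  have /cvgr0Pnorm_lt := cvg_expr k1; exact.
apply: filterS => r re.
rewrite /sing_sd fglift1.
have hs : supported [set t | simplex_seq R m m t /\ forall x y, x \in t -> y \in t ->
     `|x - y| <= (1 - m.+1%:R^-1) ^+ r * d] (iter r (lsd m.+1) << vertices R m >>).
  have h1 := iter_lsd_small (r := r) (size_vertices R m) hd.
  have h2 := @iter_lsd_convex R _ (std_simplex R m) (@std_simplex_barycenter R m) r m.+1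
    << vertices R m >> (supportedU (vertices_simplex R m)).
  by apply: supportedW (supportedI h1 h2) => t [[_ ?] ?].
apply: supported_fglift hs => s [sD hs].
rewrite /push1; case: pselect => // sD'.
apply: supportedU; rewrite mulr1 in hs.
have n0 : nth 0 s 0 \in s by rewrite mem_nth // sD.1.
have hb (u : std_simplex R m) : `|aff_row s (val u) - nth 0 s 0| < e.
  apply: le_lt_trans (le_lt_trans (ler_norm _) re).
  exact: (aff_row_dist sD (set_mem (valP u)) hs).
by case: (he _ (sD.2 _ n0)) => h; [left|right] => u /=; apply: h; exact: hb.
Qed.

Lemma sing_sd_small (O1 O2 : set X) m (c : chain m) :
  open O1 -> open O2 -> supported (simplex_in (O1 `|` O2) (k := m)) c ->
  \forall r \near \oo, supported (simplex_in O1 (k := m) `|` simplex_in O2 (k := m))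
    (sing_sd r c).
Proof.
move=> oO1 oO2 cov.
have : \forall r \near \oo, forall sg, sg \in dom c ->
    supported (simplex_in O1 (k := m) `|` simplex_in O2 (k := m)) (sing_sd r << sg >>).
  move: cov; rewrite /supported; elim: (dom c) => [|sg s ih] cov; first by apply: nearW.
  have h1 := @sing_sd_small1 O1 O2 m sg oO1 oO2 (cov sg (mem_head _ _)).
  have h2 := ih (fun sg' hs => cov sg' (@mem_behead _ (sg :: s) _ hs)).
  near=> r => sg'; rewrite inE => /orP[/eqP->|]; first by near: r.
  by move: sg'; near: r.
apply: filterS => r h; rewrite -[c]freeg_sumE raddf_sum big_seq.
apply: supported_sum => sg /h hsg.
by rewrite freegU_Mz raddfMz; exact: supportedMz.
Unshelve. all: by end_near. Qed.

Lemma supported_split k (P Q : set (simp k)) (c : chain k) :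
  supported (P `|` Q) c ->
  exists u v, [/\ supported P u, supported Q v & c = u + v].
Proof.
move=> h; exists (\sum_(s <- dom c | `[< P s >]) << coeff s c *g s >>).
exists (\sum_(s <- dom c | ~~ `[< P s >]) << coeff s c *g s >>); split.
- by apply: supported_sum => s /asboolP Ps; exact: supportedU.
- rewrite big_seq_cond; apply: supported_sum => s /andP[/h[Ps|Qs]].
    by rewrite asboolT.
  by move=> _; exact: supportedU.
by rewrite -[LHS]freeg_sumE (bigID (fun s => `[< P s >])).
Qed.

(** The excision step. Subdivision and its homotopy only precompose the simplices of z with maps
    into the standard simplex, so every support stays inside A. *)
Lemma small_cycle (A O1 O2 : set X) k (z : chain k) : open O1 -> open O2 ->
  A `<=` O1 `|` O2 -> is_cycle z -> supported (simplex_in A (k := k)) z ->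
  exists u v d, [/\ supported (simplex_in (A `&` O1) (k := k)) u,
    supported (simplex_in (A `&` O2) (k := k)) v,
    supported (simplex_in A (k := k.+1)) d & z = u + v + sing_boundary d].
Proof.
move=> oO1 oO2 AO zz zA.
have zO : supported (simplex_in (O1 `|` O2) (k := k)) z.
  by apply: supportedW zA => s sA t; apply: AO; exact: sA.
have /filter_ex[r hr] := sing_sd_small oO1 oO2 zO.
have hA : supported (simplex_in A (k := k)) (sing_sd r z).
  by apply: supported_fglift zA => s sA; exact: push_in.
have [] := @supported_split k (simplex_in (A `&` O1) (k := k))
  (simplex_in (A `&` O2) (k := k)) (sing_sd r z).
  apply: supportedW (supportedI hr hA) => s [[h|h] sA]; [left|right] => t;
    by split; [exact: sA|exact: h].
move=> u [v [hu hv uv]]; exists u, v, (sing_tel r z); split => //.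
  by apply: supported_fglift zA => s sA; exact: push_in.
by rewrite sing_tel_boundary // -uv addrC subrK.
Qed.

End SmallChains.

(** * Betti numbers of spaces with good covers *)

Section IntegerModules.

(** Euclidean division by a nonzero member of least absolute value. *)
Lemma int_ideal_principal (P : int -> Prop) : P 0 ->
  (forall u v, P u -> P v -> P (u - v)) ->
  exists2 d, P d & forall v, P v -> exists q, v = q * d.
Proof.
move=> P0 PB.
have PN u : P u -> P (- u) by rewrite -sub0r => /(PB _ _ P0).
have PD u v : P u -> P v -> P (u + v) by move=> Pu Pv; rewrite -[v]opprK; apply: PB => //; exact: PN.
have PMn u (n : nat) : P u -> P (u *+ n).
  by move=> Pu; elim: n => [|n ih]; rewrite ?mulr0n // mulrS; exact: PD.
have PM u q : P u -> P (q * u).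
  move=> Pu; have Pn (n : nat) : P (n%:Z * u).
    by rewrite -[n%:Z]intz mulrzl -pmulrn; exact: PMn.
  by case: q => n //; rewrite NegzE mulNr; exact: PN.
have [[u [Pu u0]]|/forallNP nP] := pselect (exists u, P u /\ u != 0); last first.
  exists 0 => // v Pv; exists 0; rewrite mulr0; apply/eqP/negPn/negP => v0.
  by apply: (nP v).
pose Q n := `[< exists u, P u /\ `|u|%N = n.+1 >].
have exQ : exists n, Q n.
  exists `|u|%N.-1; apply/asboolP; exists u; split => //.
  by rewrite prednK // lt0n absz_eq0.
case: (ex_minnP exQ) => n /asboolP[d [Pd dn]] dmin.
exists d => // v Pv; exists (v %/ d)%Z.
have d0 : d != 0 by rewrite -absz_eq0 dn.
have Pr : P (v %% d)%Z.
  have -> : (v %% d)%Z = v - (v %/ d)%Z * d by rewrite {2}(divz_eq v d) addrC addKr.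
  by apply: PB => //; exact: PM.
have [r0|r0] := eqVneq (v %% d)%Z 0; first by rewrite {1}(divz_eq v d) r0 addr0.
have := @dmin `|(v %% d)%Z|%N.-1.
have r1 : (0 < `|(v %% d)%Z|)%N by rewrite lt0n absz_eq0.
have /[swap]/[apply] : Q `|(v %% d)%Z|%N.-1.
  by apply/asboolP; exists (v %% d)%Z; rewrite prednK.
have := ltz_mod v d0; have := modz_ge0 v d0; lia.
Qed.

(** Induction on the number of coordinates: a member whose first coordinate generates the ideal of
    first coordinates, together with generators of the members with first coordinate 0. *)
Lemma int_submodule_gen c (P : 'rV[int]_c -> Prop) : P 0 ->
  (forall u v, P u -> P v -> P (u - v)) ->
  exists M : 'M[int]_c, (forall i, P (row i M)) /\
    forall v, P v -> exists u, v = u *m M.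
Proof.
elim: c P => [|c ih] P P0 PB.
  exists 0; split => [[]//|v _]; exists 0.
  by apply/rowP => -[].
have PN u : P u -> P (- u) by rewrite -sub0r => /(PB _ _ P0).
have PZ u q : P u -> P (q *: u).
  have PD w v : P w -> P v -> P (w + v) by move=> Pw Pv; rewrite -[v]opprK; apply: PB => //; exact: PN.
  move=> Pu; have PMn (n : nat) : P (u *+ n).
    by elim: n => [|n ihn]; rewrite ?mulr0n // mulrS; exact: PD.
  have Pn (n : nat) : P (n%:Z *: u).
    by rewrite -[n%:Z]intz scaler_int -pmulrn; exact: PMn.
  by case: q => n //; rewrite NegzE scaleNr; exact: PN.
have [] := ih (fun v => P (row_mx (0 : 'rV_1) v : 'rV[int]_((1 + c)%N))).
- by rewrite row_mx0.
- move=> u v Pu Pv; have := PB _ _ Pu Pv; congr P; apply/rowP => i.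
  by rewrite !mxE; case: fintype.split => j; rewrite !mxE ?subr0.
move=> M [rM gM].
have [] := @int_ideal_principal (fun a => exists2 v, P v & v 0 0 = a).
- by exists 0 => //; rewrite mxE.
- by move=> _ _ [u Pu <-] [v Pv <-]; exists (u - v); [exact: PB|rewrite !mxE].
move=> d [g Pg gd] hd.
pose N : 'M[int]_(c, (1 + c)%N) := row_mx (0 : 'cV_c) M.
exists (col_mx (g : 'rV_((1 + c)%N)) N); split.
  move=> i; rewrite -[X in row X _](@splitK 1 c); case: (@fintype.split 1 c i) => j /=.
    by rewrite (@rowKu _ 1 c) (ord1 j) row_id.
  rewrite (@rowKd _ 1 c); have -> : row j N = row_mx 0 (row j M); last exact: rM.
  by apply/rowP => l; rewrite !mxE; case: fintype.split => l'; rewrite !mxE.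
move=> v Pv; have [|q vq] := hd (v 0 0); first by exists v.
pose w : 'rV[int]_((1 + c)%N) := v - q *: g.
have Pw : P w by apply: PB => //; exact: PZ.
have w0 : w = row_mx 0 (rsubmx w).
  rewrite -[LHS]hsubmxK; congr row_mx; apply/rowP => i; rewrite !mxE (ord1 i).
  rewrite [lshift _ _](_ : _ = ord0 :> 'I_c.+1); last exact: val_inj.
  by move: gd vq; rewrite -[0 : 'I_c.+1]/ord0 => -> ->; rewrite subrr.
have [u wu] : exists u, rsubmx w = u *m M by apply: gM; rewrite -w0.
exists (row_mx q%:M u : 'rV[int]_((1 + c)%N)).
have uN : u *m N = row_mx 0 (u *m M).
  by rewrite /N; apply: etrans (@mul_mx_row _ 1 c 1 c u 0 M) _; rewrite mulmx0.
rewrite (@mul_row_col _ _ 1 c) mul_scalar_mx uN -wu -w0.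
by rewrite addrC subrK.
Qed.

(** A rational kernel vector exists by rank, and the product [D] of its denominators makes it
    integral. *)
Lemma int_left_kernel m c (M : 'M[int]_(m, c)) : (c < m)%N ->
  exists2 r : 'rV[int]_m, r != 0 & r *m M = 0.
Proof.
move=> cm; pose N := map_mx (intr : int -> rat) M.
have [u u0 uN] : exists2 u : 'rV[rat]_m, u != 0 & u *m N = 0.
  have : kermx N != 0.
    rewrite -mxrank_eq0 mxrank_ker -lt0n subn_gt0.
    exact: leq_ltn_trans (rank_leq_col _) cm.
  move=> /rowV0Pn[u /sub_kermxP uN u0]; by exists u.
pose D := \prod_i denq (u 0 i).
have D0 : D != 0 by apply/prodf_neq0 => i _; exact: denq_neq0.
pose r := \row_j (numq (u 0 j) * \prod_(i | i != j) denq (u 0 i)).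
have rE : map_mx (intr : int -> rat) r = D%:~R *: u.
  apply/rowP => j; rewrite !mxE.
  have -> : D = denq (u 0 j) * \prod_(i | i != j) denq (u 0 i) by rewrite /D (bigD1 j).
  rewrite !intrM -[X in _ = _ * X]divq_num_den; field.
  by rewrite intr_eq0 denq_neq0.
exists r.
  apply: contra_neq u0 => r0; move: rE; rewrite r0 map_mx0 => /esym/eqP.
  by rewrite scaler_eq0 intr_eq0 (negbTE D0) => /eqP.
have e : map_mx (intr : int -> rat) (r *m M) = 0.
  by rewrite map_mxM rE -scalemxAl uN scaler0.
apply/rowP => j; move/rowP: e => /(_ j); rewrite mxE [RHS]mxE => /eqP.
by rewrite intr_eq0 => /eqP ->; rewrite mxE.
Qed.

End IntegerModules.

(** * The Mayer-Vietoris bound on numbers of generators *)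

Section MayerVietoris.
Variables (R : realType) (X : topologicalType).

Local Notation chain := (sing_chain R X).
Local Notation sup A k := (supported (@simplex_in R X A k)).

Lemma sing_boundary_boundary k (c : chain k.+2) :
  sing_boundary (sing_boundary c) = 0.
Proof.
apply: (@freeg_morph_ext _ _
  (@sing_boundary R X k \o @sing_boundary R X k.+1 : {additive _ -> _})
  (\0 : {additive _ -> _}) _ c) => s /=.
have vS := @vertices_simplex R k.+2.
rewrite -[<< s >>]push_vertices push_boundary; last exact: supportedU.
rewrite push_boundary ?lbd_lbd ?raddf0 //.
apply: supportedW (@supported_lbd R _ (vertices R k.+2)) => t [].
by rewrite size_vertices => -[tk] tv; split => // x /tv; exact: vS.2.
Qed.

Lemma is_cycle_boundary k (c : chain k.+1) : is_cycle (sing_boundary c).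
Proof. by case: k c => [//|k] c; apply/eqP; exact: sing_boundary_boundary. Qed.

Lemma is_cycleS k (c : chain k.+1) : is_cycle c = (sing_boundary c == 0).
Proof. by []. Qed.

Lemma boundary_in A k (c : chain k.+1) : sup A k.+1 c -> sup A k (sing_boundary c).
Proof.
apply: supported_fglift => s sA; apply: supported_sum => i _.
by apply: supportedU => t; exact: sA.
Qed.

(** Generation of the homology of A in degree k by n classes, at chain level in X, without forming
    the group of A. Generation is all that an upper bound on the rank uses. *)
Definition hgen A k n := exists w : 'I_n -> chain k,
  (forall i, is_cycle (w i) /\ sup A k (w i)) /\
  forall z, is_cycle z -> sup A k z -> exists (a : 'rV[int]_n) d,
    sup A k.+1 d /\ z = \sum_i w i *~ a 0 i + sing_boundary d.

Definition fcat (V : Type) m n (w1 : 'I_m -> V) (w2 : 'I_n -> V) (i : 'I_(m + n)) : V :=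
  match fintype.split i with inl j => w1 j | inr j => w2 j end.

Lemma sum_fcat (V : zmodType) m n (w1 : 'I_m -> V) (w2 : 'I_n -> V)
    (a : 'rV[int]_m) (b : 'rV[int]_n) :
  \sum_i fcat w1 w2 i *~ (row_mx a b) 0 i =
  \sum_i w1 i *~ a 0 i + \sum_i w2 i *~ b 0 i.
Proof.
rewrite big_split_ord /=; congr (_ + _); apply: eq_bigr => i _.
  by rewrite row_mxEl /fcat (unsplitK (inl i)).
by rewrite row_mxEr /fcat (unsplitK (inr i)).
Qed.

Lemma fcatP (V : Type) (P : V -> Prop) m n (w1 : 'I_m -> V) (w2 : 'I_n -> V) :
  (forall i, P (w1 i)) -> (forall i, P (w2 i)) -> forall i, P (fcat w1 w2 i).
Proof. by move=> h1 h2 i; rewrite /fcat; case: fintype.split. Qed.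

Section Cover.
Variables (A O1 O2 : set X).
Hypotheses (oO1 : open O1) (oO2 : open O2) (AO : A `<=` O1 `|` O2).

Let sup1 k c : sup (A `&` O1) k c -> sup A k c.
Proof. by apply: supportedW => s h t; have [] := h t. Qed.

Let sup2 k c : sup (A `&` O2) k c -> sup A k c.
Proof. by apply: supportedW => s h t; have [] := h t. Qed.

Let sup12 k c : sup (A `&` O1 `&` O2) k c -> sup (A `&` O1) k c.
Proof. by apply: supportedW => s h t; have [] := h t. Qed.

Let sup21 k c : sup (A `&` O1 `&` O2) k c -> sup (A `&` O2) k c.
Proof. by apply: supportedW => s h t; have [[? ?] ?] := h t. Qed.

Lemma mayer_vietoris0 m n :
  hgen (A `&` O1) 0 m -> hgen (A `&` O2) 0 n -> hgen A 0 (m + n).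
Proof.
move=> [w1 [c1 g1]] [w2 [c2 g2]]; exists (fcat w1 w2); split.
  apply: (@fcatP _ (fun c => is_cycle c /\ sup A 0 c)) => i; split => //; [exact: sup1 (c1 i).2|exact: sup2 (c2 i).2].
move=> z zc zA; have [u [v [d [hu hv hd ->]]]] := small_cycle oO1 oO2 AO zc zA.
have [a [d1 [hd1 ->]]] := g1 u isT hu; have [b [d2 [hd2 ->]]] := g2 v isT hv.
exists (row_mx a b), (d1 + d2 + d); split.
  by apply: supportedD => //; apply: supportedD; [exact: sup1|exact: sup2].
by rewrite sum_fcat !raddfD /= addrACA !addrA.
Qed.

(** Generators come from the two pieces and from lifts of the image of the connecting map. That
    image is described by a subgroup of Z^l, which again has l generators. *)
Lemma mayer_vietoris k m n l :
  hgen (A `&` O1) k.+1 m -> hgen (A `&` O2) k.+1 n ->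
  hgen (A `&` O1 `&` O2) k l -> hgen A k.+1 (m + n + l).
Proof.
move=> [w1 [c1 g1]] [w2 [c2 g2]] [w [c g]].
(* Coefficients of the classes of the intersection that bound in both pieces: [uvd] holds chains u
   and v with opposite boundaries, and the correction d inside the intersection. *)
pose J (al : 'rV[int]_l) := exists uvd : chain k.+1 * chain k.+1 * chain k.+1,
  [/\ sup (A `&` O1) k.+1 uvd.1.1, sup (A `&` O2) k.+1 uvd.1.2,
      sup (A `&` O1 `&` O2) k.+1 uvd.2,
      sing_boundary uvd.1.1 + sing_boundary uvd.1.2 = 0 &
      sing_boundary uvd.1.1 = \sum_i w i *~ al 0 i + sing_boundary uvd.2].
have [||M [rM gM]] := @int_submodule_gen l J.
- exists (0, 0, 0) => /=; split; try exact: supported0.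
    by rewrite !raddf0 addr0.
  by rewrite !raddf0 addr0 big1 // => i _; rewrite mxE mulr0z.
- move=> al be [[[u v] d] /= [hu hv hd uv ue]] [[[u' v'] d'] /= [hu' hv' hd' uv' ue']].
  exists (u - u', v - v', d - d') => /=; split; try exact: supportedB.
    by rewrite !raddfB /= addrACA -opprD uv uv' subr0.
  rewrite !raddfB /= ue ue' opprD addrACA -sumrB; congr (_ + _).
  by apply: eq_bigr => i _; rewrite !mxE mulrzBr.
have [f fP] := choice rM.
pose ys i := (f i).1.1 + (f i).1.2.
exists (fcat (fcat w1 w2) ys); split.
  apply: (@fcatP _ (fun c => is_cycle c /\ sup A k.+1 c)) => [|i].
    apply: (@fcatP _ (fun c => is_cycle c /\ sup A k.+1 c)) => i; split; [exact: (c1 i).1|exact: sup1 (c1 i).2|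
      exact: (c2 i).1|exact: sup2 (c2 i).2].
  have [h1 h2 h3 h4 h5] := fP i; split.
    by rewrite is_cycleS raddfD /= h4.
  by apply: supportedD; [exact: sup1|exact: sup2].
move=> z zc zA; have [u [v [d0 [hu hv hd0 ez]]]] := small_cycle oO1 oO2 AO zc zA.
have uv0 : sing_boundary u + sing_boundary v = 0.
  move: zc; rewrite is_cycleS ez => /eqP.
  by rewrite !raddfD /= sing_boundary_boundary addr0.
have hbu : sup (A `&` O1 `&` O2) k (sing_boundary u).
  have h1 := boundary_in hu.
  have h2 : sup (A `&` O2) k (sing_boundary u).
    have -> : sing_boundary u = - sing_boundary v by apply/eqP; rewrite -addr_eq0 uv0.
    by apply: supportedN; exact: boundary_in.
  apply: supportedW (supportedI h1 h2) => s [s1 s2] t.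
  by have [? ?] := s1 t; have [? ?] := s2 t.
have [al [d [hd ue]]] := g _ (is_cycle_boundary u) hbu.
have [be ebe] : exists be, al = be *m M by apply: gM; exists (u, v, d).
pose comb (F : chain k.+1 * chain k.+1 * chain k.+1 -> chain k.+1) :=
  \sum_i F (f i) *~ be 0 i.
(* Once the lifted combination is subtracted, the boundary of u equals that of [dd], which lies in
   the intersection. Moving [dd] from u to v makes each part a cycle in its own piece. *)
pose dd := d - comb snd.
pose u' := u - comb (fun p => p.1.1) - dd.
pose v' := v - comb (fun p => p.1.2) + dd.
have bdcomb F : sing_boundary (comb F) = \sum_i sing_boundary (F (f i)) *~ be 0 i.
  by rewrite raddf_sum; apply: eq_bigr => i _; rewrite raddfMz.
have supcomb B F : (forall i, sup B k.+1 (F (f i))) -> sup B k.+1 (comb F).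
  by move=> h; apply: supported_sum => i _; exact: supportedMz.
have hdd : sup (A `&` O1 `&` O2) k.+1 dd.
  by apply: supportedB => //; apply: supcomb => i; have [] := fP i.
have u'0 : sing_boundary u' = 0.
  rewrite /u' /dd !raddfB /= !bdcomb ue.
  have -> : \sum_i sing_boundary (f i).1.1 *~ be 0 i =
      \sum_i w i *~ al 0 i + \sum_i sing_boundary (f i).2 *~ be 0 i.
    rewrite ebe; under eq_bigr => i _.
      have [_ _ _ _ ->] := fP i; rewrite mulrzDl mulrz_suml; over.
    rewrite big_split /= exchange_big /=; congr (_ + _).
    apply: eq_bigr => j _; rewrite [in RHS]mxE mulrz_sumr; apply: eq_bigr => i _.
    by rewrite mxE mulrC mulrzA.
  by apply/eqP; rewrite -opprD subr_eq0 opprD addrACA subrr add0r.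
have v'0 : sing_boundary v' = 0.
  have : sing_boundary u' + sing_boundary v' = 0; last by rewrite u'0 add0r.
  rewrite -raddfD /= /u' /v' addrACA [- dd + dd]addrC subrr addr0 addrACA -opprD.
  have bdD (x y : chain k.+1) :
    sing_boundary (x + y) = sing_boundary x + sing_boundary y by exact: raddfD.
  rewrite raddfB /= !bdD uv0 !bdcomb -big_split /= big1 ?subr0 // => i _.
  by rewrite -mulrzDl; have [_ _ _ -> _] := fP i; rewrite mul0rz.
have hu' : sup (A `&` O1) k.+1 u'.
  apply: supportedB; last exact: sup12.
  by apply: supportedB => //; apply: supcomb => i; have [] := fP i.
have hv' : sup (A `&` O2) k.+1 v'.
  apply: supportedD; last exact: sup21.
  by apply: supportedB => //; apply: supcomb => i; have [] := fP i.
have [a [d1 [hd1 e1]]] : exists (a : 'rV[int]_m) d, sup (A `&` O1) k.+2 d /\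
    u' = \sum_i w1 i *~ a 0 i + sing_boundary d.
  by apply: g1 => //; rewrite is_cycleS u'0.
have [b [d2 [hd2 e2]]] : exists (b : 'rV[int]_n) d, sup (A `&` O2) k.+2 d /\
    v' = \sum_i w2 i *~ b 0 i + sing_boundary d.
  by apply: g2 => //; rewrite is_cycleS v'0.
exists (row_mx (row_mx a b) be), (d1 + d2 + d0); split.
  by apply: supportedD => //; apply: supportedD; [exact: sup1|exact: sup2].
rewrite ez !sum_fcat !raddfD /=.
have -> : \sum_i ys i *~ be 0 i = comb (fun p => p.1.1) + comb (fun p => p.1.2).
  by rewrite -big_split /=; apply: eq_bigr => i _; rewrite -mulrzDl.
rewrite addrA; congr (_ + _).
have -> : u = u' + comb (fun p => p.1.1) + dd by rewrite /u' addrAC subrK subrK.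
have -> : v = v' + comb (fun p => p.1.2) - dd by rewrite /v' addrAC addrK subrK.
rewrite addrACA subrr addr0 addrACA e1 e2.
by rewrite [X in X + _ = _]addrACA [RHS]addrAC.
Qed.

End Cover.
End MayerVietoris.

Local Open Scope quotient_scope.

(** * From generators, and from path invariants, to Betti numbers *)

Section BettiBounds.
Variables (R : realType) (X : topologicalType).

Lemma homology_sum_eq0 k m (z : 'I_m -> sing_cycle R X k) (r : 'I_m -> int) :
  \sum_i (\pi_(homology R X k) (z i)) *~ r i = 0 <->
  exists c, sing_boundary c = \sum_i val (z i) *~ r i.
Proof.
have -> : \sum_i \pi_(homology R X k) (z i) *~ r i =
    \pi_(homology R X k) (\sum_i z i *~ r i).
  by rewrite raddf_sum; apply: eq_bigr => i _; rewrite raddfMz.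
have -> : \sum_i val (z i) *~ r i = val (\sum_i z i *~ r i).
  by rewrite raddf_sum; apply: eq_bigr => i _; rewrite raddfMz.
rewrite -(raddf0 \pi_(homology R X k)) /=; split.
  by move/eqP; rewrite -Quotient.idealrBE subr0 unfold_in => /asboolP.
by move=> h; apply/eqP; rewrite -Quotient.idealrBE subr0 unfold_in; apply/asboolP.
Qed.

(** Written in n generators, more than n classes give a coefficient matrix with more rows than
    columns; its integral left kernel is a relation. *)
Lemma betti_le k n : hgen R (@setT X) k n -> (betti R X k <= n%:R%:E)%E.
Proof.
move=> [w [_ g]]; apply: ge_ereal_sup => _ [m [v vfree] <-].
rewrite lee_fin ler_nat leqNgt; apply/negP => nm.
have hz i : exists ad : 'rV[int]_n * sing_chain R X k.+1,
    val (repr (v i)) = \sum_j w j *~ ad.1 0 j + sing_boundary ad.2.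
  have [|a [d [_ e]]] := g (val (repr (v i))) (valP (repr (v i))); first by [].
  by exists (a, d).
have [f fP] := choice hz.
have [r r0 rM] := int_left_kernel (\matrix_(i, j) (f i).1 0 j) nm.
case/eqP: r0; apply/rowP => i; rewrite mxE; apply: (vfree (fun i => r 0 i)).
rewrite (eq_bigr (fun i => \pi_(homology R X k) (repr (v i)) *~ r 0 i)); last first.
  by move=> j _; rewrite reprK.
apply/homology_sum_eq0; exists (\sum_i (f i).2 *~ r 0 i).
rewrite raddf_sum /=.
under [RHS]eq_bigr do rewrite fP mulrzDl mulrz_suml.
rewrite big_split /= exchange_big /= [X in _ = X + _]big1 ?add0r.
  by apply: eq_bigr => j _; rewrite raddfMz.
move=> j _; move/rowP: rM => /(_ j); rewrite !mxE => e.
rewrite -[RHS](mulr0z (w j)) -e mulrz_sumr; apply: eq_bigr => l _.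
by rewrite mxE mulrC mulrzA.
Qed.

Lemma betti_ge0 k : (0 <= betti R X k)%E.
Proof.
apply: ereal_sup_ubound; exists 0%N => //=; exists (fun=> 0) => a _ [].
by [].
Qed.

Lemma total_betti_le N n : (forall k, hgen R (@setT X) k (if (k < N)%N then n else 0)) ->
  (total_betti R X <= (N * n)%:R%:E)%E.
Proof.
move=> h; rewrite /total_betti (@nneseries_split _ _ 0 N); last first.
  by move=> k _; exact: betti_ge0.
rewrite add0n eseries0 ?adde0; last first.
  move=> k Nk _; apply/eqP; rewrite eq_le betti_ge0 andbT.
  by have := betti_le (h k); rewrite ltnNge Nk.
apply: (@le_trans _ _ (\sum_(0 <= k < N) n%:R%:E)%E).
  rewrite big_nat [leRHS]big_nat; apply: lee_sum => k /andP[_ kN].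
  by have := betti_le (h k); rewrite kN.
by rewrite sumEFin lee_fin sumr_const_nat subn0 mulnC natrM mulr_natr.
Qed.

Lemma total_betti_ge0 : (betti R X 0 <= total_betti R X)%E.
Proof.
rewrite /total_betti nneseries_recl // => [|k _]; last exact: betti_ge0.
by rewrite leeDl // nneseries_ge0 // => k _ _; exact: betti_ge0.
Qed.

Definition vertex0 : std_simplex R 0 := SigSub (mem_set (delta_simplex R (@ord0 0))).

Lemma betti0_ge (T : eqType) (phi : X -> T) m (x : 'I_m -> X) :
  (forall (s : sing_simplex R X 1) t t', phi ((s : continuousType _ _) t) = phi ((s : continuousType _ _) t')) ->
  injective (phi \o x) -> (m%:R%:E <= betti R X 0)%E.
Proof.
move=> hphi inj; apply: ereal_sup_ubound; exists m => //=.
pose sx i : sing_simplex R X 0 := cst (x i).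
pose z i : sing_cycle R X 0 := exist _ (<< sx i >> : sing_chain R X 0) isT.
exists (fun i => \pi_(homology R X 0) (z i)) => a /homology_sum_eq0[c ec] j.
(* Counts, with multiplicity, the points sharing the [phi]-value of [x j]. It kills boundaries, as
   [phi] is constant on 1-simplices, and reads off the coefficient [a j]. *)
pose F : {additive sing_chain R X 0 -> int^o} :=
  fglift (fun s : sing_simplex R X 0 =>
    (phi ((s : continuousType _ _) vertex0) == phi (x j))%:R : int^o).
have Fb : F (sing_boundary c) = 0.
  apply: (@freeg_morph_ext _ _ (F \o @sing_boundary R X 0 : {additive _ -> _})
    (\0 : {additive _ -> _}) _ c) => s /=.
  rewrite sing_boundary1 !big_ord_recl big_ord0 addr0 raddfD /=.
  rewrite !liftU expr0 expr1 scale1r scaleN1r /=.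
  by rewrite (hphi s _ (face_map (fintype.lift ord0 ord0) vertex0)) subrr.
have : F (sing_boundary c) = a j.
  rewrite ec raddf_sum /= (bigD1 j) //= big1 => [|i ij].
    by rewrite raddfMz /= fglift1 /= eqxx addr0 intz.
  rewrite raddfMz /= fglift1 /=; case: eqP => [e|]; last by rewrite mul0rz.
  by case/eqP: ij; exact: inj.
by rewrite Fb.
Qed.

(** Intermediate value theorem along the segment from t to t': two distinct values would force the
    omitted value c. *)
Lemma gap_simplex_constant (f : X -> R) (s : sing_simplex R X 1) t t' :
  continuous f ->
  (forall a b, range f a -> range f b -> a < b ->
    exists c, a < c < b /\ ~ range f c) ->
  f ((s : continuousType _ _) t) = f ((s : continuousType _ _) t').
Proof.
move=> cf gap; apply/eqP/negPn/negP => ne.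
wlog lt : t t' {ne} / f ((s : continuousType _ _) t) < f ((s : continuousType _ _) t').
  by move: ne; rewrite neq_lt => /orP[] h H; [exact: H h|exact: H h].
have [||c [/andP[ac cb] nc]] := gap _ _ _ _ lt; try by eexists.
(* Clamping to [0, 1] makes the segment a continuous map on the whole line. *)
pose cl (u : R) := Num.max 0 (Num.min 1 u).
have cl01 u : 0 <= cl u <= 1.
  by rewrite /cl le_max lexx /= ge_max ler01 /= ge_min lexx.
have ccl : continuous cl.
  move=> u; apply: continuous_max; first exact: cst_continuous.
  by apply: continuous_min; [exact: cst_continuous|].
pose grow (u : R) : 'rV[R]_2 := (1 - cl u) *: val t + cl u *: val t'.
have gD u : std_simplex R 1 (grow u).
  have /andP[u0 u1] := cl01 u.
  have [t0 t1] := set_mem (valP t); have [t'0 t'1] := set_mem (valP t').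
  split => [i|]; first by rewrite !mxE addr_ge0 // mulr_ge0 // subr_ge0.
  under eq_bigr do rewrite !mxE.
  by rewrite big_split /= -!mulr_sumr t1 t'1 !mulr1 subrK.
pose g u : std_simplex R 1 := SigSub (mem_set (gD u)).
have cg : continuous g.
  apply: (@continuous_comp_initial _ _ _ (@set_val _ (std_simplex R 1))) => u.
  apply: cvgD; apply: cvgZr_tmp; last exact: ccl.
  by apply: cvgB; [exact: cvg_cst|exact: ccl].
pose F u := f ((s : continuousType _ _) (g u)).
have cF : continuous F.
  move=> u; apply: (@continuous_comp _ _ _ ((s : continuousType _ _) \o g) f); last exact: cf.
  apply: (@continuous_comp _ _ _ g s); [exact: cg|exact: cts_fun].
have F0 : F 0 = f ((s : continuousType _ _) t).
  rewrite /F; congr (f (_ _)); apply: val_inj; rewrite /= /grow /cl.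
  by rewrite min_r // maxxx subr0 scale1r scale0r addr0.
have F1 : F 1 = f ((s : continuousType _ _) t').
  rewrite /F; congr (f (_ _)); apply: val_inj; rewrite /= /grow /cl.
  by rewrite minxx max_r // subrr scale1r scale0r add0r.
have [||u _ Fu] := @IVT R F 0 1 c ler01.
- by apply: continuous_subspaceT.
- by rewrite F0 F1 ge_min le_max (ltW ac) (ltW cb) orbT.
by apply: nc; exists ((s : continuousType _ _) (g u)).
Qed.

End BettiBounds.

(** * Contractible sets and the cone operator on singular chains *)

Section Cones.
Variables (R : realType) (X : topologicalType).

Local Notation simp := (sing_simplex R X).
Local Notation chain := (sing_chain R X).
Local Notation sup A k := (supported (@simplex_in R X A k)).

(* Continuity is required only along maps into A: a contraction of a subspace
   then never has to be continuous outside of it. *)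
Definition contracts (A : set X) (x0 : X) (h : X -> R -> X) :=
  [/\ A x0, (forall x s, A x -> 0 <= s <= 1 -> A (h x s)),
      (forall x, A x -> h x 1 = x), (forall x, A x -> h x 0 = x0) &
      forall (Y : topologicalType) (f : Y -> X) (g : Y -> R),
        continuous f -> continuous g -> (forall y, A (f y)) ->
        (forall y, 0 <= g y <= 1) -> continuous (fun y => h (f y) (g y))].

Lemma compact_set_type (T : topologicalType) (K : set T) :
  compact K -> compact [set: set_type K].
Proof.
move=> cK F PF _.
have FK : (set_val @ F) K.
  by apply: (@filterS _ F _ setT) => [y _|]; [exact: (set_mem (valP y))|exact: filterT].
have [x [Kx clx]] := cK (set_val @ F) _ FK.
exists (SigSub (mem_set Kx)); split => // A B FA [_ [[W oW <-]] /= Wx WB].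
have FA' : (set_val @ F) (set_val @` A).
  by apply: (@filterS _ F _ A) => // y Ay; exists y.
have [_ [[y Ay <-] Wy]] := clx _ _ FA' (open_nbhs_nbhs (conj oW Wx)).
by exists y; split => //; exact: WB.
Qed.

Definition row_tail k (t : 'rV[R]_k.+2) : 'rV[R]_k.+1 :=
  \row_j t 0 (fintype.lift ord0 j).

Lemma row_tail_simplex k (t : 'rV[R]_k.+2) : std_simplex R k.+1 t -> t 0 0 != 1 ->
  std_simplex R k ((1 - t 0 0)^-1 *: row_tail t).
Proof.
move=> tD t1; have := std_simplex_le1 0 tD; have [t0 ts] := tD.
rewrite le_eqVlt (negbTE t1) /= => lt1.
split => [i|]; first by rewrite !mxE mulr_ge0 // invr_ge0 subr_ge0 ltW.
under eq_bigr do rewrite !mxE.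
rewrite -mulr_sumr; move: ts; rewrite big_ord_recl => /(canRL (addKr _)) ->.
by rewrite [- _ + _]addrC mulVf // subr_eq0 eq_sym.
Qed.

Section ContractibleSet.
Variables (A : set X) (x0 : X) (h : X -> R -> X).
Hypothesis hA : contracts A x0 h.

(** The apex is vertex 0, and 1 minus its barycentric coordinate is the contraction time. The
    separate value covers the apex, where the other coordinates cannot be normalised. *)
Definition cone_fun k (sg : simp k) (t : std_simplex R k.+1) : X :=
  if pselect (val t 0 0 != 1) is left t1
  then h ((sg : continuousType _ _)
    (SigSub (mem_set (row_tail_simplex (set_mem (valP t)) t1)))) (1 - val t 0 0)
  else x0.

Definition join_row k (ys : std_simplex R k * R) : 'rV[R]_k.+2 :=
  \row_j oapp (fun j' => ys.2 * val ys.1 0 j') (1 - ys.2) (unlift ord0 j).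

Lemma join_row0 k (ys : std_simplex R k * R) : join_row ys 0 0 = 1 - ys.2.
Proof. by rewrite mxE unlift_none. Qed.

Lemma join_rowS k (ys : std_simplex R k * R) j :
  join_row ys 0 (fintype.lift ord0 j) = ys.2 * val ys.1 0 j.
Proof. by rewrite mxE liftK. Qed.

Lemma join_row_continuous k : continuous (@join_row k).
Proof.
move=> ys; have -> : @join_row k = (fun ys => \sum_j
    (if unlift ord0 j is Some j' then ys.2 * val ys.1 0 j' else 1 - ys.2)
      *: delta_mx 0 j).
  apply/funext => zs; rewrite [LHS]row_sum_delta; apply: eq_bigr => j _.
  by rewrite mxE; case: unlift.
apply: continuous_big => [|j _ zs]; first exact: add_continuous.
apply: cvgZr_tmp; case: unlift => [j'|].
  apply: cvgM; first exact: cvg_snd.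
  apply: (@cvg_comp _ _ _ (fun zs : std_simplex R k * R => val zs.1) (fun x => x 0 j') _ (nbhs (val zs.1))).
    apply: (@cvg_comp _ _ _ fst val _ (nbhs zs.1)); first exact: cvg_fst.
    exact: initial_continuous.
  exact: coord_continuous.
by apply: cvgB; [exact: cvg_cst|exact: cvg_snd].
Qed.

Lemma cone_fun_join k (sg : simp k) (y : std_simplex R k) s
    (t : std_simplex R k.+1) : simplex_in A sg -> 0 <= s <= 1 ->
  val t = join_row (y, s) -> cone_fun sg t = h ((sg : continuousType _ _) y) s.
Proof.
move=> sA s01 tE; have [_ _ _ h0 _] := hA.
have t0 : val t 0 0 = 1 - s by rewrite tE join_row0.
rewrite /cone_fun; case: pselect => [t1|]; last first.
  rewrite t0 => /negP/negPn/eqP/(canRL (addKr _)); rewrite addNr => /eqP.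
  by rewrite oppr_eq0 => /eqP ->; rewrite h0.
congr h; last by rewrite t0 subKr.
congr (_ _); apply: val_inj => /=; apply/rowP => j.
rewrite mxE mxE t0 subKr tE join_rowS mulrA mulVf ?mul1r //.
by move: t1; rewrite t0 subr_eq addrC -subr_eq subrr eq_sym.
Qed.

(** The formula degenerates at the apex, so continuity is tested on closed sets: [join_row] exhibits
    the simplex as an image of the compact cylinder, and the preimage of C is the image of a compact
    subset. *)
Lemma cone_fun_continuous k (sg : simp k) : simplex_in A sg ->
  continuous (cone_fun sg).
Proof.
move=> sA; apply/continuous_closedP => C clC.
have [_ _ _ _ hc] := hA.
pose cl (u : R) := Num.max 0 (Num.min 1 u).
have cl01 u : 0 <= cl u <= 1.
  by rewrite /cl le_max lexx /= ge_max ler01 /= ge_min lexx.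
have ccl : continuous cl.
  move=> u; apply: continuous_max; first exact: cst_continuous.
  by apply: continuous_min; [exact: cst_continuous|].
have clid u : 0 <= u <= 1 -> cl u = u.
  by move=> /andP[u0 u1]; rewrite /cl min_r // max_r.
pose F (ys : std_simplex R k * R) := h ((sg : continuousType _ _) ys.1) (cl ys.2).
have cF : continuous F.
  apply: hc => [ys|ys|ys|ys].
  - apply: (@cvg_comp _ _ _ fst sg _ (nbhs ys.1)); first exact: cvg_fst.
    exact: cts_fun.
  - apply: (@cvg_comp _ _ _ snd cl _ (nbhs ys.2)); first exact: cvg_snd.
    exact: ccl.
  - exact: sA.
  - exact: cl01.
pose D := [set: std_simplex R k] `*` [set u : R | 0 <= u <= 1].
have cD : compact D.
  apply: compact_setX; first exact/compact_set_type/std_simplex_compact.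
  rewrite (_ : [set _ | _] = `[0, 1]%classic); first exact: segment_compact.
  by apply/seteqP; split => u; rewrite /= in_itv.
have cim : closed (@join_row k @` (D `&` F @^-1` C)).
  apply: compact_closed; first exact: norm_hausdorff.
  apply: continuous_compact.
    by apply: continuous_subspaceT => x; exact: join_row_continuous.
  apply: compact_closedI => //; exact: preimage_closed.
have -> : cone_fun sg @^-1` C = set_val @^-1` (@join_row k @` (D `&` F @^-1` C)).
  apply/seteqP; split => t.
    move=> Ct; have tD := set_mem (valP t).
    have [t0 ts] := tD; have t1 := std_simplex_le1 0 tD.
    pose s := 1 - val t 0 0.
    have s01 : 0 <= s <= 1 by rewrite subr_ge0 t1 /= lerBlDr lerDl t0.
    have [y yE] : exists y : std_simplex R k, val t = join_row (y, s).
      have [/eqP e1|ne1] := eqVneq (val t 0 0) 1.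
        (* At the apex s = 0 and any y will do; a vertex is taken. *)
        exists (SigSub (mem_set (@delta_simplex R k ord0))); apply/rowP => j.
        have s0 : s = 0 by rewrite /s (eqP e1) subrr.
        rewrite mxE /= s0 subr0; case: unliftP => [j' ->|->] /=; last exact/eqP.
        rewrite mul0r; apply/eqP; rewrite eq_le t0 andbT.
        have := ts; rewrite (bigD1 0) //= (eqP e1) => /(canRL (addKr _)).
        rewrite addNr => e; rewrite -e (bigD1 (fintype.lift ord0 j')) //= lerDl.
        by apply: sumr_ge0 => i _; exact: t0.
      exists (SigSub (mem_set (row_tail_simplex tD ne1))); apply/rowP => j.
      rewrite mxE /=; case: unliftP => [j' ->|->] /=; last by rewrite /s subKr.
      by rewrite !mxE mulrA mulfV ?mul1r // subr_eq0 eq_sym.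
    exists (y, s); rewrite ?yE //; split; first by split.
    by rewrite /= /F /= clid // -(cone_fun_join sA s01 yE).
  move=> [[y s] [[_ s01] Fys] e].
  rewrite /= (@cone_fun_join k sg y s t sA s01); last exact: esym.
  by move: Fys; rewrite /F /= clid.
have csv : continuous (set_val : std_simplex R k.+1 -> _) by move=> x; exact: initial_continuous.
exact: preimage_closed.
Qed.

Definition scone k (sg : simp k) : chain k.+1 :=
  if pselect (simplex_in A sg) is left sA
  then << (mkcts (cone_fun_continuous sA) : simp k.+1) >> else 0.

Definition cone k : chain k -> chain k.+1 := fglift (@scone k).

HB.instance Definition _ k := GRing.Additive.copy (@cone k) (fglift (@scone k)).

Lemma coneE k (sg : simp k) (sA : simplex_in A sg) :
  cone << sg >> = << (mkcts (cone_fun_continuous sA) : simp k.+1) >>.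
Proof.
rewrite /cone fglift1 /scone; case: pselect => // sA'.
by rewrite (Prop_irrelevance sA sA').
Qed.

Lemma cone_in k (c : chain k) : sup A k.+1 (cone c).
Proof.
apply: (@supported_fglift _ _ _ setT) => // sg _.
rewrite /scone; case: pselect => [sA|_]; last exact: supported0.
have [A0 Ah _ _ _] := hA.
apply: supportedU => t /=; rewrite /mkcts /cone_fun; case: pselect => // t1.
apply: Ah; first exact: sA.
have tD := set_mem (valP t); rewrite subr_ge0 std_simplex_le1 //=.
by rewrite lerBlDr lerDl; have [+ _] := tD; apply.
Qed.

Lemma cone_fun_face0 k (sg : simp k) t : simplex_in A sg ->
  cone_fun sg (face_map ord0 t) = (sg : continuousType _ _) t.
Proof.
move=> sA; have [_ _ h1 _ _] := hA.
rewrite (@cone_fun_join k sg t 1) ?ler01 ?lexx ?h1 //.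
by apply/rowP => j; rewrite !mxE /= subrr; case: unlift => //= j'; rewrite mul1r.
Qed.

Lemma cone_fun_faceS k (sg : simp k.+1) (i : 'I_k.+2) t :
  cone_fun sg (face_map (fintype.lift ord0 i) t) = cone_fun (sing_face i sg) t.
Proof.
have e0 : val (face_map (fintype.lift ord0 i) t) 0 0 = val t 0 0.
  rewrite mxE; have -> : 0 = fintype.lift (fintype.lift ord0 i) 0 by exact: val_inj.
  by rewrite liftK.
rewrite /cone_fun; case: pselect => [t1|t1]; case: pselect => [t1'|t1'] //.
- rewrite /sing_face /=; congr h; last by rewrite e0.
  congr (_ _); apply: val_inj; apply/rowP => j.
  move: e0; rewrite /= => e0.
  rewrite [LHS]mxE e0 [X in _ * X]mxE [RHS]mxE [X in _ * X]mxE; case: (unliftP i j) => [j' ->|->] /=.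
    rewrite !mxE; congr (_ * _).
    have -> : fintype.lift ord0 (fintype.lift i j') =
        fintype.lift (fintype.lift ord0 i) (fintype.lift ord0 j').
      by apply: val_inj; rewrite /= /bump /=; lia.
    by rewrite liftK.
  by rewrite unlift_none /= mulr0.
- by case: t1'; rewrite -e0.
- by case: t1; rewrite e0.
Qed.

Lemma boundary_coneS k (c : chain k.+1) : sup A k.+1 c ->
  sing_boundary (cone c) = c - cone (sing_boundary c).
Proof.
apply: (@freeg_morph_ext_in _ _
  (@sing_boundary R X k.+1 \o @cone k.+1 : {additive _ -> _})
  (idfun \- (@cone k \o @sing_boundary R X k) : {additive _ -> _})) => s sA /=.
rewrite (coneE sA) !sing_boundary1 big_ord_recl expr0; congr (_ + _).
  congr << _ >>; apply/continuousEP => t; exact: cone_fun_face0.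
rewrite raddf_sum -sumrN; apply: eq_bigr => i _ /=.
rewrite [in RHS]freegU_Mz raddfMz /=.
have fA : simplex_in A (sing_face i s) by move=> t; exact: sA.
rewrite (coneE fA) -freegU_Mz freegUN /bump add1n exprS mulN1r.
congr << _ *g _ >>; apply/continuousEP => t; exact: cone_fun_faceS.
Qed.

(** The second face of the cone on a point is the constant simplex at x0, so the multiple is the sum
    of the coefficients of c. *)
Lemma boundary_cone0 (c : chain 0) : sup A 0 c ->
  exists a : int, sing_boundary (cone c) = c - << (cst x0 : simp 0) >> *~ a.
Proof.
move=> cA; exists (\sum_(z <- dom c) coeff z c).
have -> : << (cst x0 : simp 0) >> *~ (\sum_(z <- dom c) coeff z c) =
    fglift (fun _ => << (cst x0 : simp 0) >> : chain 0) c.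
  rewrite mulrz_sumr -[in RHS](freeg_sumE c) [RHS]raddf_sum; apply: eq_bigr => s _ /=.
  by rewrite liftU -scaler_int intz.
move: cA; apply: (@freeg_morph_ext_in _ _
  (@sing_boundary R X 0 \o @cone 0 : {additive _ -> _})
  (idfun \- fglift (fun _ => << (cst x0 : simp 0) >> : chain 0) : {additive _ -> _})) => s sA /=.
rewrite (coneE sA) sing_boundary1 !big_ord_recl big_ord0 addr0 expr0 fglift1.
congr (_ + _).
  congr << _ >>; apply/continuousEP => t; exact: cone_fun_face0.
rewrite expr1 freegUN; congr << _ *g _ >>.
apply/continuousEP => t; rewrite /= /mkcts /cone_fun; case: pselect => // t1.
case/eqP: t1; rewrite mxE.
have -> : 0 = fintype.lift (fintype.lift ord0 ord0) 0 :> 'I_2 by exact: val_inj.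
rewrite liftK /=; have [_] := set_mem (valP t); rewrite big_ord_recl big_ord0 addr0.
by move=> <-.
Qed.

Lemma contractible_hgen0 : hgen R A 0 1.
Proof.
exists (fun=> << (cst x0 : simp 0) >>); split.
  by move=> _; split => //; apply: supportedU => t /=; have [] := hA.
move=> z _ zA; have [a ea] := boundary_cone0 zA.
exists (const_mx a), (cone z); split; first exact: cone_in.
by rewrite big_ord1 mxE ea addrC subrK.
Qed.

Lemma contractible_hgenS k : hgen R A k.+1 0.
Proof.
exists (fun=> 0); split; first by case.
move=> z; rewrite is_cycleS => /eqP z0 zA; exists 0, (cone z).
split; first exact: cone_in.
by rewrite big_ord0 add0r boundary_coneS // z0 raddf0 subr0.
Qed.

End ContractibleSet.

End Cones.

(** * Good covers and disjoint covers *)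

Section GoodCovers.
Variables (R : realType) (X : topologicalType).

Lemma hgen_widen (A : set X) k n m : (n <= m)%N -> hgen R A k n -> hgen R A k m.
Proof.
move=> /subnKC <- [w [wc wg]]; exists (fcat w (fun _ : 'I_(m - n) => 0)); split.
  apply: (@fcatP _ (fun c => is_cycle c /\ _ c)) => // i; split.
    by case: k {w wc wg} => [//|k]; rewrite is_cycleS raddf0.
  exact: supported0.
move=> z zc zA; have [a [d [hd ->]]] := wg z zc zA.
exists (row_mx a 0), d; split => //; rewrite sum_fcat [X in _ + X + _]big1 ?addr0 //.
by move=> i _; rewrite mul0rz.
Qed.

Lemma hgen_set0 k : hgen R (@set0 X) k 0.
Proof.
exists (fun=> 0); split; first by case.
move=> z _ z0; exists 0, 0; split; first exact: supported0.
rewrite raddf0 big_ord0 addr0; apply/eqP; rewrite -dom_eq0.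
move: z0; rewrite /supported; case: (dom z) => // s r /(_ s); rewrite mem_head.
by move=> /(_ isT (SigSub (mem_set (delta_simplex R (@ord0 k))))).
Qed.

Definition acyclic (A : set X) :=
  A = set0 \/ exists x0 h, @contracts R X A x0 h.

Lemma acyclic_hgen A k : acyclic A -> hgen R A k (k == 0).
Proof.
move=> [->|[x0 [h hA]]]; first exact: hgen_widen (hgen_set0 k).
by case: k => [|k]; [exact: (contractible_hgen0 hA)|exact: (contractible_hgenS hA)].
Qed.

Section Families.
Variables (I : eqType) (F : I -> set X).
Hypothesis oF : forall i, open (F i).

Definition cover_of (s : seq I) : set X := [set x | exists2 i, i \in s & F i x].

Lemma open_cover_of s : open (cover_of s).
Proof.
rewrite (_ : cover_of s = \bigcup_(i in [set i | i \in s]) F i).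
  by apply: bigcup_open => i _.
by apply/seteqP; split=> x [i is_ Fx]; exists i.
Qed.

Lemma cover_of_cons i s : cover_of (i :: s) = F i `|` cover_of s.
Proof.
apply/seteqP; split => x.
  by move=> [j]; rewrite inE => /orP[/eqP->|js] Fx; [left|right; exists j].
move=> [Fx|[j js Fx]]; first by exists i => //; rewrite mem_head.
by exists j => //; rewrite inE js orbT.
Qed.

(** Unfolds to acyclicity of S intersected with every nonempty subfamily. The recursion follows
    Mayer-Vietoris: one member is split off, leaving the rest of the cover on S and its trace on
    that member. *)
Fixpoint good (S : set X) (s : seq I) : Prop :=
  if s is i :: s' then [/\ acyclic (S `&` F i), good S s' & good (S `&` F i) s']
  else True.

Lemma good_ext (S S' : set X) s : (forall i, i \in s -> S `&` F i = S' `&` F i) ->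
  good S s -> good S' s.
Proof.
elim: s S S' => [//|i s ih] S S' h /= [ac g1 g2]; split.
- by rewrite -h // mem_head.
- by apply: ih g1 => j js; apply: h; rewrite inE js orbT.
- by rewrite -h // mem_head.
Qed.

Lemma setI_cover (S : set X) s i : i \in s -> S `&` F i = S `&` cover_of s `&` F i.
Proof.
by move=> is_; apply/seteqP; split=> x; [move=> [Sx Fx]; split => //; split => //; exists i|move=> [[]]].
Qed.

(** A new member at most doubles the count, through the rest of the cover and its trace one degree
    lower, and raises the top degree by one. *)
Lemma good_hgen s (S : set X) k : good S s -> S `<=` cover_of s ->
  hgen R S k (if (k < size s)%N then 2 ^ size s else 0)%N.
Proof.
elim: s S k => [|i s ih] S k.
  move=> _ h; rewrite (_ : S = set0); first exact: hgen_set0.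
  by apply/seteqP; split => // x /h [].
move=> /= [ac g1 g2]; rewrite cover_of_cons => cov.
have oU := open_cover_of s.
have h1 l := acyclic_hgen l ac.
have h2 l : hgen R (S `&` cover_of s) l (if (l < size s)%N then 2 ^ size s else 0)%N.
  by apply: ih; [apply: good_ext g1 => j; exact: setI_cover|move=> x []].
have h3 l : hgen R (S `&` F i `&` cover_of s) l (if (l < size s)%N then 2 ^ size s else 0)%N.
  by apply: ih; [apply: good_ext g2 => j; exact: setI_cover|move=> x []].
case: k => [|k].
  apply: hgen_widen (mayer_vietoris0 (oF i) oU cov (h1 0) (h2 0)).
  by rewrite expnS /=; case: ifP => _; have := expn_gt0 2 (size s); lia.
apply: hgen_widen (mayer_vietoris (oF i) oU cov (h1 k.+1) (h2 k.+1) (h3 k)).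
rewrite /= ltnS expnS; case: ltnP => ks; case: ltnP => ks'; lia.
Qed.

Lemma disjoint_hgen s (S : set X) k n : uniq s ->
  (forall i j x, i \in s -> j \in s -> S x -> F i x -> F j x -> i = j) ->
  (forall i, i \in s -> hgen R (S `&` F i) k n) -> S `<=` cover_of s ->
  hgen R S k (size s * n)%N.
Proof.
elim: s S => [|i s ih] S.
  move=> _ _ _ h; rewrite (_ : S = set0); first exact: hgen_set0.
  by apply/seteqP; split => // x /h [].
move=> /= /andP[nis us] dis hF; rewrite cover_of_cons => cov.
have oU := open_cover_of s.
have h1 : hgen R (S `&` F i) k n by apply: hF; rewrite mem_head.
have h2 : hgen R (S `&` cover_of s) k (size s * n)%N.
  apply: ih => // [a b x as_ bs [Sx _]|a as_].
    by apply: dis => //; rewrite inE ?as_ ?bs orbT.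
  by rewrite -setI_cover //; apply: hF; rewrite inE as_ orbT.
have e0 : S `&` F i `&` cover_of s = set0.
  apply/seteqP; split => // x [[Sx Fx] [j js Fj]].
  have ij : i = j by apply: (dis i j x); rewrite ?mem_head // inE js orbT.
  by move: nis; rewrite ij js.
rewrite mulSn; case: k hF h1 h2 {ih} => [|k] hF h1 h2.
  exact: (mayer_vietoris0 (oF i) oU cov h1 h2).
have := mayer_vietoris (oF i) oU cov h1 h2 (l := 0); rewrite addn0; apply.
by rewrite e0; exact: hgen_set0.
Qed.

End Families.

End GoodCovers.

(** * Spherical fibers *)

Section SquareNorm.
Variables (R : realType) (m : nat).
Implicit Types u v : 'rV[R]_m.

Lemma sqnorm_ge0 u : 0 <= sqnorm u.
Proof. by apply: sumr_ge0 => i _; exact: sqr_ge0. Qed.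

Lemma sqnorm_eq0 u : (sqnorm u == 0) = (u == 0).
Proof.
rewrite /sqnorm psumr_eq0 => [|i _]; last exact: sqr_ge0.
apply/idP/eqP => [/allP h|->]; last by apply/allP => i _; rewrite mxE /= expr0n /= eqxx.
apply/rowP => i; rewrite mxE; have := h i (mem_index_enum i).
by rewrite /= sqrf_eq0 => /eqP.
Qed.

Lemma sqnorm0 : sqnorm (0 : 'rV[R]_m) = 0.
Proof. by apply/eqP; rewrite sqnorm_eq0. Qed.

Lemma sqnormZ a u : sqnorm (a *: u) = a ^+ 2 * sqnorm u.
Proof. by rewrite /sqnorm mulr_sumr; apply: eq_bigr => i _; rewrite mxE exprMn. Qed.

Lemma sqnorm_continuous : continuous (@sqnorm R m).
Proof.
apply: continuous_big => [|i _]; first exact: add_continuous.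
have -> : (fun u : 'rV[R]_m => u 0 i ^+ 2) = (fun u => u 0 i * u 0 i).
  by apply/funext => u; rewrite expr2.
by move=> u; apply: continuousM; exact: (@coord_continuous R 1 m 0 i u).
Qed.

End SquareNorm.

Section Spheres.
Variables (R : realType) (n : nat) (Gam : set (Defs.cpoint R n)).
Let N := n.*2.
Variables (zeta : R) (c : 'rV[R]_N) (V : set 'rV[R]_N) (rho : R).
Hypothesis V_lin : forall a b u v, V u -> V v -> V (a *: u + b *: v).
Hypothesis V0 : V 0.
Hypothesis GamE : forall xi, Gam (xi, zeta) <-> V (xi - c) /\ sqnorm (xi - c) = rho.

Local Notation T := (set_type Gam).

Definition level : set T := [set eta | (val eta).2 = zeta].

Lemma level_sphere (eta : T) : level eta ->
  V ((val eta).1 - c) /\ sqnorm ((val eta).1 - c) = rho.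
Proof.
move=> e; apply/GamE; rewrite -e -surjective_pairing; exact: (set_mem (valP eta)).
Qed.

Lemma level_eq (eta eta' : T) : level eta -> level eta' ->
  (val eta).1 = (val eta').1 -> eta = eta'.
Proof.
move=> e e' h; apply: val_inj; rewrite [LHS]surjective_pairing.
by rewrite [RHS]surjective_pairing h; congr pair; rewrite e.
Qed.

(** The sign [true] is the negative one. These sets are open in the whole of [Gam], as the cover
    argument requires, and are only afterwards cut down to a level. *)
Definition half_space (bi : bool * 'I_N) : set T :=
  [set eta | 0 < (-1) ^+ bi.1 * ((val eta).1 - c) 0 bi.2].

Lemma cval_continuous : continuous (fun eta : T => (val eta).1).
Proof.
move=> eta; apply: (@cvg_comp _ _ _ val fst _ (nbhs (val eta))).
  exact: initial_continuous.
exact: cvg_fst.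
Qed.

Lemma open_half_space bi : open (half_space bi).
Proof.
have -> : half_space bi =
    (fun eta : T => (-1) ^+ bi.1 * ((val eta).1 - c) 0 bi.2) @^-1` [set r | 0 < r] by [].
apply: open_comp; last exact: open_gt.
move=> eta _; apply: (@continuousM _ _ (fun=> (-1) ^+ bi.1) (fun eta : T => ((val eta).1 - c) 0 bi.2)).
  exact: cst_continuous.
apply: (@cvg_comp _ _ _ (fun eta : T => (val eta).1 - c) (fun x => x 0 bi.2) _ (nbhs ((val eta).1 - c))).
  by apply: cvgB; [exact: nbhs_filter|exact: cval_continuous|exact: (@cst_continuous _ _ c eta)].
exact: (@coord_continuous R 1 _ 0 bi.2).
Qed.

(** Convex cones; excluding the zero combination lets open half-spaces qualify. *)
Definition cone_set (K : set 'rV[R]_N) := forall a b u v, 0 <= a -> 0 <= b ->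
  0 < a + b -> K u -> K v -> K (a *: u + b *: v).

Definition slice (K : set 'rV[R]_N) : set T :=
  [set eta | level eta /\ K ((val eta).1 - c)].

Definition half_cone (bi : bool * 'I_N) : set 'rV[R]_N :=
  [set u | 0 < (-1) ^+ bi.1 * u 0 bi.2].

Lemma half_cone_cone bi : cone_set (half_cone bi).
Proof.
move=> a b u v a0 b0 ab; rewrite /half_cone /= !mxE mulrDr !(mulrCA ((-1) ^+ _)).
move=> u0 v0; have [a1|a1] := ltP 0 a.
  by apply: ltr_pwDl; [exact: mulr_gt0|apply: mulr_ge0 => //; exact: ltW].
have a_0 : a = 0 by apply/eqP; rewrite eq_le a1.
by rewrite a_0 mul0r add0r mulr_gt0 //; move: ab; rewrite a_0 add0r.
Qed.

Lemma cone_setI K K' : cone_set K -> cone_set K' -> cone_set (K `&` K').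
Proof.
move=> h h' a b u v a0 b0 ab [Ku K'u] [Kv K'v].
by split; [exact: h|exact: h'].
Qed.

(* The normalised segment towards the base point never meets the centre, as
   one coordinate keeps its sign. *)
Lemma slice_acyclic K bi : 0 < rho -> cone_set K ->
  acyclic R (slice (K `&` half_cone bi)).
Proof.
move=> rho0 cK; set K' := K `&` half_cone bi.
have cK' : cone_set K' := cone_setI cK (half_cone_cone (bi := bi)).
have K'nz u : K' u -> 0 < sqnorm u.
  move=> [_ Hu]; rewrite lt_neqAle sqnorm_ge0 andbT eq_sym sqnorm_eq0.
  by apply/eqP => u0; move: Hu; rewrite /half_cone /= u0 mxE mulr0 ltxx.
have [->|/set0P[eta0 [l0 K0]]] := eqVneq (slice K') set0; first by left.
right; pose u0 := (val eta0).1 - c; exists eta0.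
(* [w] is the segment from the base point, and [pt] its radial projection to the sphere of radius
   [Num.sqrt rho] about c. *)
pose w (eta : T) (s : R) := (1 - s) *: u0 + s *: ((val eta).1 - c).
pose pt eta s : Defs.cpoint R n :=
  (c + (Num.sqrt rho / Num.sqrt (sqnorm (w eta s))) *: w eta s, zeta).
have wK eta s : slice K' eta -> 0 <= s <= 1 -> K' (w eta s).
  by move=> [_ Ke] /andP[s0 s1]; apply: cK' => //; rewrite ?subr_ge0 // subrK.
have ptG eta s : slice K' eta -> 0 <= s <= 1 -> Gam (pt eta s).
  move=> es s01; apply/GamE; rewrite addrC addKr; split.
    rewrite -[X in V X]addr0 -[X in _ + X](scale0r 0); apply: V_lin => //.
    by apply: V_lin; [exact: (level_sphere l0).1|exact: (level_sphere es.1).1].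
  have w0 := K'nz _ (wK _ _ es s01).
  by rewrite sqnormZ exprMn exprVn !sqr_sqrtr ?mulfVK ?gt_eqF // ltW.
(* The default [eta] is never taken on the slice at times in [0, 1], by [ptG]. *)
pose h (eta : T) (s : R) : T :=
  if pselect (Gam (pt eta s)) is left G then SigSub (mem_set G) else eta.
have hE eta s : slice K' eta -> 0 <= s <= 1 -> val (h eta s) = pt eta s.
  by move=> es s01; rewrite /h; case: pselect => // nG; case: nG; exact: ptG.
have norm1 (eta : T) u : level eta -> u = (val eta).1 - c ->
    (Num.sqrt rho / Num.sqrt (sqnorm u)) *: u = u.
  move=> le ->; rewrite (level_sphere le).2 divff ?scale1r //.
  by rewrite gt_eqF // sqrtr_gt0.
have hA eta s : slice K' eta -> 0 <= s <= 1 -> slice K' (h eta s).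
  move=> es s01; split; first by rewrite /level /= hE.
  rewrite hE //= addrC addKr -[X in K' X]addr0 -[X in _ + X](scale0r (w eta s)).
  have w0 := K'nz _ (wK _ _ es s01).
  have q0 : 0 < Num.sqrt rho / Num.sqrt (sqnorm (w eta s)).
    by rewrite divr_gt0 // sqrtr_gt0.
  by apply: cK'; rewrite ?addr0 // ?(ltW q0) //; exact: wK.
have i0 : 0 <= (0 : R) <= 1 by rewrite lexx ler01.
have i1 : 0 <= (1 : R) <= 1 by rewrite lexx ler01.
have w0E eta : w eta 0 = u0 by rewrite /w subr0 scale0r addr0 scale1r.
have w1E eta : w eta 1 = (val eta).1 - c by rewrite /w subrr scale0r add0r scale1r.
have ptE eta s (eta' : T) : level eta' -> w eta s = (val eta').1 - c ->
    (pt eta s).1 = (val eta').1.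
  by move=> le we; rewrite -[LHS]/(c + _) we (norm1 eta') // addrC subrK.
exists h; split => //.
- move=> eta es; apply: level_eq; [exact: (hA _ _ es i1).1|exact: es.1|].
  by rewrite (hE _ _ es i1); exact: ptE es.1 (w1E _).
- move=> eta es; apply: level_eq; [exact: (hA _ _ es i0).1|exact: l0|].
  by rewrite (hE _ _ es i0); exact: ptE l0 (w0E _).
move=> Y f g cf cg fA g01.
apply: (@continuous_comp_initial _ _ _ (@set_val _ Gam)) => y.
have -> : set_val \o (fun y => h (f y) (g y)) = (fun y => pt (f y) (g y)).
  by apply/funext => z /=; exact: hE.
have cw : w (f z) (g z) @[z --> y] --> w (f y) (g y).
  apply: cvgD; first by apply: cvgZr_tmp; apply: cvgB; [exact: cvg_cst|exact: cg].
  apply: cvgZ; first exact: cg.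
  apply: cvgB; last exact: cvg_cst.
  by apply: (@cvg_comp _ _ _ f (fun eta : T => (val eta).1) _ (nbhs (f y))); [exact: cf|exact: cval_continuous].
have w0 := K'nz _ (wK _ _ (fA y) (g01 y)).
have cq : Num.sqrt rho / Num.sqrt (sqnorm (w (f z) (g z))) @[z --> y] -->
    Num.sqrt rho / Num.sqrt (sqnorm (w (f y) (g y))).
  apply: cvgM; first exact: cvg_cst.
  apply: cvgV; first by rewrite gt_eqF // sqrtr_gt0.
  apply: (@cvg_comp _ _ _ (fun z => sqnorm (w (f z) (g z))) Num.sqrt _
    (nbhs (sqnorm (w (f y) (g y))))); last exact: sqrt_continuous.
  apply: (@cvg_comp _ _ _ (fun z => w (f z) (g z)) (@sqnorm R N) _
    (nbhs (w (f y) (g y)))) => //.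
  exact: sqnorm_continuous.
have c1 : (pt (f z) (g z)).1 @[z --> y] --> (pt (f y) (g y)).1.
  by apply: cvgD; [exact: cvg_cst|exact: cvgZ cq cw].
exact: (cvg_pair c1 (@cst_continuous _ _ zeta y)).
Qed.

(** A half-space cuts a slice of a cone to a slice of a smaller cone, so letting K vary keeps the
    induction inside one family. *)
Lemma slice_good K s : 0 < rho -> cone_set K -> good R half_space (slice K) s.
Proof.
move=> rho0; elim: s K => [//|bi s ih] K cK /=.
have -> : slice K `&` half_space bi = slice (K `&` half_cone bi).
  by apply/seteqP; split => eta; [move=> [[]]|move=> [? []]].
split; [exact: slice_acyclic|exact: ih|].
by apply: ih; apply: cone_setI => //; exact: half_cone_cone.
Qed.

(** The 2N coordinate half-spaces cover the sphere because some coordinate of a nonzero vector is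
    nonzero; [rho] = 0 leaves the single point c and [rho] < 0 nothing. *)
Lemma level_hgen k : (0 < N)%N ->
  hgen R level k (if (k < N.*2)%N then 2 ^ N.*2 else 0)%N.
Proof.
move=> N0.
have [rho0|] := ltP 0 rho.
  have -> : level = slice setT by apply/seteqP; split=> eta // [].
  have := @good_hgen R _ _ half_space open_half_space
    (enum {: bool * 'I_N}) (slice setT) k.
  rewrite -cardE card_prod card_bool card_ord mul2n; apply.
    exact: slice_good.
  move=> eta [le _]; have [i ci] : exists i, ((val eta).1 - c) 0 i != 0.
    apply/existsP; rewrite -negb_forall; apply/negP => /forallP h.
    have := (level_sphere le).2.
    rewrite (_ : _ - c = 0) ?sqnorm0; first by move=> e; rewrite -e ltxx in rho0.
    by apply/rowP => i; rewrite [RHS]mxE; exact/eqP.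
  move: ci; rewrite neq_lt => /orP[] h; [exists (true, i)|exists (false, i)]; rewrite ?mem_enum //.
    by rewrite /half_space /= expr1 mulN1r oppr_gt0.
  by rewrite /half_space /= expr0 mul1r.
rewrite le_eqVlt => /orP[/eqP rho0|rho0]; last first.
  have -> : level = set0; last exact: hgen_widen (hgen_set0 R _ k).
  apply/seteqP; split => // eta /level_sphere[_ e].
  by move: (sqnorm_ge0 ((val eta).1 - c)); rewrite e leNgt rho0.
apply: (@hgen_widen _ _ _ _ (k == 0)).
  by case: k => [|k] //=; rewrite double_gt0 N0 expn_gt0.
apply: acyclic_hgen; right.
have Gc : Gam (c, zeta) by apply/GamE; rewrite subrr sqnorm0 rho0.
pose x0 : T := SigSub (mem_set Gc).
have l0 : level x0 by [].
exists x0, (fun _ _ => x0); split => //.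
- move=> eta le; apply: level_eq => //=; have := (level_sphere le).2.
  by rewrite rho0 => /eqP; rewrite sqnorm_eq0 subr_eq0 => /eqP.
- by move=> Y f g _ _ _ _; exact: cst_continuous.
Qed.

End Spheres.

Section Fibers.
Variables (R : realType) (n : nat) (Gam : set (Defs.cpoint R n)).
Let N := n.*2.

Local Notation T := (set_type Gam).

(** A negative [rho] encodes an empty fiber and [rho] = 0 a single point, so all levels share one
    description. *)
Definition sphere_fiber (zeta : R) :=
  exists c (V : set 'rV[R]_N) (rho : R),
  [/\ forall a b u v, V u -> V v -> V (a *: u + b *: v), V 0 &
      forall xi, Gam (xi, zeta) <-> V (xi - c) /\ sqnorm (xi - c) = rho].

Lemma height_continuous : continuous (fun eta : T => (val eta).2).
Proof.
move=> eta; apply: (@cvg_comp _ _ _ val snd _ (nbhs (val eta))).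
  exact: initial_continuous.
exact: cvg_snd.
Qed.

Lemma fibers_total_betti_le (zs : seq R) : (0 < N)%N -> uniq zs ->
  (forall zeta, zeta \in zs -> sphere_fiber zeta) ->
  (forall xi zeta, Gam (xi, zeta) -> zeta \in zs) ->
  (total_betti R Gam <= (N.*2 * (size zs * 2 ^ N.*2))%:R%:E)%E.
Proof.
move=> N0 us sph cov.
have covT (eta : T) : (val eta).2 \in zs.
  have := set_mem (valP eta); rewrite [X in Gam X]surjective_pairing.
  exact: cov.
(* Phrased as avoiding the other finitely many heights, the level at z is visibly open; [FE]
   identifies the two. *)
pose F (z : R) : set T := [set eta | forall y, y \in zs -> y != z -> (val eta).2 != y].
have FE z : z \in zs -> F z = @level R n Gam z.
  move=> zz; apply/seteqP; split => eta.
    move=> h; apply/eqP/negPn/negP => nz; have := h _ (covT eta) nz.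
    by rewrite eqxx.
  by move=> <- y _ yz; rewrite eq_sym.
have oF z : open (F z).
  rewrite (_ : F z = \big[setI/setT]_(y <- [seq y <- zs | y != z])
      ((fun eta : T => (val eta).2) @^-1` [set r | r != y])).
    apply: big_ind => [|A B|y _]; [exact: openT|exact: openI|].
    by apply: open_comp; [move=> ? _; exact: height_continuous|exact: open_neq].
  apply/seteqP; split => eta; rewrite -bigcap_seq.
    by move=> h y /=; rewrite mem_filter => /andP[yz ys]; exact: h.
  by move=> h y ys yz; apply: (h y); rewrite /= mem_filter yz.
apply: total_betti_le => k.
rewrite (_ : (if _ then _ else _) =
    (size zs * (if k < N.*2 then 2 ^ N.*2 else 0))%N); last first.
  by case: ifP => _; rewrite ?muln0.
apply: (@disjoint_hgen R _ _ F oF) => //.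
- by move=> i j eta iz jz _; rewrite !FE // => <- <-.
- move=> z zz; rewrite setTI FE //; have [c [V [rho [h1 h2 h3]]]] := sph z zz.
  exact: level_hgen h1 h2 h3 _ N0.
- by move=> eta _; exists (val eta).2; rewrite ?FE.
Qed.

(** The gaps make the height constant on singular 1-simplices, so it serves as the invariant [phi]
    of [betti0_ge]. *)
Lemma fibers_total_betti_ge (zs : seq R) : uniq zs ->
  (forall zeta, zeta \in zs -> exists xi, Gam (xi, zeta)) ->
  (forall a b, a < b -> exists c, a < c < b /\ forall xi, ~ Gam (xi, c)) ->
  ((size zs)%:R%:E <= total_betti R Gam)%E.
Proof.
move=> us ex gap; apply: le_trans (@total_betti_ge0 R _).
have hx (i : 'I_(size zs)) : exists eta : T, (val eta).2 = zs`_i.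
  have [|xi G] := ex zs`_i; first by rewrite mem_nth.
  by exists (SigSub (mem_set G)).
have [x xE] := choice hx.
apply: (@betti0_ge R _ _ (fun eta : T => (val eta).2) _ x) => [s t t'|].
  apply: (@gap_simplex_constant R _ (fun eta : T => (val eta).2)).
    exact: height_continuous.
  move=> a b _ _ /gap[c [abc nc]]; exists c; split => // -[eta _ e].
  apply: (nc (val eta).1); rewrite -e -surjective_pairing.
  exact: (set_mem (valP eta)).
move=> i j /=; rewrite !xE => /eqP; rewrite nth_uniq // => /eqP.
exact: val_inj.
Qed.

End Fibers.

(** * The group law and the Hamiltonian flow *)

Section DerivativeToolkit.
Variable R : realType.

Lemma is_derive_cvg (V W : normedModType R) (a v : V) (f : V -> W) d :
  is_derive a v f d <->
  (fun h : R => h^-1 *: (f (h *: v + a) - f a)) @ 0^' --> d.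
Proof.
split=> [[df <-]|h]; first exact: df.
by split; [apply/cvg_ex; exists d|exact: cvg_lim h].
Qed.

Lemma is_derive_pairE (V W W' : normedModType R) (a v : V) (f : V -> W)
    (g : V -> W') df dg :
  is_derive a v f df -> is_derive a v g dg ->
  is_derive a v (fun x => (f x, g x)) (df, dg).
Proof.
move=> /is_derive_cvg hf /is_derive_cvg hg; apply/is_derive_cvg.
exact: cvg_pair hf hg.
Qed.

Lemma is_derive_fst (V W W' : normedModType R) (a v : V) (f : V -> W * W') d :
  is_derive a v f d -> is_derive a v (fun x => (f x).1) d.1.
Proof.
move=> /is_derive_cvg h; apply/is_derive_cvg.
apply: (@cvg_comp _ _ _ (fun h : R => h^-1 *: (f (h *: v + a) - f a)) fst _ (nbhs d)) => //.
exact: cvg_fst.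
Qed.

Lemma is_derive_snd (V W W' : normedModType R) (a v : V) (f : V -> W * W') d :
  is_derive a v f d -> is_derive a v (fun x => (f x).2) d.2.
Proof.
move=> /is_derive_cvg h; apply/is_derive_cvg.
apply: (@cvg_comp _ _ _ (fun h : R => h^-1 *: (f (h *: v + a) - f a)) snd _ (nbhs d)) => //.
exact: cvg_snd.
Qed.

Lemma is_derive_coord (V : normedModType R) m (a v : V) (f : V -> 'rV[R]_m) d i :
  is_derive a v f d -> is_derive a v (fun x => f x 0 i) (d 0 i).
Proof.
move=> /is_derive_cvg h; apply/is_derive_cvg.
rewrite (_ : (fun h => _) = (fun M : 'rV[R]_m => M 0 i) \o
    (fun h => h^-1 *: (f (h *: v + a) - f a))).
  by apply: (cvg_comp _ _ h); exact: (@coord_continuous R 1 m 0 i d).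
by apply/funext => k /=; rewrite !mxE.
Qed.

Lemma is_derive_row (V : normedModType R) m (a v : V) (f : V -> 'rV[R]_m)
    (d : 'rV[R]_m) :
  (forall i, is_derive a v (fun x => f x 0 i) (d 0 i)) -> is_derive a v f d.
Proof.
move=> h; have df : derivable f a v.
  by apply/derivable_mxP => i j; rewrite (ord1 i); have [] := h j.
apply: DeriveDef => //; rewrite derive_mx //; apply/rowP => j; rewrite mxE.
by have [] := h j.
Qed.

Lemma is_derive_scale (V W : normedModType R) (a v : V) (k : V -> R) (f : V -> W) dk df :
  is_derive a v k dk -> is_derive a v f df ->
  is_derive a v (fun x => k x *: f x) (dk *: f a + k a *: df).
Proof.
move=> hk hf; have /is_derive_cvg ck := hk; have /is_derive_cvg cf := hf.
apply/is_derive_cvg.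
(* Only differentiability along v is available; it gives continuity of k on that line, which is what
   the product rule uses. The [if] keeps the identity valid at h = 0. *)
have ck0 : (k (h *: v + a)) @[h --> 0^'] --> k a.
  have -> : (fun h : R => k (h *: v + a)) =
     (fun h => k a + (if h == 0 then k (0 *: v + a) - k a else h * (h^-1 *: (k (h *: v + a) - k a)))).
    apply/funext => h; case: eqVneq => [->|h0]; first by rewrite [RHS]addrC subrK.
    by rewrite /GRing.scale /= mulrA mulfV // mul1r [RHS]addrC subrK.
  rewrite -[X in _ --> X]addr0; apply: cvgD; first exact: cvg_cst.
  apply: (@cvg_trans _ ((fun h : R => h * (h^-1 *: (k (h *: v + a) - k a))) @ 0^')).
    apply: near_eq_cvg; near=> h; case: eqVneq => // h0; exfalso.
    by move: h0; apply/eqP; near: h; exact: nbhs_dnbhs_neq.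
  have c0 : h @[h --> (0 : R)^'] --> (0 : R) by exact: cvg_within.
  have h1 := cvgM c0 ck; rewrite mul0r in h1; exact: h1.
rewrite (_ : (fun h => _) = (fun h => (h^-1 *: (k (h *: v + a) - k a)) *: f a +
   k (h *: v + a) *: (h^-1 *: (f (h *: v + a) - f a)))).
  by apply: cvgD; [exact: cvgZr_tmp|exact: cvgZ].
apply/funext => h; rewrite [h^-1 *: (k _ - _)]/GRing.scale /= -scalerA.
rewrite [k _ *: (_ *: _)]scalerA [k _ * _]mulrC -scalerA -scalerDr; congr (_ *: _).
by rewrite scalerBl scalerBr [RHS]addrC addrA subrK.
Unshelve. all: by end_near. Qed.

End DerivativeToolkit.

(** * A Gronwall estimate for linear equations *)

Section Gronwall.
Variable R : realType.

Lemma is_derive_sumE (V W : normedModType R) m (f : 'I_m -> V -> W) (a v : V) df :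
  (forall i, is_derive a v (f i) (df i)) ->
  is_derive a v (fun x => \sum_i f i x) (\sum_i df i).
Proof.
move=> h; have := @is_derive_sum R V W m f a v df h.
by rewrite (_ : \sum_i f i = fun x => \sum_i f i x) //; apply/funext => x; rewrite fct_sumE.
Qed.

Lemma is_derive_continuous (W : normedModType R) (f : R -> W) (df : R -> W) :
  (forall t, is_derive t (1 : R) f (df t)) -> continuous f.
Proof.
by move=> h t; apply/differentiable_continuous/derivable1_diffP; have [] := h t.
Qed.

(** The function y(t) exp(-C t) is nonincreasing on [0, 1]. *)
Lemma le_expR_of_derive (y dy : R -> R) (C : R) :
  (forall t, is_derive t (1 : R) y (dy t)) ->
  (forall t, 0 <= t <= 1 -> dy t <= C * y t) -> y 1 <= y 0 * expR C.
Proof.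
move=> hy le_dy; pose z t := y t * expR (- (C * t)).
have hz t : is_derive t (1 : R) z ((dy t - C * y t) * expR (- (C * t))).
  have hC : is_derive t (1 : R) (fun t => - (C * t)) (- C).
    by apply: is_derive_eq; rewrite /GRing.scale /= mulr1.
  have he := @is_derive1_comp _ expR (fun t => - (C * t)) t _ _ (is_derive_expR _) hC.
  apply: is_derive_eq (is_deriveM (hy t) he) _.
  by rewrite /GRing.scale /=; ring.
have : z 1 <= z 0.
  have hd t : t \in `]0, 1[ -> derivable z t 1 by move=> _; have [] := hz t.
  have := ler0_derive1_le_cc hd; apply => //.
  - move=> t; rewrite in_itv /= => /andP[t0 t1]; rewrite derive1E.
    have [_ ->] := hz t; rewrite mulr_le0_ge0 ?expR_ge0 // subr_le0 le_dy //.
    by rewrite !ltW.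
  - by apply: continuous_subspaceT; exact: is_derive_continuous hz.
  - by rewrite in_itv /= ler01 lexx.
  - by rewrite in_itv /= ler01 lexx.
by rewrite /z mulr0 oppr0 expR0 !mulr1 expRN ler_pdivrMr // expR_gt0.
Qed.

Variable n : nat.
Let N := n.*2.
Local Notation E := (Defs.cpoint R n).

(** Euclidean square, used because the norm of [cpoint] is a maximum norm and not differentiable. *)
Definition sqn (p : E) := sqnorm p.1 + p.2 ^+ 2.

Lemma sqn_norm (p : E) : `|p| ^+ 2 <= sqn p.
Proof.
have h1 : `|p.1| ^+ 2 <= sqnorm p.1.
  rewrite -[leRHS]sqr_sqrtr ?sqnorm_ge0 // lerXn2r ?nnegrE ?sqrtr_ge0 //.
  apply: norm_le_coord => [|i]; first exact: sqrtr_ge0.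
  rewrite -sqrtr_sqr ler_sqrt ?sqnorm_ge0 // /sqnorm (bigD1 i) //= lerDl.
  by apply: sumr_ge0 => j _; exact: sqr_ge0.
have s0 := sqnorm_ge0 p.1; have q0 := sqr_ge0 p.2.
rewrite prod_normE /sqn; case: (leP `|p.1| `|p.2|) => _.
  by rewrite real_normK ?num_real // lerDr.
by apply: le_trans h1 _; rewrite lerDl.
Qed.

Lemma gronwall_zero (W dW : R -> E) (K : R) : W 0 = 0 ->
  (forall t, is_derive t (1 : R) W (dW t)) ->
  (forall t, 0 <= t <= 1 -> `|dW t| <= K * `|W t|) -> W 1 = 0.
Proof.
move=> W0 hW hK.
pose dy t := \sum_i 2 * ((W t).1 0 i * (dW t).1 0 i) + 2 * ((W t).2 * (dW t).2).
have hy t : is_derive t (1 : R) (fun t => sqn (W t)) (dy t).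
  have h2 := is_derive_snd (hW t).
  have h1 i := is_derive_coord i (is_derive_fst (hW t)).
  apply: is_deriveD.
    apply: is_derive_sumE => i; apply: is_derive_eq (is_deriveX 2 (h1 i)) _.
    by rewrite /GRing.scale /=; ring.
  apply: is_derive_eq (is_deriveX 2 h2) _.
  by rewrite /GRing.scale /=; ring.
(* Each of the N + 1 coordinates contributes at most 2 |W| |dW|, hence at most 2 K |W|^2. *)
have key t : 0 <= t <= 1 -> dy t <= (2 * (N.+1)%:R * K) * sqn (W t).
  move=> t01; have Kt := hK t t01.
  have c (a b : R) : `|a| <= `|W t| -> `|b| <= `|dW t| -> 2 * (a * b) <= 2 * (`|W t| * `|dW t|).
    move=> ha hb; rewrite ler_pM2l //; apply: le_trans (ler_norm _) _.
    by rewrite normrM ler_pM.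
  have n1 (p : E) i : `|p.1 0 i| <= `|p|.
    by apply: le_trans (coord_le_norm _ i) _; rewrite prod_normE le_max lexx.
  have n2 (p : E) : `|p.2| <= `|p| by rewrite prod_normE le_max lexx orbT.
  have : dy t <= N.+1%:R * (2 * (`|W t| * `|dW t|)).
    rewrite mulr_natl mulrSr; apply: lerD; last by apply: c.
    have -> x : x *+ N = \sum_(i < N) x :> R by rewrite sumr_const card_ord.
    apply: ler_sum => i _.
    by apply: c.
  move/le_trans; apply; rewrite -mulrA mulrCA -mulrA; apply: ler_wpM2l => //.
  apply: ler_wpM2l => //.
  apply: (@le_trans _ _ (K * `|W t| ^+ 2)).
    by rewrite expr2 mulrCA ler_wpM2l.
  (* A negative K forces W t = 0. *)
  have [K0|K0] := leP 0 K; first by rewrite ler_wpM2l // sqn_norm.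
  have Wt0 : `|W t| = 0.
    apply/eqP; rewrite eq_le normr_ge0 andbT leNgt; apply/negP => W0'.
    have : K * `|W t| < 0 by rewrite nmulr_rlt0.
    by rewrite ltNge (le_trans _ Kt).
  move/eqP: Wt0; rewrite normr_eq0 => /eqP ->.
  by rewrite normr0 /sqn /= sqnorm0 expr0n /= addr0 mulr0.
have := le_expR_of_derive hy key; rewrite W0 {2}/sqn /= sqnorm0 expr0n /= addr0 mul0r.
move=> le0; have := le_trans (sqn_norm (W 1)) le0.
rewrite le_eqVlt ltNge sqr_ge0 orbF sqrf_eq0 normr_eq0 => /eqP //.
Qed.

End Gronwall.

Lemma derive_lincomb (R : realType) (V W : normedModType R) (g : V -> W) p m
    (c : 'I_m -> R) (u : 'I_m -> V) d u0 : differentiable g p ->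
  'D_(\sum_i c i *: u i + d *: u0) g p =
  \sum_i c i *: 'D_(u i) g p + d *: 'D_u0 g p.
Proof.
move=> dg; rewrite !deriveE // linearD linearZ /= linear_sum /=.
by congr (_ + _); apply: eq_bigr => i _; rewrite linearZ deriveE.
Qed.

Lemma lincomb_sub (R : realType) (V : lmodType R) m (c : 'I_m -> R)
    (x y : 'I_m -> V) d x0 y0 :
  (\sum_i c i *: x i + d *: x0) - (\sum_i c i *: y i + d *: y0) =
  \sum_i c i *: (x i - y i) + d *: (x0 - y0).
Proof.
rewrite opprD addrACA -sumrB scalerBr; congr (_ + _).
by apply: eq_bigr => i _; rewrite scalerBr.
Qed.

(** * Left-invariant fields and the exponential axiom *)

Section LeftInvariantFields.
Variables (R : realType) (n : nat) (G : contactCarnotGroup R n).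
Local Notation N := (n.*2).
Local Notation E := (Defs.cpoint R n).
Local Notation mul := (ccg_mul G).
Local Notation mm := (fun pq : E * E => ccg_mul G pq.1 pq.2).
Local Notation hdir := (@horizontal_dir R n).
Local Notation vdir := (vertical_dir R n).

Lemma cpoint_eq (p q : E) : (forall i, p.1 0 i = q.1 0 i) -> p.2 = q.2 -> p = q.
Proof.
move=> h1 h2; rewrite [p]surjective_pairing [q]surjective_pairing h2.
by congr pair; apply/rowP.
Qed.

Lemma cpoint_decomp (p : E) : p = \sum_i p.1 0 i *: hdir i + p.2 *: vdir.
Proof.
have fstE I (r : seq I) (F : I -> E) : (\sum_(i <- r) F i).1 = \sum_(i <- r) (F i).1.
  by elim: r => [|i r ih]; rewrite ?big_nil // !big_cons /= -ih.
have sndE I (r : seq I) (F : I -> E) : (\sum_(i <- r) F i).2 = \sum_(i <- r) (F i).2.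
  by elim: r => [|i r ih]; rewrite ?big_nil // !big_cons /= -ih.
rewrite [LHS]surjective_pairing [RHS]surjective_pairing /= fstE sndE /=.
congr pair; first by rewrite scaler0 addr0 -row_sum_delta.
by rewrite /GRing.scale /= mulr1 big1 ?add0r // => i _; rewrite mulr0.
Qed.

Definition inv_field (w p : E) : E := left_invariant_field mul w p.
Local Notation F := inv_field.

Lemma inv_fieldE w p : F w p = 'D_w (mul p) 0.
Proof. by []. Qed.

(** As a partial derivative of the multiplication in both variables, the field inherits linearity in
    w and regularity in p from smoothness of the group. *)
Lemma inv_field_mm w p : F w p = 'D_((0, w) : E * E) mm (p, 0).
Proof.
rewrite /inv_field /left_invariant_field /derive.
rewrite (_ : (fun h => _) = (fun h : R =>
  h^-1 *: ((mm \o shift (p, 0)) (h *: ((0, w) : E * E)) - mm (p, 0)))) //.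
by apply/funext => h /=; rewrite scaler0 !add0r.
Qed.

Opaque inv_field.

Lemma mm_differentiable x : differentiable mm x.
Proof. by have [+ _] := ccg_mul_smooth G 1; apply. Qed.

Lemma inv_field_lin a u w p : F (a *: u + w) p = a *: F u p + F w p.
Proof.
rewrite !inv_field_mm !deriveE; try exact: mm_differentiable.
rewrite -linearP (_ : a *: ((0, u) : E * E) + (0, w) = (a *: 0 + 0, a *: u + w)) //.
by rewrite scaler0 addr0.
Qed.

Lemma inv_fieldD u w p : F (u + w) p = F u p + F w p.
Proof. by have := inv_field_lin 1 u w p; rewrite !scale1r. Qed.

Lemma inv_field0 p : F 0 p = 0.
Proof. by rewrite inv_field_mm; exact: derive0. Qed.

Lemma inv_fieldZ a u p : F (a *: u) p = a *: F u p.
Proof. by have := inv_field_lin a u 0 p; rewrite !addr0 inv_field0 addr0. Qed.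

Lemma inv_field_decomp w p :
  F w p = \sum_i w.1 0 i *: F (hdir i) p + w.2 *: F vdir p.
Proof.
rewrite {1}[w]cpoint_decomp inv_fieldD inv_fieldZ; congr (_ + _).
by elim/big_ind2: _ => [|x y x' y' <- <-|i _]; rewrite ?inv_field0 ?inv_fieldD ?inv_fieldZ.
Qed.

Lemma inv_field_differentiable w p : differentiable (F w) p.
Proof.
have -> : F w = (fun x => 'D_((0, w) : E * E) mm x) \o (fun p : E => (p, 0)).
  by apply/funext => q; rewrite inv_field_mm.
apply: differentiable_comp; first exact: differentiable_pair.
by have [_ /(_ (0, w))[+ _]] := ccg_mul_smooth G 2; apply.
Qed.

Lemma derive_inv_field_continuous u w : continuous (fun p => 'D_u (F w) p).
Proof.
have -> : (fun p => 'D_u (F w) p) =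
    (fun x => 'D_((u, 0) : E * E) (fun x => 'D_((0, w) : E * E) mm x) x) \o
    (fun p : E => (p, 0)).
  apply/funext => p /=.
  have fE : (fun h : R => h^-1 *: ((F w \o shift p) (h *: u) - F w p)) =
      (fun h : R => h^-1 *:
        (((fun x => 'D_((0, w) : E * E) mm x) \o shift (p, 0)) (h *: ((u, 0) : E * E)) -
         'D_((0, w) : E * E) mm (p, 0))).
    apply/funext => h; rewrite [(_ \o _) _]/= [(_ \o _) _]/= !inv_field_mm.
    have e : (h *: u + p, 0) = h *: ((u, 0) : E * E) + (p, 0).
      by rewrite -[0 in LHS]addr0 -[X in (_, X + _)](scaler0 _ h).
    by rewrite -e.
  exact: (congr1 (fun f => lim (f @ 0^')) fE).
move=> p; apply: continuous_comp.
  exact: (cvg_pair (@cvg_id _ (nbhs p)) (@cst_continuous _ _ (0 : E) p)).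
by have [_ /(_ (0, w))[_ /(_ (u, 0))]] := ccg_mul_smooth G 2; apply.
Qed.

Lemma is_derive_inv_field u w p : is_derive p u (F w) ('D_u (F w) p).
Proof. exact/derivableP/diff_derivable/inv_field_differentiable. Qed.

Lemma derive_inv_field_lin a u v w p :
  'D_(a *: u + v) (F w) p = a *: 'D_u (F w) p + 'D_v (F w) p.
Proof.
rewrite !deriveE; try exact: inv_field_differentiable.
by rewrite linearP.
Qed.

Lemma derive_inv_field_decomp u w p : 'D_u (F w) p =
  \sum_i u.1 0 i *: 'D_(hdir i) (F w) p + u.2 *: 'D_vdir (F w) p.
Proof.
by rewrite {1}[u]cpoint_decomp; apply: derive_lincomb; exact: inv_field_differentiable.
Qed.

Lemma derive_field_decomp u w p : 'D_u (F w) p =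
  \sum_i w.1 0 i *: 'D_u (F (hdir i)) p + w.2 *: 'D_u (F vdir) p.
Proof.
have -> : F w = (fun p => \sum_i w.1 0 i *: F (hdir i) p + w.2 *: F vdir p).
  by apply/funext => q; exact: inv_field_decomp.
suff : is_derive p u
  (fun p => \sum_i w.1 0 i *: F (hdir i) p + w.2 *: F vdir p)
  (\sum_i w.1 0 i *: 'D_u (F (hdir i)) p + w.2 *: 'D_u (F vdir) p) by case.
apply: is_deriveD; last exact/is_deriveZ/is_derive_inv_field.
by apply: is_derive_sumE => i; exact/is_deriveZ/is_derive_inv_field.
Qed.

Lemma inv_field_ray t v : F v (t *: v) = v.
Proof.
rewrite inv_fieldE; suff : is_derive (0 : E) v (mul (t *: v)) v by case.
apply/is_derive_cvg.
apply: (@cvg_trans _ ((fun=> v) @ (0 : R)^')); last exact: cvg_cst.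
apply: near_eq_cvg; near=> h.
have h0 : h != 0 by near: h; exact: nbhs_dnbhs_neq.
rewrite addr0 ccg_exp -[0 in X in _ - X](scale0r v) ccg_exp -scalerBl addr0 addrAC subrr add0r.
by rewrite scalerA mulVf // scale1r.
Unshelve. all: by end_near. Qed.

(** Differentiates F q q = q in the direction u at q = t v, using that the field depends linearly on
    its first argument. *)
Lemma derive_ray u v t : F u (t *: v) + t *: 'D_u (F v) (t *: v) = u.
Proof.
set p := t *: v.
have h1 : is_derive p u (fun q : E => \sum_i q.1 0 i *: F (hdir i) q + q.2 *: F vdir q)
   (\sum_i (u.1 0 i *: F (hdir i) p + p.1 0 i *: 'D_u (F (hdir i)) p) +
    (u.2 *: F vdir p + p.2 *: 'D_u (F vdir) p)).
  have hid := @is_derive_id R E p u.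
  apply: is_deriveD.
    apply: is_derive_sumE => i; apply: is_derive_scale; last exact: is_derive_inv_field.
    exact: (is_derive_coord i (is_derive_fst hid)).
  by apply: is_derive_scale; [exact: (is_derive_snd hid)|exact: is_derive_inv_field].
have h2 : (fun q : E => \sum_i q.1 0 i *: F (hdir i) q + q.2 *: F vdir q) = id.
  apply/funext => q; rewrite -inv_field_decomp.
  by have := inv_field_ray 1 q; rewrite scale1r.
rewrite h2 in h1; have [_] := h1; rewrite derive_id => e; rewrite [RHS]e.
rewrite big_split /= addrACA.
apply: (congr2 +%R); first exact: inv_field_decomp.
apply: etrans (derive_field_decomp u p p).
have -> : F p = t *: F v by apply/funext => q; exact: inv_fieldZ.
by rewrite deriveZ //; have [] := is_derive_inv_field u v p.
Qed.

Lemma bracket_fields v w p b :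
  (forall i, lie_bracket (F (hdir i)) (F w) p = b i *: F vdir p) ->
  lie_bracket (F vdir) (F w) p = 0 ->
  'D_(F v p) (F w) p - 'D_(F w p) (F v) p = (\sum_i v.1 0 i * b i) *: F vdir p.
Proof.
move=> hb h0.
have e1 := derive_field_decomp (F w p) v p.
have e2 := etrans (congr1 (fun x => 'D_x (F w) p) (inv_field_decomp v p))
  (derive_lincomb _ _ _ _ (inv_field_differentiable w p)).
rewrite /= in e2.
apply: etrans (congr2 (fun a b => a - b) e2 e1) _.
apply: etrans (lincomb_sub _ _ _ _ _ _) _.
apply: etrans (congr2 +%R (eq_bigr _ (fun i _ => congr1 ( *:%R (v.1 0 i)) (hb i)))
  (congr1 ( *:%R v.2) h0)) _.
rewrite scaler0 addr0 scaler_suml; apply: eq_bigr => i _; exact: scalerA.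
Qed.

End LeftInvariantFields.

(** * The frame in exponential coordinates *)

Section ExponentialCoordinates.
Variables (R : realType) (n : nat) (G : contactCarnotGroup R n).
Local Notation N := (n.*2).
Local Notation E := (Defs.cpoint R n).
Local Notation hdir := (@horizontal_dir R n).
Local Notation vdir := (vertical_dir R n).
Local Notation F := (inv_field G).

Opaque derive.

Lemma is_derive_along (V W : normedModType R) (g : V -> W) (v : V) (t : R) :
  differentiable g (t *: v) ->
  is_derive t (1 : R) (fun t => g (t *: v)) ('D_v g (t *: v)).
Proof.
move=> dg; have /is_derive_cvg h : is_derive (t *: v) v g ('D_v g (t *: v)).
  exact/derivableP/diff_derivable.
apply/is_derive_cvg.
have -> : (fun h : R => h^-1 *: (g ((h *: (1 : R) + t) *: v) - g (t *: v))) =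
    (fun h : R => h^-1 *: (g (h *: v + t *: v) - g (t *: v))); last exact: h.
by apply/funext => k; rewrite scalerDl [k *: (1 : R)]/GRing.scale /= mulr1.
Qed.

Lemma derive_inv_field_bound v : exists K, forall t, 0 <= t <= 1 -> forall x,
  `|'D_x (F v) (t *: v)| <= K * `|x|.
Proof.
pose phi t := \sum_i `|'D_(hdir i) (F v) (t *: v)| + `|'D_vdir (F v) (t *: v)|.
have c1 u : continuous (fun t : R => `|'D_u (F v) (t *: v)|).
  move=> t; apply: cvg_norm.
  apply: (@cvg_comp _ _ _ (fun t : R => t *: v) (fun p => 'D_u (F v) p) _ (nbhs (t *: v))).
    by apply: cvgZr_tmp; exact: cvg_id.
  exact: derive_inv_field_continuous.
have cphi : continuous phi.
  move=> t; apply: cvgD; last exact: c1.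
  have cs : continuous (fun t : R => \sum_i `|'D_(hdir i) (F v) (t *: v)|).
    by apply: continuous_big => [|i _]; [exact: add_continuous|exact: c1].
  exact: cs.
have [|c _ hc] := @EVT_max R phi 0 1 ler01; first exact: continuous_subspaceT.
exists (phi c) => t t01 x; rewrite derive_inv_field_decomp.
apply: (@le_trans _ _ (phi t * `|x|)); last first.
  by apply: ler_wpM2r; [exact: normr_ge0|apply: hc; rewrite in_itv /= t01].
have n1 i : `|x.1 0 i| <= `|x|.
  by apply: le_trans (coord_le_norm _ i) _; rewrite prod_normE le_max lexx.
have n2 : `|x.2| <= `|x| by rewrite prod_normE le_max lexx orbT.
apply: le_trans (ler_normD _ _) _; rewrite mulrDl; apply: lerD; last first.
  by rewrite normrZ mulrC ler_wpM2l.
apply: le_trans (ler_norm_sum _ _ _) _; rewrite mulr_suml; apply: ler_sum => i _.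
by rewrite normrZ mulrC ler_wpM2l.
Qed.

(** With all derivatives replaced by free vectors, the identity splits into coordinates and becomes
    linear arithmetic. *)
Lemma solution_algebra (t b : R) (a w c z Dw D0 Da dw : E) :
  a + t *: Dw = w -> c + t *: D0 = z -> b *: (c - z) = 0 -> dw - Da = b *: c ->
  (1 : R) *: (a - w - (t * (2^-1 * b)) *: z) + t *: (dw - (2^-1 * b) *: z) =
  t *: Da + ((- t) *: Dw + (- (t * (t * (2^-1 * b)))) *: D0).
Proof.
have comb (wi ai ci vi Dwi D0i Dai dwi : R) : ai + t * Dwi = wi ->
    ci + t * D0i = vi -> b * (ci - vi) = 0 -> dwi - Dai = b * ci ->
    1 * (ai - wi - t * (2^-1 * b) * vi) + t * (dwi - 2^-1 * b * vi) =
    t * Dai + (- t * Dwi + - (t * (t * (2^-1 * b))) * D0i).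
  move=> h1 h2 h3 h4.
  have h2' : t * (2^-1 * b) * (ci + t * D0i) = t * (2^-1 * b) * vi by rewrite h2.
  have h3' : t * (b * (ci - vi)) = 0 by rewrite h3 mulr0.
  have h4' : t * (dwi - Dai) = t * (b * ci) by rewrite h4.
  lra.
move=> h1 h2 h3 h4; apply: cpoint_eq => [i|].
  have := congr1 (fun x : E => x.1 0 i) h4; have := congr1 (fun x : E => x.1 0 i) h3.
  have := congr1 (fun x : E => x.1 0 i) h2; have := congr1 (fun x : E => x.1 0 i) h1.
  rewrite /= !mxE; exact: comb.
have := congr1 (fun x : E => x.2) h4; have := congr1 (fun x : E => x.2) h3.
have := congr1 (fun x : E => x.2) h2; have := congr1 (fun x : E => x.2) h1.
exact: comb.
Qed.

(** Along the ray t v, the bracket relation and [derive_ray] show that W, which is t times the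
    deviation from the expected field, solves W' = D_W (F v). As W 0 = 0, Gronwall gives W 1 = 0.
    The second hypothesis says that the vertical field is constant along the ray unless b = 0. *)
Lemma inv_field_solution v w b :
  (forall p, lie_bracket (F v) (F w) p = b *: F vdir p) ->
  (forall t, b *: (F vdir (t *: v) - vdir) = 0) ->
  F w v = w + (2^-1 * b) *: vdir.
Proof.
move=> br b0.
pose W t := t *: (F w (t *: v) - w - (t * (2^-1 * b)) *: vdir).
pose dW t := 'D_(W t) (F v) (t *: v).
have hW t : is_derive t (1 : R) W (dW t).
  have h1 := is_derive_along (inv_field_differentiable G w (t *: v)).
  have h2 : is_derive t (1 : R) (fun t => F w (t *: v) - w - (t * (2^-1 * b)) *: vdir)
      ('D_v (F w) (t *: v) - (2^-1 * b) *: vdir).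
    have h3 : is_derive t (1 : R) (fun t : R => t * (2^-1 * b)) (2^-1 * b).
      by apply: is_derive_eq; rewrite /GRing.scale /= !mulr1 ?mulr0 ?add0r ?addr0.
    have h4 := is_derive_scale h3 (is_derive_cst vdir t (1 : R)).
    have h5 := is_deriveB (is_deriveB h1 (is_derive_cst w t (1 : R))) h4.
    by apply: is_derive_eq h5 _; rewrite scaler0 addr0 subr0.
  apply: is_derive_eq (is_derive_scale (is_derive_id t 1) h2) _.
  have brt := br (t *: v); rewrite /lie_bracket (inv_field_ray G t v) in brt.
  have WE : W t = t *: F w (t *: v) +
      ((- t) *: w + ((- (t * (t * (2^-1 * b)))) *: vdir + 0)).
    by rewrite /W addr0 !scalerBr !scaleNr scalerA addrA.
  have lin := derive_inv_field_lin G.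
  have L3 := etrans (lin (- (t * (t * (2^-1 * b)))) vdir 0 v (t *: v))
    (etrans (congr1 (+%R _) (derive0 (F v) (t *: v))) (addr0 _)).
  have L2 := etrans (lin (- t) w ((- (t * (t * (2^-1 * b)))) *: vdir + 0) v (t *: v))
    (congr1 (+%R _) L3).
  have L1 := etrans (lin t (F w (t *: v)) _ v (t *: v)) (congr1 (+%R _) L2).
  have L0 := etrans (congr1 (fun x => 'D_x (F v) (t *: v)) WE) L1.
  have S0 := solution_algebra (derive_ray G w v t) (derive_ray G vdir v t) (b0 t) brt.
  exact: (etrans S0 (esym L0)).
have [K hK] := derive_inv_field_bound v.
have W0 : W 0 = 0 by rewrite /W scale0r.
have := gronwall_zero W0 hW (fun t t01 => hK t t01 (W t)).
rewrite /W !scale1r mul1r => /eqP; rewrite subr_eq0 subr_eq addrC => /eqP ->.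
by rewrite addrC.
Qed.

End ExponentialCoordinates.

Section ExplicitFields.
Variables (R : realType) (n : nat) (G : contactCarnotGroup R n).
Local Notation E := (Defs.cpoint R n).
Local Notation hdir := (@horizontal_dir R n).
Local Notation vdir := (vertical_dir R n).
Local Notation F := (inv_field G).

Opaque derive.

(** The case b = 0 of [inv_field_solution], whose second hypothesis is then automatic; the result
    supplies that hypothesis for the horizontal fields. *)
Lemma vertical_fieldE (p : E) : F vdir p = vdir.
Proof.
have := @inv_field_solution R n G p vdir 0; rewrite mulr0 scale0r addr0; apply.
  move=> q; have hb i : lie_bracket (F (hdir i)) (F vdir) q = (0 : R) *: F vdir q.
    by rewrite scale0r; exact: (ccg_bracket0 G i q).
  have h0 : lie_bracket (F vdir) (F vdir) q = 0 by exact: subrr.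
  apply: etrans (bracket_fields p hb h0) _.
  by rewrite big1 // => i _; rewrite mulr0.
by move=> t; rewrite scale0r.
Qed.

Lemma horizontal_fieldE i (p : E) :
  ccg_f G i p = (delta_mx 0 i, 2^-1 * (p.1 *m ccg_form G) 0 i).
Proof.
have := @inv_field_solution R n G p (hdir i) ((p.1 *m ccg_form G) 0 i).
rewrite -[inv_field G (hdir i) p]/(ccg_f G i p) => ->.
- by apply: cpoint_eq => [j|] /=; rewrite ?mxE ?mulr0 ?addr0 // add0r /GRing.scale /= mulr1.
- move=> q; have hb j : lie_bracket (F (hdir j)) (F (hdir i)) q = ccg_form G j i *: F vdir q.
    exact: (ccg_bracket G j i q).
  have h0 : lie_bracket (F vdir) (F (hdir i)) q = 0.
    by apply: (@oppr_inj E); rewrite oppr0 opprB; exact: (ccg_bracket0 G i q).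
  apply: etrans (bracket_fields p hb h0) _.
  by rewrite mxE.
by move=> t; rewrite vertical_fieldE subrr scaler0.
Qed.

End ExplicitFields.

(** * Spectral projectors of symmetric and skew matrices *)

Section RealSpectralProjectors.
Variable R : realType.

Lemma trmx_horner_mx d (B : 'M[R]_d.+1) p : (horner_mx B p)^T = horner_mx B^T p.
Proof.
elim/poly_ind: p => [|p c ih]; first by rewrite !rmorph0 trmx0.
rewrite !rmorphD !rmorphM /= !horner_mx_X !horner_mx_C linearD /= tr_scalar_mx.
rewrite [(_ * B)^T]trmx_mul ih; congr (_ + _).
exact/comm_mx_horner.
Qed.

Lemma horner_mx_conjugate (F : fieldType) d (U D : 'M[F]_d.+1) p : U \in unitmx ->
  horner_mx (invmx U *m D *m U) p = invmx U *m horner_mx D p *m U.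
Proof.
move=> Uu; elim/poly_ind: p => [|p c ih].
  by rewrite !rmorph0 mulmx0 mul0mx.
rewrite !rmorphD !rmorphM /= !horner_mx_X !horner_mx_C ih mulmxDr mulmxDl.
congr (_ + _); last by rewrite scalar_mxC -mulmxA mulVmx // mulmx1.
by rewrite -[LHS]/(_ *m _) -[X in _ = _ *m X *m _]/(_ *m _) !mulmxA mulmxK.
Qed.

Lemma interpolation_poly (s : seq R) a : uniq s -> a \in s ->
  exists p : {poly R}, forall x, x \in s -> p.[x] = (x == a)%:R.
Proof.
move=> us as_; exists (\prod_(b <- rem a s) ((a - b)^-1 *: ('X - b%:P))) => x xs.
rewrite horner_prod; case: eqVneq => [->|xa].
  rewrite big_seq big1 // => b; rewrite mem_rem_uniq // inE => /andP[ba _].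
  by rewrite hornerZ hornerXsubC mulVf // subr_eq0 eq_sym.
apply/eqP; rewrite prodf_seq_eq0; apply/hasP; exists x.
  by rewrite mem_rem_uniq // inE xa.
by rewrite /= hornerZ hornerXsubC subrr mulr0 eqxx.
Qed.

(** The projectors are interpolation polynomials in B at its distinct eigenvalues. They are
    therefore real and commute with whatever commutes with B; identities are checked after
    diagonalisation over C and pulled back along the injective f. *)
Lemma diagonalizable_projectors (C : fieldType) (f : {rmorphism R -> C}) d
    (B : 'M[R]_d.+1) (U : 'M[C]_d.+1) (lam : 'I_d.+1 -> R) : B^T = B -> U \in unitmx ->
  map_mx f B = invmx U *m diag_mx (\row_j f (lam j)) *m U ->
  exists (m : nat) (b : 'I_m -> R) (P : 'I_m -> 'M[R]_d.+1),
  [/\ forall k l, P k *m P l = if k == l then P k else 0,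
      \sum_k P k = 1%:M, forall k, (P k)^T = P k,
      forall k, B *m P k = b k *: P k &
      forall k, P k != 0 /\ exists p, P k = horner_mx B p].
Proof.
move=> sB Uu BE.
pose s := undup [seq lam j | j <- enum 'I_d.+1].
have us : uniq s := undup_uniq _.
have lams j : lam j \in s by rewrite mem_undup map_f // mem_enum.
have hp (k : 'I_(size s)) : exists p : {poly R},
    forall x, x \in s -> p.[x] = (x == s`_k)%:R.
  by apply: interpolation_poly => //; rewrite mem_nth.
have [p pE] := choice hp.
pose P k := horner_mx B (p k).
pose Dk (k : 'I_(size s)) : 'M[C]_d.+1 := diag_mx (\row_j (lam j == s`_k)%:R).
have PE k : map_mx f (P k) = invmx U *m Dk k *m U.
  apply: etrans (map_horner_mx f B (p k)) _.
  apply: etrans (congr1 (fun M => horner_mx M _) BE) _.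
  rewrite horner_mx_conjugate // horner_mx_diag.
  congr (_ *m diag_mx _ *m _); apply/rowP => j; rewrite !mxE.
  by rewrite horner_map pE // rmorph_nat.
have finj (X Y : 'M[R]_d.+1) : map_mx f X = map_mx f Y -> X = Y.
  by move=> /matrixP e; apply/matrixP => i j; have := e i j; rewrite !mxE => /fmorph_inj.
exists (size s), (fun k => s`_k), P; split.
- move=> k l; apply: finj; rewrite map_mxM !PE !mulmxA mulmxK //.
  rewrite -[_ *m Dk k *m Dk l]mulmxA mulmx_diag.
  case: eqVneq => [->|kl].
    rewrite PE; congr (_ *m diag_mx _ *m _); apply/rowP => j; rewrite !mxE.
    by case: eqP; rewrite ?mulr1 ?mulr0.
  rewrite map_mx0 (_ : diag_mx _ = 0) ?mulmx0 ?mul0mx //.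
  apply/matrixP => i j; rewrite !mxE; case: (i == j); rewrite ?mulr0n // mulr1n.
  case: eqP => [->|_]; last by rewrite mul0r.
  by rewrite nth_uniq // [_ == _](negbTE kl) mulr0.
- apply: finj; rewrite map_mx1 raddf_sum /=; under eq_bigr do rewrite PE.
  rewrite -mulmx_suml -mulmx_sumr (_ : \sum_k Dk k = 1%:M) ?mulmx1 ?mulVmx //.
  apply/matrixP => i j; rewrite summxE !mxE; under eq_bigr do rewrite !mxE.
  case: (i == j); last by rewrite big1.
  have ki : (index (lam i) s < size s)%N by rewrite index_mem.
  rewrite (bigD1 (Ordinal ki)) //= nth_index // eqxx big1 ?addr0 // => k kn.
  rewrite mulr1n; case: eqP => // e; case/eqP: kn; apply: val_inj => /=.
  by rewrite e index_uniq.
- by move=> k; rewrite trmx_horner_mx sB.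
- move=> k; apply: finj; rewrite map_mxM map_mxZ PE {1}BE !mulmxA mulmxK //.
  rewrite -[_ *m diag_mx _ *m Dk k]mulmxA mulmx_diag scalemxAl scalemxAr.
  congr (_ *m _ *m _); apply/matrixP => i j; rewrite !mxE.
  case: (i == j); rewrite ?mulr0n ?mulr0 // mulr1n.
  by case: eqP => [->|_]; rewrite ?mulr1 ?mulr0.
move=> k; split; last by exists (p k).
have : s`_k \in s by rewrite mem_nth.
rewrite mem_undup => /mapP[j _ sj]; apply/eqP => P0.
have := PE k; rewrite P0 map_mx0 => /(congr1 (fun X => U *m X *m invmx U)).
rewrite mulmx0 mul0mx !mulmxA mulmxV // mul1mx mulmxK // => /matrixP/(_ j j).
by rewrite !mxE sj !eqxx => /eqP; rewrite eq_sym oner_eq0.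
Qed.

(** Over [R[i]] the matrix becomes Hermitian, hence unitarily diagonalisable with real spectrum. *)
Lemma symmetric_projectors d (B : 'M[R]_d.+1) : B^T = B ->
  exists (m : nat) (b : 'I_m -> R) (P : 'I_m -> 'M[R]_d.+1),
  [/\ forall k l, P k *m P l = if k == l then P k else 0,
      \sum_k P k = 1%:M, forall k, (P k)^T = P k,
      forall k, B *m P k = b k *: P k &
      forall k, P k != 0 /\ exists p, P k = horner_mx B p].
Proof.
move=> sB; pose f := real_complex R; pose Bc := map_mx f B.
have Bh : Bc \is hermsymmx.
  apply/is_hermitianmxP; rewrite expr0 scale1r; apply/matrixP => i j; rewrite !mxE /=.
  have -> : B i j = B j i by rewrite -[in LHS]sB mxE.
  by rewrite conj_Creal //; apply/complex_realP; exists (B j i).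
have Bn := hermitian_normalmx Bh.
have [U [sp [Uu BE spR]]] : exists (U : 'M[R[i]]_d.+1) (sp : 'rV[R[i]]_d.+1),
    [/\ U \in unitmx, Bc = invmx U *m diag_mx sp *m U &
        forall j, exists r, sp 0 j = f r].
  exists (spectralmx Bc), (spectral_diag Bc); split; first exact: spectral_unit.
    exact/orthomx_spectralP.
  move=> j; have /mxOverP /(_ 0 j) := hermitian_spectral_diag_real Bh.
  by move=> /complex_realP[r ->]; exists r.
have [lam lamE] := choice spR.
apply: (@diagonalizable_projectors _ f _ B U lam) => //.
by rewrite -[LHS]/Bc BE; congr (_ *m diag_mx _ *m _); apply/rowP => j; rewrite mxE lamE.
Qed.


End RealSpectralProjectors.

Section SkewMatrices.
Variable R : realType.

Definition dot d (u v : 'rV[R]_d) : R := \sum_i u 0 i * v 0 i.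

Lemma dotE d (u v : 'rV[R]_d) : dot u v = (u *m v^T) 0 0.
Proof. by rewrite mxE; apply: eq_bigr => i _; rewrite mxE. Qed.

Lemma dotC d (u v : 'rV[R]_d) : dot u v = dot v u.
Proof. by apply: eq_bigr => i _; rewrite mulrC. Qed.

Lemma dot_sqnorm d (u : 'rV[R]_d) : dot u u = sqnorm u.
Proof. by apply: eq_bigr => i _; rewrite expr2. Qed.

Lemma dotDl d (u v w : 'rV[R]_d) : dot (u + v) w = dot u w + dot v w.
Proof. by rewrite /dot -big_split /=; apply: eq_bigr => i _; rewrite mxE mulrDl. Qed.

Lemma dotZl d k (u w : 'rV[R]_d) : dot (k *: u) w = k * dot u w.
Proof. by rewrite /dot mulr_sumr; apply: eq_bigr => i _; rewrite mxE mulrA. Qed.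

Lemma dotDr d (u v w : 'rV[R]_d) : dot w (u + v) = dot w u + dot w v.
Proof. by rewrite dotC dotDl !(dotC w). Qed.

Lemma dotZr d k (u w : 'rV[R]_d) : dot w (k *: u) = k * dot w u.
Proof. by rewrite dotC dotZl dotC. Qed.

Lemma dotNl d (u w : 'rV[R]_d) : dot (- u) w = - dot u w.
Proof. by rewrite -scaleN1r dotZl mulN1r. Qed.

Lemma dot_suml d m (u : 'I_m -> 'rV[R]_d) w : dot (\sum_k u k) w = \sum_k dot (u k) w.
Proof.
rewrite /dot exchange_big /=; apply: eq_bigr => i _.
by rewrite summxE mulr_suml.
Qed.

Lemma dot_sumr d m (u : 'I_m -> 'rV[R]_d) w : dot w (\sum_k u k) = \sum_k dot w (u k).
Proof. by rewrite dotC dot_suml; apply: eq_bigr => k _; rewrite dotC. Qed.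

Lemma dot_mull d (u v : 'rV[R]_d) (M : 'M[R]_d) : dot (u *m M) v = dot u (v *m M^T).
Proof. by rewrite !dotE trmx_mul trmxK mulmxA. Qed.

(** B = - A^2 = A^T A is symmetric and positive definite, and a_k is the square root of its k-th
    distinct eigenvalue. The P_k are polynomials in A^2, so they commute with A. *)
Lemma skew_projectors d (A : 'M[R]_d) : (0 < d)%N -> A^T = - A -> A \in unitmx ->
  exists (m : nat) (a : 'I_m -> R) (P : 'I_m -> 'M[R]_d),
  [/\ (0 < m)%N, forall k, 0 < a k /\ P k != 0,
      [/\ forall k l, P k *m P l = if k == l then P k else 0,
      \sum_k P k = 1%:M & forall k, (P k)^T = P k],
      forall k, P k *m A = A *m P k &
      forall k, A *m A *m P k = - (a k ^+ 2) *: P k].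
Proof.
case: d A => [//|d] A _ skA uA; pose B := - (A *m A).
have sB : B^T = B by rewrite /B linearN /= trmx_mul skA mulmxN mulNmx opprK.
have [m [b [P [PP sP tP BP hP]]]] := symmetric_projectors sB.
have cA k : P k *m A = A *m P k.
  have [_ [p ->]] := hP k; apply: comm_horner_mx.
  by rewrite /comm_mx /B mulNmx mulmxN mulmxA.
(* A nonzero row u of P_k is an eigenvector, and b_k |u|^2 = |u A|^2 is positive because A is
   invertible. *)
have b0 k : 0 < b k.
  have [Pk0 _] := hP k.
  have [i ui0] : exists i, row i (P k) != 0.
    apply/existsP; rewrite -negb_forall; apply: contra Pk0 => /forallP h.
    by apply/eqP/row_matrixP => i; rewrite row0; exact/eqP.
  set u := row i (P k) in ui0.
  have uB : u *m B = b k *: u.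
    rewrite -row_mul -linearZ /=; congr row.
    by rewrite -[LHS]trmxK trmx_mul tP sB BP linearZ /= tP.
  have n0 : 0 < sqnorm u.
    by rewrite lt_neqAle sqnorm_ge0 andbT eq_sym sqnorm_eq0.
  have uA0 : u *m A != 0.
    by apply: contra ui0 => /eqP e; rewrite -(mulmxK uA u) e mul0mx.
  have n1 : 0 < sqnorm (u *m A).
    by rewrite lt_neqAle sqnorm_ge0 andbT eq_sym sqnorm_eq0.
  have : dot (u *m B) u = sqnorm (u *m A).
    rewrite -dot_sqnorm dot_mull [in RHS]dot_mull skA sB /B.
    by rewrite mulmxN mulmxN mulmxA.
  rewrite uB dotZl dot_sqnorm => e.
  by rewrite -(pmulr_lgt0 _ n0) e.
exists m, (fun k => Num.sqrt (b k)), P; split => //.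
- rewrite lt0n; apply/eqP => m0; move: sP; rewrite big1 => [|[k km]]; last first.
    by exfalso; rewrite m0 in km.
  by move=> /matrixP/(_ 0 0); rewrite !mxE eqxx => /eqP; rewrite eq_sym oner_eq0.
- by move=> k; rewrite sqrtr_gt0; have [Pk0 _] := hP k.
by move=> k; rewrite sqr_sqrtr ?ltW // scaleNr -BP /B mulNmx opprK.
Qed.

End SkewMatrices.

(** * Hamilton's equations and uniqueness of their solutions *)

Section HamiltonianField.
Variables (R : realType) (n : nat) (G : contactCarnotGroup R n).
Local Notation N := (n.*2).
Local Notation E := (Defs.cpoint R n).
Local Notation A := (ccg_form G).

(** The vector of the functions h_i = <eta, f_i(q)>; the Hamiltonian is half its square norm. *)
Definition momentum (q eta : E) : 'rV[R]_N := eta.1 + (eta.2 * 2^-1) *: (q.1 *m A).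

Lemma hamiltonianE q eta :
  sub_riemannian_H G (q, eta) = 2^-1 * sqnorm (momentum q eta).
Proof.
rewrite /sub_riemannian_H /sqnorm; congr (_ * _); apply: eq_bigr => i _.
rewrite horizontal_fieldE /pairing /= !mxE (bigD1 i) //= !mxE !eqxx mulr1 big1; last first.
  by move=> j ji; rewrite mxE eqxx (negbTE ji) mulr0.
by rewrite addr0 mulrA.
Qed.

Lemma is_derive_affine (V W : normedModType R) (f : V -> W) (a v : V) (d : W) :
  (forall h : R, f (h *: v + a) - f a = h *: d) -> is_derive a v f d.
Proof.
move=> hf; apply/is_derive_cvg.
apply: (@cvg_trans _ ((fun=> d) @ (0 : R)^')); last exact: cvg_cst.
apply: near_eq_cvg; near=> h.
have h0 : h != 0 by near: h; exact: nbhs_dnbhs_neq.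
by rewrite hf scalerA mulVf // scale1r.
Unshelve. all: by end_near. Qed.

Lemma is_derive_dot (V : normedModType R) d (f g : V -> 'rV[R]_d) (a v : V) df dg :
  is_derive a v f df -> is_derive a v g dg ->
  is_derive a v (fun x => dot (f x) (g x)) (dot df (g a) + dot (f a) dg).
Proof.
move=> hf hg; rewrite /dot -big_split /=; apply: is_derive_sumE => i.
apply: is_derive_eq (is_deriveM (is_derive_coord i hf) (is_derive_coord i hg)) _.
by rewrite /GRing.scale /= addrC; congr (_ + _); rewrite mulrC.
Qed.

Lemma is_derive_half_sqnorm (V : normedModType R) d (f : V -> 'rV[R]_d) (a v : V) df :
  is_derive a v f df ->
  is_derive a v (fun x => 2^-1 * sqnorm (f x)) (dot (f a) df).
Proof.
move=> hf; under [X in is_derive _ _ X]eq_fun do rewrite -dot_sqnorm.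
apply: is_derive_eq (is_deriveZ 2^-1 (is_derive_dot hf hf)) _.
by rewrite dotC /GRing.scale /=; field.
Qed.

Lemma dot_delta d (u : 'rV[R]_d) i : dot u (delta_mx 0 i) = u 0 i.
Proof.
rewrite /dot (bigD1 i) //= mxE !eqxx mulr1 big1 ?addr0 // => j ji.
by rewrite mxE eqxx (negbTE ji) mulr0.
Qed.

Lemma partials_covector q eta :
  partials (fun eta => sub_riemannian_H G (q, eta)) eta =
  (momentum q eta, 2^-1 * dot (momentum q eta) (q.1 *m A)).
Proof.
have hE : (fun eta => sub_riemannian_H G (q, eta)) =
    (fun eta => 2^-1 * sqnorm (momentum q eta)).
  by apply/funext => e; exact: hamiltonianE.
have D v : 'D_v (fun eta => sub_riemannian_H G (q, eta)) eta =
    dot (momentum q eta) (v.1 + (v.2 * 2^-1) *: (q.1 *m A)).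
  have hd : is_derive eta v (momentum q) (v.1 + (v.2 * 2^-1) *: (q.1 *m A)); last first.
    by rewrite hE; have [] := is_derive_half_sqnorm hd.
  apply: is_derive_affine => h; rewrite /momentum /= scalerDr scalerA mulrA.
  rewrite opprD addrACA addrK -scalerBl; congr (_ + _ *: _).
  by rewrite mulrDl addrK.
rewrite /partials; congr pair.
  by apply/rowP => i; rewrite mxE D /= mul0r scale0r addr0 dot_delta.
by rewrite D /= add0r mul1r dotZr.
Qed.

Lemma partials_point q eta :
  - partials (fun q => sub_riemannian_H G (q, eta)) q =
  ((eta.2 * 2^-1) *: (momentum q eta *m A), 0).
Proof.
have hE : (fun q => sub_riemannian_H G (q, eta)) =
    (fun q => 2^-1 * sqnorm (momentum q eta)).
  by apply/funext => e; exact: hamiltonianE.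
have D v : 'D_v (fun q => sub_riemannian_H G (q, eta)) q =
    dot (momentum q eta) ((eta.2 * 2^-1) *: (v.1 *m A)).
  have hd : is_derive q v (momentum^~ eta) ((eta.2 * 2^-1) *: (v.1 *m A)); last first.
    by rewrite hE; have [] := is_derive_half_sqnorm hd.
  apply: is_derive_affine => h; rewrite /momentum /= opprD addrACA subrr add0r.
  by rewrite mulmxDl -scalemxAl scalerDr addrK !scalerA [h * _]mulrC.
rewrite /partials -[LHS]/(_, _) /=; congr pair; last first.
  by rewrite D /= mul0mx scaler0 /dot big1 ?oppr0 // => i _; rewrite [X in _ * X]mxE mulr0.
apply/rowP => i; rewrite !mxE D /= dotZr dotC dot_mull ccg_form_skew.
by rewrite dotC dot_delta mulmxN mxE mulrN opprK mxE.
Qed.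

Lemma hamiltonian_fieldE l : hamiltonian_field (sub_riemannian_H G) l =
  ((momentum l.1 l.2, 2^-1 * dot (momentum l.1 l.2) (l.1.1 *m A)),
   ((l.2.2 * 2^-1) *: (momentum l.1 l.2 *m A), 0)).
Proof. by apply: (congr2 pair); [exact: partials_covector|exact: partials_point]. Qed.

End HamiltonianField.

Section Uniqueness.
Variables (R : realType) (n : nat) (G : contactCarnotGroup R n).
Local Notation N := (n.*2).
Local Notation E := (Defs.cpoint R n).
Local Notation A := (ccg_form G).

Lemma dot_skew (u : 'rV[R]_N) : dot u (u *m A) = 0.
Proof.
have : dot u (u *m A) = - dot u (u *m A).
  by rewrite {1}dotC dot_mull ccg_form_skew mulmxN dotC dotNl dotC.
lra.
Qed.

Lemma is_derive_mulmx (u : R -> 'rV[R]_N) t du (M : 'M[R]_N) :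
  is_derive t (1 : R) u du -> is_derive t (1 : R) (fun t => u t *m M) (du *m M).
Proof.
move=> hu; apply: is_derive_row => i; rewrite mxE.
under [X in is_derive _ _ X]eq_fun do rewrite mxE.
apply: is_derive_sumE => j.
apply: is_derive_eq (is_deriveM (is_derive_coord j hu) (is_derive_cst (M j i) t 1)) _.
by rewrite /GRing.scale /= mulr0 add0r mulrC.
Qed.

Lemma const_row (u : R -> 'rV[R]_N) :
  (forall t, is_derive t (1 : R) u 0) -> forall t, u t = u 0.
Proof.
move=> h t; apply/rowP => i.
apply: (@is_derive_0_is_cst R (fun t => u t 0 i)) => s.
by have := is_derive_coord i (h s); rewrite mxE.
Qed.

Section Curve.
Variable l : R -> E * E.
Hypothesis hl : integral_curve G l.

Lemma curve_derive t : is_derive t (1 : R) l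
  ((momentum G (l t).1 (l t).2, 2^-1 * dot (momentum G (l t).1 (l t).2) ((l t).1.1 *m A)),
   (((l t).2.2 * 2^-1) *: (momentum G (l t).1 (l t).2 *m A), 0)).
Proof. by rewrite -hamiltonian_fieldE; exact: hl. Qed.

Lemma curve_zeta t : (l t).2.2 = (l 0).2.2.
Proof.
apply: (@is_derive_0_is_cst R (fun t => (l t).2.2)) => s.
exact: (is_derive_snd (is_derive_snd (curve_derive s))).
Qed.

Definition curve_momentum t := (l t).2.1 + ((l 0).2.2 * 2^-1) *: ((l t).1.1 *m A).

Lemma curve_momentumE t : momentum G (l t).1 (l t).2 = curve_momentum t.
Proof. by rewrite /momentum curve_zeta. Qed.

Lemma curve_point t : is_derive t (1 : R) (fun t => (l t).1.1) (curve_momentum t).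
Proof.
rewrite -curve_momentumE.
exact: (is_derive_fst (is_derive_fst (curve_derive t))).
Qed.

Lemma curve_height t : is_derive t (1 : R) (fun t => (l t).1.2)
  (2^-1 * dot (curve_momentum t) ((l t).1.1 *m A)).
Proof.
rewrite -curve_momentumE.
exact: (is_derive_snd (is_derive_fst (curve_derive t))).
Qed.

(** One half of the factor zeta comes from the covector equation, the other from differentiating
    zeta x A / 2. *)
Lemma curve_momentum_derive t :
  is_derive t (1 : R) curve_momentum ((l 0).2.2 *: (curve_momentum t *m A)).
Proof.
have h1 := is_derive_fst (is_derive_snd (curve_derive t)).
have h2 := is_derive_mulmx A (curve_point t).
apply: is_derive_eq (is_deriveD h1 (is_deriveZ ((l 0).2.2 * 2^-1) h2)) _.
by rewrite /= curve_momentumE curve_zeta -scalerDl; congr (_ *: _); field.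
Qed.

End Curve.

(** The difference d of two momenta solves d' = zeta d A with A skew, so |d| is constant. Points and
    heights are then primitives of the same functions. *)
Lemma integral_curve_unique l1 l2 : integral_curve G l1 -> integral_curve G l2 ->
  l1 0 = l2 0 -> forall t, (l1 t).1 = (l2 t).1.
Proof.
move=> h1 h2 e0.
have hm t : curve_momentum l1 t = curve_momentum l2 t.
  pose d t := curve_momentum l1 t - curve_momentum l2 t.
  have dd s : is_derive s (1 : R) d ((l1 0).2.2 *: (d s *m A)).
    have hd2 := curve_momentum_derive h2 s; rewrite -e0 in hd2.
    apply: is_derive_eq (is_deriveB (curve_momentum_derive h1 s) hd2) _.
    by rewrite -scalerBr mulmxBl.
  have sd s : is_derive s (1 : R) (fun t => dot (d t) (d t)) 0.
    apply: is_derive_eq (is_derive_dot (dd s) (dd s)) _.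
    by rewrite dotZl dotZr [dot (_ *m A) _]dotC dot_skew mulr0 addr0.
  have := @is_derive_0_is_cst R (fun t => dot (d t) (d t)) t 0 sd.
  have -> : d 0 = 0 by rewrite /d /curve_momentum e0 subrr.
  rewrite !dot_sqnorm sqnorm0 => /eqP; rewrite sqnorm_eq0 subr_eq0.
  by move=> /eqP.
have hx t : (l1 t).1.1 = (l2 t).1.1.
  have hd s : is_derive s (1 : R) (fun t => (l1 t).1.1 - (l2 t).1.1) 0.
    apply: is_derive_eq (is_deriveB (curve_point h1 s) (curve_point h2 s)) _.
    by rewrite hm subrr.
  by have := const_row hd t; rewrite /= e0 subrr => /eqP; rewrite subr_eq0 => /eqP.
move=> t; rewrite [LHS]surjective_pairing [RHS]surjective_pairing hx; congr pair.
have hd s : is_derive s (1 : R) (fun t => (l1 t).1.2 - (l2 t).1.2) 0.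
  apply: is_derive_eq (is_deriveB (curve_height h1 s) (curve_height h2 s)) _.
  by rewrite hm hx subrr.
have := @is_derive_0_is_cst R (fun t => (l1 t).1.2 - (l2 t).1.2) t 0 hd.
by rewrite e0 subrr => /eqP; rewrite subr_eq0 => /eqP.
Qed.

(** Uniqueness lets one explicit curve decide the existential in [exp_map_graph]. *)
Lemma exp_map_graphE l eta p : integral_curve G l -> l 0 = (0, eta) ->
  exp_map_graph G eta p <-> (l 1).1 = p.
Proof.
move=> hl l0; split=> [[l' [hl' l'0 <-]]|e]; last by exists l.
by apply: integral_curve_unique => //; rewrite l0.
Qed.

End Uniqueness.

(** * Explicit geodesics by functional calculus in A *)

Section FunctionalCalculus.
Variables (R : realType) (n : nat) (G : contactCarnotGroup R n).
Local Notation N := (n.*2).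
Local Notation E := (Defs.cpoint R n).
Local Notation A := (ccg_form G).
Variables (m : nat) (a : 'I_m -> R) (P : 'I_m -> 'M[R]_N).
Hypothesis a_gt0 : forall k, 0 < a k.
Hypothesis PP : forall k l, P k *m P l = if k == l then P k else 0.
Hypothesis sumP : \sum_k P k = 1%:M.
Hypothesis trP : forall k, (P k)^T = P k.
Hypothesis PA : forall k, P k *m A = A *m P k.
Hypothesis AAP : forall k, A *m A *m P k = - (a k ^+ 2) *: P k.

(* With B = - A^2 = sum a_k^2 P_k, this is xi (f(B) + A g(B)). *)
Definition fcalc (f g : 'I_m -> R) (xi : 'rV[R]_N) : 'rV[R]_N :=
  \sum_k (f k *: (xi *m P k) + g k *: (xi *m A *m P k)).

Definition weight (xi : 'rV[R]_N) k := sqnorm (xi *m P k).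

Lemma weight_ge0 xi k : 0 <= weight xi k.
Proof. exact: sqnorm_ge0. Qed.

Lemma dotPP xi eta k l :
  dot (xi *m P k) (eta *m P l) = if k == l then dot (xi *m P k) eta else 0.
Proof.
rewrite dotC dot_mull trP -mulmxA PP; case: eqP => _; first by rewrite dotC.
by rewrite mulmx0 /dot big1 // => i _; rewrite mxE mulr0.
Qed.

Lemma weightE xi k : weight xi k = dot (xi *m P k) xi.
Proof. by rewrite /weight -dot_sqnorm dotPP eqxx. Qed.

Lemma sum_weight xi : \sum_k weight xi k = sqnorm xi.
Proof.
under eq_bigr do rewrite weightE.
by rewrite -dot_suml -mulmx_sumr sumP mulmx1 dot_sqnorm.
Qed.

Lemma eq_fcalc f f' g g' xi : f =1 f' -> g =1 g' -> fcalc f g xi = fcalc f' g' xi.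
Proof. by move=> ff gg; apply: eq_bigr => k _; rewrite ff gg. Qed.

Lemma fcalc_id xi : fcalc (fun=> 1) (fun=> 0) xi = xi.
Proof.
rewrite /fcalc; under eq_bigr do rewrite scale1r scale0r addr0.
by rewrite -mulmx_sumr sumP mulmx1.
Qed.

Lemma fcalc_P f g xi k :
  fcalc f g xi *m P k = f k *: (xi *m P k) + g k *: (xi *m A *m P k).
Proof.
rewrite /fcalc mulmx_suml (bigD1 k) //= big1 ?addr0 => [|j jk].
  by rewrite mulmxDl -!scalemxAl -!mulmxA PP eqxx.
by rewrite mulmxDl -!scalemxAl -!mulmxA PP (negbTE jk) !mulmx0 !scaler0 addr0.
Qed.

Lemma fcalc_A f g xi : fcalc f g xi *m A = fcalc (fun k => - (g k * a k ^+ 2)) f xi.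
Proof.
rewrite /fcalc mulmx_suml; apply: eq_bigr => k _.
rewrite mulmxDl -!scalemxAl -!mulmxA PA addrC; congr (_ + _).
by rewrite mulmxA mulmxA -[xi *m A *m A]mulmxA -mulmxA AAP -scalemxAr scalerA mulrN.
Qed.

Lemma fcalcZ c f g xi : c *: fcalc f g xi = fcalc (fun k => c * f k) (fun k => c * g k) xi.
Proof.
by rewrite /fcalc scaler_sumr; apply: eq_bigr => k _; rewrite scalerDr !scalerA.
Qed.

(* (f + A g)(f' + A g') = (f f' - B g g') + A (f g' + g f') *)
Lemma fcalc_comp f g f' g' xi : fcalc f g (fcalc f' g' xi) =
  fcalc (fun k => f k * f' k - a k ^+ 2 * (g k * g' k))
        (fun k => f k * g' k + g k * f' k) xi.
Proof.
rewrite {1}/fcalc; apply: eq_bigr => k _.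
rewrite fcalc_A !fcalc_P !scalerDr !scalerA addrACA -!scalerDl.
by congr (_ *: _ + _ *: _); ring.
Qed.

Lemma dot_odd xi k l : dot (xi *m P k) (xi *m A *m P l) = 0.
Proof.
rewrite dotPP; case: eqP => // _.
have h : dot (xi *m P k) (xi *m A) = dot (xi *m P k) (xi *m P k *m A).
  by rewrite -[xi *m P k *m A]mulmxA PA mulmxA dotPP eqxx.
by rewrite h dot_skew.
Qed.

Lemma dot_oddodd xi k l : dot (xi *m A *m P k) (xi *m A *m P l) =
  if k == l then a k ^+ 2 * weight xi k else 0.
Proof.
rewrite dotPP; case: eqP => // _.
rewrite dotC dot_mull ccg_form_skew mulmxN -[xi *m A *m P k *m A]mulmxA PA mulmxA.
rewrite -[xi *m A *m A]mulmxA -mulmxA AAP -scalemxAr scaleNr opprK dotZr dotC.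
by rewrite -weightE.
Qed.

Lemma dot_fcalc f g f' g' xi : dot (fcalc f g xi) (fcalc f' g' xi) =
  \sum_k (f k * f' k + a k ^+ 2 * (g k * g' k)) * weight xi k.
Proof.
rewrite dot_suml; apply: eq_bigr => k _; rewrite dot_sumr (bigD1 k) //= big1 ?addr0.
  rewrite !dotDl !dotDr !dotZl !dotZr dot_odd [dot (_ *m A *m P k) (xi *m P k)]dotC.
  rewrite dot_odd dot_oddodd dotPP eqxx -weightE; ring.
move=> j jk; rewrite !dotDl !dotDr !dotZl !dotZr dot_odd.
rewrite [dot (_ *m A *m P k) (xi *m P j)]dotC dot_odd dot_oddodd dotPP.
by rewrite eq_sym (negbTE jk) !mulr0 !addr0.
Qed.

(** On the range of P_k the square of A is -a_k^2, so f + A g multiplies lengths there by |f + i a_k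
    g|. *)
Lemma weight_fcalc f g xi k :
  weight (fcalc f g xi) k = (f k ^+ 2 + a k ^+ 2 * g k ^+ 2) * weight xi k.
Proof.
rewrite /weight fcalc_P -dot_sqnorm !dotDl !dotDr !dotZl !dotZr dot_odd.
rewrite [dot (_ *m A *m P k) (xi *m P k)]dotC dot_odd dot_oddodd eqxx.
by rewrite dotPP eqxx -weightE /weight; ring.
Qed.

Lemma is_derive_fcalc (f g : R -> 'I_m -> R) t df dg xi :
  (forall k, is_derive t (1 : R) (f^~ k) (df k)) ->
  (forall k, is_derive t (1 : R) (g^~ k) (dg k)) ->
  is_derive t (1 : R) (fun t => fcalc (f t) (g t) xi) (fcalc df dg xi).
Proof.
move=> hf hg; apply: is_derive_sumE => k.
have h (c : R -> R) (dc : R) (v : 'rV[R]_N) : is_derive t (1 : R) c dc ->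
    is_derive t (1 : R) (fun t => c t *: v) (dc *: v).
  move=> hc; apply: is_derive_eq (is_derive_scale hc (is_derive_cst v t 1)) _.
  by rewrite scaler0 addr0.
by apply: is_deriveD; apply: h.
Qed.

Section Geodesic.
Variables (xi : 'rV[R]_N) (zeta : R).
Hypothesis zeta0 : zeta != 0.

Let th t k := t * (zeta * a k).
(** This is xi exp(t zeta A); [xsol] is its primitive vanishing at 0, and [zsol] integrates half the
    product of h with x A. *)
Let hsol t := fcalc (fun k => cos (th t k)) (fun k => sin (th t k) / a k) xi.
Let xsol t := fcalc (fun k => sin (th t k) / (zeta * a k))
  (fun k => (1 - cos (th t k)) / (zeta * a k ^+ 2)) xi.
Let zsol t := \sum_k weight xi k * (th t k - sin (th t k)) / (2 * zeta ^+ 2 * a k).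

Let a0 k : a k != 0. Proof. by rewrite gt_eqF. Qed.

Let dth t k : is_derive t (1 : R) (th^~ k) (zeta * a k).
Proof. by apply: is_derive_eq; rewrite /GRing.scale /= mulr1 ?mulr0 ?add0r ?addr0. Qed.

Let dsin t k : is_derive t (1 : R) (fun t => sin (th t k)) (cos (th t k) * (zeta * a k)).
Proof. exact: (@is_derive1_comp _ sin (th^~ k) t _ _ (is_derive_sin _) (dth t k)). Qed.

Let dcos t k : is_derive t (1 : R) (fun t => cos (th t k)) (- sin (th t k) * (zeta * a k)).
Proof. exact: (@is_derive1_comp _ cos (th^~ k) t _ _ (is_derive_cos _) (dth t k)). Qed.

Let dscal t (f : R -> R) df c : is_derive t (1 : R) f df ->
  is_derive t (1 : R) (fun t => f t / c) (df / c).
Proof.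
move=> hf; apply: is_derive_eq (is_deriveM hf (is_derive_cst c^-1 t 1)) _.
by rewrite /GRing.scale /= mulr0 add0r mulrC.
Qed.

Let hsol_derive t : is_derive t (1 : R) hsol (zeta *: (hsol t *m A)).
Proof.
apply: is_derive_eq (is_derive_fcalc _ (dcos t) (fun k => dscal (a k) (dsin t k))) _.
by rewrite fcalc_A fcalcZ; apply: eq_fcalc => k; field.
Qed.

Let xsol_derive t : is_derive t (1 : R) xsol (hsol t).
Proof.
have d1 k : is_derive t (1 : R) (fun t => 1 - cos (th t k)) (sin (th t k) * (zeta * a k)).
  apply: is_derive_eq (is_deriveB (is_derive_cst (1 : R) t 1) (dcos t k)) _.
  by rewrite sub0r mulNr opprK.
apply: is_derive_eq (is_derive_fcalc _ (fun k => dscal (zeta * a k) (dsin t k))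
  (fun k => dscal (zeta * a k ^+ 2) (d1 k))) _.
by apply: eq_fcalc => k; field; rewrite ?zeta0 ?a0.
Qed.

Let zsol_derive t : is_derive t (1 : R) zsol (2^-1 * dot (hsol t) (xsol t *m A)).
Proof.
have d1 k : is_derive t (1 : R)
    (fun t => weight xi k * (th t k - sin (th t k)) / (2 * zeta ^+ 2 * a k))
    (weight xi k * (zeta * a k - cos (th t k) * (zeta * a k)) / (2 * zeta ^+ 2 * a k)).
  apply: dscal; apply: is_derive_eq
    (is_deriveM (is_derive_cst (weight xi k) t 1) (is_deriveB (dth t k) (dsin t k))) _.
  by rewrite /GRing.scale /= mulr0 addr0.
apply: is_derive_eq (is_derive_sumE d1) _.
rewrite fcalc_A dot_fcalc mulr_sumr; apply: eq_bigr => k _.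
have := cos2Dsin2 (th t k); set c := cos _; set s := sin _ => cs.
have -> : c * - ((1 - c) / (zeta * a k ^+ 2) * a k ^+ 2) +
   a k ^+ 2 * (s / a k * (s / (zeta * a k))) = (1 - c) / zeta.
  have -> : c * - ((1 - c) / (zeta * a k ^+ 2) * a k ^+ 2) +
   a k ^+ 2 * (s / a k * (s / (zeta * a k))) = (c ^+ 2 + s ^+ 2 - c) / zeta.
    by field; rewrite zeta0 a0.
  by rewrite cs.
by field; rewrite zeta0 a0.
Qed.

Lemma geodesic_curve : exists l, [/\ integral_curve G l, l 0 = (0, (xi, zeta)) &
  (l 1).1 = (fcalc (fun k => sin (zeta * a k) / (zeta * a k))
               (fun k => (1 - cos (zeta * a k)) / (zeta * a k ^+ 2)) xi,
             \sum_k weight xi k * (zeta * a k - sin (zeta * a k)) / (2 * zeta ^+ 2 * a k))].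
Proof.
pose l t : E * E := ((xsol t, zsol t), (hsol t - (zeta * 2^-1) *: (xsol t *m A), zeta)).
have th0 k : th 0 k = 0 by rewrite /th mul0r.
have th1 k : th 1 k = zeta * a k by rewrite /th mul1r.
have ml t : momentum G (l t).1 (l t).2 = hsol t by rewrite /momentum /= subrK.
exists l; split.
- move=> t; rewrite hamiltonian_fieldE ml.
  apply: is_derive_pairE.
    by apply: is_derive_pairE; [exact: xsol_derive|exact: zsol_derive].
  apply: is_derive_pairE.
  apply: is_derive_eq (is_deriveB (hsol_derive t)
    (is_deriveZ (zeta * 2^-1) (is_derive_mulmx A (xsol_derive t)))) _.
  by rewrite /= -scalerBl; congr (_ *: _); field.
- have x0 : xsol 0 = 0.
    rewrite /xsol /fcalc big1 // => k _; rewrite th0 sin0 cos0 subrr !mul0r.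
    by rewrite !scale0r addr0.
  rewrite /l x0 mul0mx scaler0 subr0; congr ((_, _), (_, _)).
    by rewrite /zsol big1 // => k _; rewrite th0 sin0 subrr mulr0 mul0r.
  rewrite /hsol -[RHS]fcalc_id; apply: eq_fcalc => k.
    by rewrite th0 cos0.
  by rewrite th0 sin0 mul0r.
- rewrite /l /=; congr pair; first by apply: eq_fcalc => k; rewrite th1.
  by apply: eq_bigr => k _; rewrite th1.
Qed.

End Geodesic.

Lemma line_curve (xi : 'rV[R]_N) : exists l, [/\ integral_curve G l,
  l 0 = (0, (xi, 0)) & (l 1).1 = (xi, 0)].
Proof.
pose l (t : R) : E * E := ((t *: xi, 0), (xi, 0)).
exists l; split.
- move=> t; rewrite hamiltonian_fieldE.
  have -> : momentum G (l t).1 (l t).2 = xi by rewrite /momentum /= mul0r scale0r addr0.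
  have e1 : 2^-1 * dot xi ((l t).1.1 *m A) = 0.
    by rewrite /= -scalemxAl dotZr dot_skew !mulr0.
  have e2 : ((l t).2.2 * 2^-1) *: (xi *m A) = 0 by rewrite /= mul0r scale0r.
  have d1 : is_derive t (1 : R) (fun t : R => t *: xi) xi.
    apply: is_derive_eq (is_derive_scale (is_derive_id t 1) (is_derive_cst xi t 1)) _.
    by rewrite scale1r scaler0 addr0.
  rewrite e1 e2.
  exact: (is_derive_pairE (is_derive_pairE d1 (is_derive_cst (0 : R) t 1))
    (is_derive_cst ((xi, 0) : E) t 1)).
- by rewrite /l scale0r.
- by rewrite /l /= scale1r.
Qed.

End FunctionalCalculus.

(** * The height function *)

Section Trigonometry.
Variable R : realType.
Implicit Types t u x : R.

Lemma gt0_of_derive (h dh : R -> R) u : (forall t, is_derive t (1 : R) h (dh t)) ->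
  h 0 = 0 -> 0 < u -> (forall t, 0 < t < u -> 0 < dh t) -> 0 < h u.
Proof.
move=> hd h0 u0 pos; rewrite -h0.
have hd' t : t \in `]0, u[ -> derivable h t 1 by move=> _; have [] := hd t.
have := gtr0_derive1_lt_cc hd'; apply => //.
- move=> t; rewrite in_itv /= => tu; rewrite derive1E; have [_ ->] := hd t.
  exact: pos.
- by apply: continuous_subspaceT; exact: is_derive_continuous hd.
- by rewrite in_itv /= lexx ltW.
- by rewrite in_itv /= lexx ltW.
Qed.

Lemma ge0_of_derive (h dh : R -> R) u : (forall t, is_derive t (1 : R) h (dh t)) ->
  h 0 = 0 -> 0 <= u -> (forall t, 0 < t < u -> 0 <= dh t) -> 0 <= h u.
Proof.
move=> hd h0 u0 pos; rewrite -h0.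
have hd' t : t \in `]0, u[ -> derivable h t 1 by move=> _; have [] := hd t.
have := ger0_derive1_le_cc hd'; apply => //.
- move=> t; rewrite in_itv /= => tu; rewrite derive1E; have [_ ->] := hd t.
  exact: pos.
- by apply: continuous_subspaceT; exact: is_derive_continuous hd.
- by rewrite in_itv /= lexx.
- by rewrite in_itv /= lexx u0.
Qed.

Lemma sin_le_id x : 0 <= x -> sin x <= x.
Proof.
move=> x0; rewrite -subr_ge0.
apply: (@ge0_of_derive (fun x => x - sin x) (fun x => 1 - cos x)) => //.
by rewrite sin0 subrr.
Qed.

Lemma mulB_sin_ge0 x : 0 <= x * (x - sin x).
Proof.
have [x0|x0] := leP 0 x; first by rewrite mulr_ge0 // subr_ge0 sin_le_id.
rewrite -mulrNN mulr_ge0 //; first by rewrite oppr_ge0 ltW.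
have := @sin_le_id (- x); rewrite sinN oppr_ge0 (ltW x0) => /(_ isT); lra.
Qed.

(** From 2 on, 3 sin u < 2 (2 + cos u) by completing squares. Below 2, the difference and its first
    two derivatives vanish at 0, and the third is t sin t > 0. *)
Lemma cusa_huygens u : 0 < u -> 3 * sin u < u * (2 + cos u).
Proof.
move=> u0; rewrite -subr_gt0.
have [u2|u2] := ltP u 2; last first.
  have h : 0 < 2 * (2 + cos u) - 3 * sin u.
    have := cos2Dsin2 u; have := sqr_ge0 (sin u - 3 / 4); have := sqr_ge0 (cos u + 1 / 2).
    by rewrite !expr2; lra.
  have := ler_wpM2r (_ : 0 <= 2 + cos u) u2; have := cos_geN1 u => c1.
  by move=> /(_ ltac:(lra)); lra.
have d1 t : is_derive t (1 : R) (fun t => t * (2 + cos t) - 3 * sin t)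
    (2 - 2 * cos t - t * sin t).
  by apply: is_derive_eq; rewrite /GRing.scale /=; ring.
have d2 t : is_derive t (1 : R) (fun t => 2 - 2 * cos t - t * sin t)
    (sin t - t * cos t).
  by apply: is_derive_eq; rewrite /GRing.scale /=; ring.
have d3 t : is_derive t (1 : R) (fun t => sin t - t * cos t) (t * sin t).
  by apply: is_derive_eq; rewrite /GRing.scale /=; ring.
have s0 t : 0 < t < u -> 0 < sin t.
  by move=> /andP[t0 tu]; rewrite sin2_gt0 // t0 (lt_trans tu u2).
apply: (gt0_of_derive d1) => //; first by rewrite mul0r sin0 mulr0 subrr.
move=> t /andP[t0 tu]; apply: (gt0_of_derive d2) => //.
  by rewrite cos0 mulr1 subrr mul0r subr0.
move=> r /andP[r0 rt]; apply: (gt0_of_derive d3) => //.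
  by rewrite sin0 mul0r subr0.
move=> q /andP[q0 qr]; rewrite mulr_gt0 // s0 // q0.
exact: lt_trans qr (lt_trans rt tu).
Qed.

Lemma cosD2piz x (m : int) : cos (x + m%:~R * (pi *+ 2)) = cos x.
Proof.
case: m => m; first by rewrite mulr_natl (periodicn (@cosD2pi R)).
rewrite NegzE mulrNz mulNr -(periodicn (@cosD2pi R) m.+1).
by congr cos; rewrite -[pi *+ 2 *+ _]mulr_natl subrK.
Qed.

Lemma cos_eq1_between x (m : int) :
  m%:~R * (pi *+ 2) < x < (m + 1)%:~R * (pi *+ 2) -> cos x < 1.
Proof.
move=> /andP[mx xm]; pose y := (x - m%:~R * (pi *+ 2)) / 2.
have yE : x = y *+ 2 + m%:~R * (pi *+ 2).
  by rewrite /y -mulr_natr mulfVK ?subrK.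
have y0 : 0 < y < pi.
  move: xm; rewrite intrD mulrDl mul1r /y mulr2n.
  rewrite divr_gt0 ?subr_gt0 //= ltr_pdivrMr // => xm; lra.
rewrite yE cosD2piz cos_mulr2n; have := sin_gt0_pi y0.
have := cos2Dsin2 y; nra.
Qed.

Lemma cos_eq1P x : cos x = 1 <-> exists m : int, x = m%:~R * (pi *+ 2).
Proof.
have p0 : 0 < (pi *+ 2 : R) by rewrite pmulrn_lgt0 // pi_gt0.
split=> [c1|[m ->]]; last by rewrite -[X in cos X]add0r cosD2piz cos0.
exists (Num.floor (x / (pi *+ 2))); apply/eqP/negPn/negP => ne.
have [fl lf] : (Num.floor (x / (pi *+ 2)))%:~R * (pi *+ 2) <= x /\
    x < (Num.floor (x / (pi *+ 2)) + 1)%:~R * (pi *+ 2).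
  rewrite -ler_pdivlMr // -ltr_pdivrMr //; split; first exact: Num.Theory.floor_le_tmp.
  exact: Num.Theory.floorD1_gt.
have := @cos_eq1_between x (Num.floor (x / (pi *+ 2))).
by rewrite lf lt_neqAle fl andbT eq_sym ne c1 ltxx => /(_ isT).
Qed.

Definition Gfun x := (x - sin x) / (4 * (1 - cos x)).
Definition Gfun' x := (2 * (1 - cos x) - x * sin x) / (4 * (1 - cos x) ^+ 2).
(** Its numerator is the difference in [cusa_huygens], which is the source of strict convexity. *)
Definition Gfun'' x := (x * (2 + cos x) - 3 * sin x) / (4 * (1 - cos x) ^+ 2).

Lemma is_derive_div (f g : R -> R) t df dg : g t != 0 ->
  is_derive t (1 : R) f df -> is_derive t (1 : R) g dg ->
  is_derive t (1 : R) (fun t => f t / g t) ((df * g t - f t * dg) / g t ^+ 2).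
Proof.
move=> g0 hf hg; have hv : is_derive t (1 : R) (fun t => (g t)^-1) (- dg / g t ^+ 2).
  have [dgt dgE] := hg; apply: DeriveDef; first exact: derivableV.
  by rewrite deriveV // dgE /GRing.scale /= mulrC mulrN mulNr.
apply: is_derive_eq (is_deriveM hf hv) _.
by rewrite /GRing.scale /=; field.
Qed.

Lemma is_derive_Gfun x : cos x != 1 -> is_derive x (1 : R) Gfun (Gfun' x).
Proof.
move=> c1; have d0 : 1 - cos x != 0 by rewrite subr_eq0 eq_sym.
have h1 : is_derive x (1 : R) (fun x => x - sin x) (1 - cos x) by apply: is_derive_eq.
have h2 : is_derive x (1 : R) (fun x => 4 * (1 - cos x)) (4 * sin x).
  by apply: is_derive_eq; rewrite /GRing.scale /=; ring.
have g0 : 4 * (1 - cos x) != 0 by rewrite mulf_neq0.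
have h : is_derive x (1 : R) Gfun _ := is_derive_div (f := fun x => _) (g := fun x => _) g0 h1 h2.
apply: is_derive_eq h _.
rewrite /Gfun'.
have -> : (1 - cos x) * (4 * (1 - cos x)) - (x - sin x) * (4 * sin x) =
    4 * (1 - 2 * cos x + (cos x ^+ 2 + sin x ^+ 2) - x * sin x) by ring.
by rewrite cos2Dsin2; field.
Qed.

Lemma is_derive_Gfun' x : cos x != 1 -> is_derive x (1 : R) Gfun' (Gfun'' x).
Proof.
move=> c1; have d0 : 1 - cos x != 0 by rewrite subr_eq0 eq_sym.
have h1 : is_derive x (1 : R) (fun x => 2 * (1 - cos x) - x * sin x) (sin x - x * cos x).
  by apply: is_derive_eq; rewrite /GRing.scale /=; ring.
have h2 : is_derive x (1 : R) (fun x => 4 * (1 - cos x) ^+ 2) (8 * (1 - cos x) * sin x).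
  by apply: is_derive_eq; rewrite /GRing.scale /=; ring.
have g0 : 4 * (1 - cos x) ^+ 2 != 0 by rewrite mulf_neq0 // expf_neq0.
have h : is_derive x (1 : R) Gfun' _ := is_derive_div (f := fun x => _) (g := fun x => _) g0 h1 h2.
apply: is_derive_eq h _.
rewrite /Gfun''.
have e : (sin x - x * cos x) * (4 * (1 - cos x) ^+ 2) -
     (2 * (1 - cos x) - x * sin x) * (8 * (1 - cos x) * sin x) =
  4 * (1 - cos x) ^+ 2 * (x * (2 + cos x) - 3 * sin x)
  + 8 * (1 - cos x) * x * (cos x ^+ 2 + sin x ^+ 2 - 1) by ring.
rewrite e cos2Dsin2 subrr mulr0 addr0; field.
by rewrite d0.
Qed.

Lemma Gfun''_gt0 x : 0 < x -> cos x != 1 -> 0 < Gfun'' x.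
Proof.
move=> x0 c1; rewrite divr_gt0 ?subr_gt0 ?cusa_huygens //.
by rewrite mulr_gt0 // exprn_even_gt0 //= subr_eq0 eq_sym.
Qed.

Lemma GfunN x : Gfun (- x) = - Gfun x.
Proof. by rewrite /Gfun sinN cosN -opprD mulNr. Qed.

Lemma Gfun_ge0 x : 0 <= x -> 0 <= Gfun x.
Proof.
move=> x0; rewrite divr_ge0 // ?subr_ge0 ?sin_le_id // mulr_ge0 //.
Qed.

End Trigonometry.

(** * Finite families of reals and pigeonhole arguments *)

Section FiniteFamilies.
Variable R : realType.

Lemma finite_positive_lb (I : finType) (f : I -> R) : (forall i, 0 < f i) ->
  exists2 e, 0 < e & forall i, e <= f i.
Proof.
move=> f0; exists (\big[Num.min/1]_i f i).
  by rewrite lt_bigmin.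
by move=> i; exact: bigmin_le.
Qed.

Lemma finite_ub (I : finType) (f : I -> R) : exists2 M, 0 < M & forall i, f i <= M.
Proof.
exists (\big[Num.max/1]_i f i).
  by apply: lt_le_trans (bigmax_ge_id _ _ _ _).
by move=> i; exact: le_bigmax.
Qed.

Lemma subitv_avoid (Q : seq R) (s t : R) : s < t -> exists s' t',
  [/\ s < s', s' < t', t' < t & forall q, q \in Q -> ~~ (s' <= q <= t')].
Proof.
move=> st; elim: Q => [|q Q [s' [t' [ss' s't' t't hQ]]]].
  by exists (s + (t - s) / 3), (s + (t - s) / 3 * 2); split=> //; lra.
have [qm|qm] := leP q ((s' + t') / 2).
- exists ((s' + 3 * t') / 4), t'; split=> //; [lra|lra|].
  move=> r; rewrite inE => /predU1P[->|/hQ]; first by rewrite negb_and -ltNge; apply/orP; left; lra.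
  by apply: contra => /andP[h ->]; rewrite andbT; lra.
- exists s', ((s' + t') / 2); split=> //; [lra|lra|].
  move=> r; rewrite inE => /predU1P[->|/hQ]; first by rewrite negb_and -!ltNge qm orbT.
  by apply: contra => /andP[-> h] /=; lra.
Qed.

Lemma three_sorted (s : seq R) : uniq s -> (2 < size s)%N ->
  exists t1 t2 t3, [/\ t1 \in s, t2 \in s, t3 \in s, t1 < t2 & t2 < t3].
Proof.
case: s => [|x [|y [|z s]]] //=; rewrite !inE !negb_or -!andbA.
move=> /and5P[xy xz _ yz _] _; wlog: x y z xy xz yz / x < y => [hw|].
  have [h|h|h] := ltgtP x y; first exact: hw.
    have yx : y != x by rewrite eq_sym.
    have [t1 [t2 [t3 [h1 h2 h3 h4 h5]]]] := hw y x z yx yz xz h.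
    by exists t1, t2, t3; split=> //; rewrite !inE orbCA -!in_cons.
  by rewrite h eqxx in xy.
move=> lxy; have [h|h|h] := ltgtP y z; last by rewrite h eqxx in yz.
  by exists x, y, z; rewrite !inE !eqxx !orbT.
have [h'|h'|h'] := ltgtP x z; last by rewrite h' eqxx in xz.
  by exists x, z, y; rewrite !inE !eqxx !orbT.
by exists z, x, y; rewrite !inE !eqxx !orbT.
Qed.

Lemma count_lt_sub (p q : pred R) x (s : seq R) : subpred p q -> x \in s ->
  q x -> ~~ p x -> (count p s < count q s)%N.
Proof.
move=> pq; elim: s => //= y s IH; rewrite inE => /predU1P[<-|xs] qx px.
  by rewrite qx (negbTE px) add1n add0n ltnS sub_count.
by have := IH xs qx px; have := pq y; case: (p y) => [->//|_] /=; lia.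
Qed.

Lemma size_le_fibers (s : seq R) (f : R -> nat) (c v : nat) :
  {in s, forall x, (f x < v)%N} ->
  (forall i, (count (fun x => f x == i) s <= c)%N) -> (size s <= c * v)%N.
Proof.
move=> fv fc; have -> : size s = (\sum_(i < v) count (fun x => f x == i :> nat) s)%N.
  elim: s fv {fc} => [|x s IH] fv /=; first by rewrite big1.
  rewrite big_split /= -IH => [|y ys]; last by apply: fv; rewrite inE ys orbT.
  rewrite (bigD1 (Ordinal (fv x (mem_head _ _)))) //= eqxx big1 ?addn0 ?add1n //.
  by move=> i; rewrite eq_sym -val_eqE /= => /negbTE ->.
apply: (@leq_trans (\sum_(i < v) c)%N); first by apply: leq_sum => i _; exact: fc.
by rewrite sum_nat_const card_ord mulnC.
Qed.

(** Adding missing elements to a list must stop after at most M steps. *)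
Lemma bounded_set_enum (S : set R) (M : nat) :
  (forall s : seq R, uniq s -> (forall x, x \in s -> S x) -> (size s <= M)%N) ->
  exists s : seq R, [/\ uniq s, (size s <= M)%N & forall x, S x -> x \in s].
Proof.
move=> hM; suff : forall d s, uniq s -> (forall x, x \in s -> S x) ->
    (M - size s <= d)%N -> exists s' : seq R,
    [/\ uniq s', (size s' <= M)%N & forall x, S x -> x \in s'].
  by move=> /(_ M [::]); apply => //; rewrite subn0.
elim=> [|d IH] s us sS hd; have sM := hM s us sS.
  exists s; split=> // x Sx; apply/negPn/negP => xs.
  have := hM (x :: s); rewrite /= xs us => /(_ isT) h.
  have : (size s < M)%N by apply: h => y; rewrite inE => /predU1P[->|/sS].
  by lia.
have [[x Sx xs]|none] := pselect (exists2 x, S x & x \notin s).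
  apply: (IH (x :: s)) => [|y|]; first by rewrite /= xs.
    by rewrite inE => /predU1P[->|/sS].
  by rewrite /= subnS; move: hd; case: (M - size s)%N.
by exists s; split=> // x Sx; apply/negPn/negP => xs; apply: none; exists x.
Qed.

(** Rolle twice gives two zeros of h', and once more a zero of h''. *)
Lemma convex_three_values (h h' h'' : R -> R) (t1 t2 t3 : R) : t1 < t2 -> t2 < t3 ->
  (forall t, t1 <= t <= t3 -> is_derive t (1 : R) h (h' t)) ->
  (forall t, t1 <= t <= t3 -> is_derive t (1 : R) h' (h'' t)) ->
  (forall t, t1 <= t <= t3 -> 0 < h'' t) -> h t1 = h t2 -> h t2 = h t3 -> False.
Proof.
move=> t12 t23 d1 d2 p2 e12 e23.
have rolle (f f' : R -> R) u v : t1 <= u -> u < v -> v <= t3 ->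
    (forall t, t1 <= t <= t3 -> is_derive t (1 : R) f (f' t)) -> f u = f v ->
    exists c, [/\ u < c, c < v & f' c = 0].
  move=> t1u uv vt3 df fuv.
  have dfu t : t \in `[u, v] -> is_derive t (1 : R) f (f' t).
    by rewrite in_itv /= => /andP[ut tv]; apply: df; rewrite (le_trans t1u ut) (le_trans tv vt3).
  have hd t : t \in `]u, v[ -> derivable f t 1.
    by move=> tuv; have [] := dfu t (subset_itv_oo_cc tuv).
  have hc : {within `[u, v], continuous f}.
    apply: derivable_within_continuous => t tuv.
    by have [] := dfu t tuv.
  have [c cuv dc] := Rolle uv hd hc fuv.
  exists c; move: (cuv); rewrite in_itv /= => /andP[uc cv]; split=> //.
  have [_ <-] := dfu c (subset_itv_oo_cc cuv).
  by have [_] := dc.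
have [c1 [tc1 ct1 z1]] := rolle h h' t1 t2 (lexx _) t12 (ltW t23) d1 e12.
have [c2 [tc2 ct2 z2]] := rolle h h' t2 t3 (ltW t12) t23 (lexx _) d1 e23.
have [c3 [tc3 ct3 z3]] := rolle h' h'' c1 c2 (ltW tc1) (lt_trans ct1 tc2) (ltW ct2) d2 (etrans z1 (esym z2)).
have : 0 < h'' c3.
  by apply: p2; rewrite (ltW (lt_trans tc1 tc3)) (ltW (lt_trans ct3 ct2)).
by rewrite z3 ltxx.
Qed.

End FiniteFamilies.

(** * Convexity and level sets of the height *)

Section HeightFunction.
Variables (R : realType) (m : nat) (a : 'I_m -> R).
Hypothesis a_gt0 : forall k, 0 < a k.
Variable w : 'I_m -> R.
Hypothesis w_ge0 : forall k, 0 <= w k.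
Implicit Types zeta t : R.

Definition resonant zeta k := cos (zeta * a k) == 1.
Definition nonresonant zeta := forall k, ~~ resonant zeta k.

(* Gfun takes the junk value 0 at its poles, so resonant indices do not
   contribute. *)
Definition height zeta := \sum_k w k * (a k * Gfun (zeta * a k)).

Let height' zeta := \sum_k w k * (a k ^+ 2 * Gfun' (zeta * a k)).
Let height'' zeta := \sum_k w k * (a k ^+ 3 * Gfun'' (zeta * a k)).

Lemma resonantN zeta k : resonant (- zeta) k = resonant zeta k.
Proof. by rewrite /resonant mulNr cosN. Qed.

Lemma heightN zeta : height (- zeta) = - height zeta.
Proof.
rewrite /height -sumrN; apply: eq_bigr => k _.
by rewrite mulNr GfunN !mulrN.
Qed.

Lemma resonant0 k : resonant 0 k.
Proof. by rewrite /resonant mul0r cos0. Qed.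

Lemma is_derive_scaled (f : R -> R) df (c d : R) t : is_derive (t * c) (1 : R) f df ->
  is_derive t (1 : R) (fun t => d * f (t * c)) (d * c * df).
Proof.
move=> hf; have hl : is_derive t (1 : R) (fun t => t * c) c.
  by apply: is_derive_eq; rewrite /GRing.scale /= ?mul1r ?mulr1 ?mulr0 ?addr0 ?add0r.
have h := @is_derive1_comp R f (fun t => t * c) t df c hf hl.
apply: is_derive_eq (is_deriveZ d h) _.
by rewrite /GRing.scale /=; ring.
Qed.

Lemma is_derive_height_terms (f : R -> R) (df : R -> R) (c : 'I_m -> R) t :
  nonresonant t -> (forall u, cos u != 1 -> is_derive u (1 : R) f (df u)) ->
  is_derive t (1 : R) (fun t => \sum_k w k * (c k * f (t * a k)))
    (\sum_k w k * (c k * a k * df (t * a k))).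
Proof.
move=> nt hf; apply: is_derive_sumE => k.
have h := is_derive_scaled (w k * c k) (hf _ (nt k)).
have -> : (fun t => w k * (c k * f (t * a k))) = (fun t => w k * c k * f (t * a k)).
  by apply/funext => u; rewrite mulrA.
by apply: is_derive_eq h _; ring.
Qed.

Lemma is_derive_height t : nonresonant t -> is_derive t (1 : R) height (height' t).
Proof.
move=> nt; apply: is_derive_eq (is_derive_height_terms a nt (@is_derive_Gfun R)) _.
by apply: eq_bigr => k _; rewrite expr2.
Qed.

Lemma is_derive_height' t : nonresonant t -> is_derive t (1 : R) height' (height'' t).
Proof.
move=> nt; have h := is_derive_height_terms (fun k => a k ^+ 2) nt (@is_derive_Gfun' R).
apply: is_derive_eq h _.
by apply: eq_bigr => k _; rewrite -exprSr.
Qed.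

Lemma height''_gt0 t : 0 < t -> nonresonant t -> (exists k, 0 < w k) -> 0 < height'' t.
Proof.
move=> t0 nt [k wk]; rewrite /height'' (bigD1 k) //=.
have g0 l : 0 < a l ^+ 3 * Gfun'' (t * a l).
  by rewrite mulr_gt0 ?exprn_gt0 ?Gfun''_gt0 ?mulr_gt0 ?nt.
apply: ltr_pwDl; first by rewrite mulr_gt0.
apply: sumr_ge0 => l _.
by rewrite mulr_ge0 // ltW.
Qed.

Lemma height_three t1 t2 t3 : (0 < m)%N -> (exists k, 0 < w k) -> t1 < t2 -> t2 < t3 ->
  (forall t, t1 <= t <= t3 -> nonresonant t) ->
  height t1 = height t2 -> height t2 = height t3 -> False.
Proof.
(* Since 0 is a pole, a pole-free interval lies on one side of it, and oddness of the height moves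
   it to the positive side. *)
move=> m0 ew; wlog t10 : t1 t2 t3 / 0 < t1 => [hw t12 t23 nr e12 e23|].
  have [t10|t10] := ltP 0 t1; first exact: (hw t1 t2 t3).
  have [t30|t30] := ltP t3 0.
    apply: (hw (- t3) (- t2) (- t1)); rewrite ?oppr_gt0 ?ltrN2 ?heightN ?e12 ?e23 //.
    by move=> t tt k; rewrite -resonantN; apply: nr; lra.
  by have := nr 0 _ (Ordinal m0); rewrite resonant0 t10 t30 => /(_ isT).
move=> t12 t23 nr; apply: (@convex_three_values R height height' height'' _ _ _ t12 t23).
- by move=> t /nr; exact: is_derive_height.
- by move=> t /nr; exact: is_derive_height'.
- move=> t tt; apply: height''_gt0 => //; last exact: nr.
  by case/andP: tt => h _; apply: lt_le_trans h.
Qed.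

Definition poles (J : nat) : seq R :=
  [seq (j%:Z - J%:Z)%:~R * (pi *+ 2) / a k | k <- enum 'I_m, j <- iota 0 J.*2.+1].

Lemma size_poles J : size (poles J) = (m * J.*2.+1)%N.
Proof. by rewrite size_allpairs size_enum_ord size_iota. Qed.

(** The index j of the pole satisfies |j| <= 2 pi |j| = |zeta| a_k <= J. *)
Lemma resonant_poles zeta k J : resonant zeta k -> `|zeta| * a k <= J%:R ->
  zeta \in poles J.
Proof.
move=> /eqP/cos_eq1P[j jE] hJ; have ak := a_gt0 k.
have zE : zeta = j%:~R * (pi *+ 2) / a k by rewrite -jE mulfK // gt_eqF.
have jJ : (`|j| <= J)%N.
  have p1 : (1 : R) <= pi *+ 2 by have := @pi_ge2 R; rewrite mulr2n; lra.
  rewrite -(ler_nat R); apply: le_trans hJ.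
  rewrite -[X in _ * X](gtr0_norm ak) -normrM jE normrM natr_absz intr_norm.
  by rewrite ler_peMr // (le_trans p1) // ler_norm.
apply/allpairsP; exists (k, absz (j + J%:Z)%R); rewrite mem_enum mem_iota /=; split=> //.
  by lia.
rewrite zE; congr (_%:~R * _ / _); lia.
Qed.

Lemma nonresonant_solutions_le (z L : R) J (s : seq R) : (0 < m)%N ->
  (exists k, 0 < w k) -> (forall k, L * a k <= J%:R) -> uniq s ->
  (forall t, t \in s -> [/\ `|t| <= L, nonresonant t & height t = z]) ->
  (size s <= 2 * (size (poles J)).+1)%N.
Proof.
(* [f t] numbers the interval between poles that contains t. It takes at most [size (poles J)] + 1
   values, and convexity allows two solutions for each. *)
move=> m0 ew LJ us hs; pose f t := count (fun p => p <= t) (poles J).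
apply: (@size_le_fibers R s f) => [t _|i]; first by rewrite ltnS count_size.
rewrite -size_filter leqNgt; apply/negP => h3.
have [t1 [t2 [t3 []]]] := three_sorted (filter_uniq _ us) h3.
rewrite !mem_filter => /andP[/eqP f1 s1] /andP[_ s2] /andP[/eqP f3 s3] t12 t23.
have [L1 n1 h1] := hs _ s1; have [_ _ h2] := hs _ s2; have [L3 _ h3'] := hs _ s3.
apply: (@height_three t1 t2 t3) => //; rewrite ?h1 ?h2 ?h3' //.
move=> t /andP[t1t tt3] k; apply/negP => rk.
have tJ : t \in poles J.
  apply: (resonant_poles rk); apply: le_trans (LJ k); apply: ler_wpM2r; first exact: ltW.
  move: L1 L3; rewrite !ler_norml => /andP[h _] /andP[_ h'].
  by rewrite (le_trans h t1t) (le_trans tt3 h').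
have lt1 : t1 < t.
  rewrite lt_neqAle t1t andbT; apply/negP => /eqP e; move: (n1 k).
  by rewrite e rk.
have : (f t1 < f t3)%N.
  apply: (@count_lt_sub R _ _ t) => //=; last by rewrite -ltNge.
  by move=> p /= /le_trans; apply; rewrite ltW // (lt_trans t12).
by rewrite f1 f3 ltnn.
Qed.

End HeightFunction.

(** * Existence of solutions in windows of fixed length *)

Section HeightSolutions.
Variables (R : realType) (m : nat) (a : 'I_m -> R).
Hypothesis a_gt0 : forall k, 0 < a k.

Lemma seq_has_min (Q : seq R) p : p \in Q ->
  exists2 q, q \in Q & forall t, t \in Q -> q <= t.
Proof.
elim: Q p => // r Q IH p _; case: Q IH => [_|r' Q /(_ _ (mem_head _ _))[q qQ qle]].
  by exists r; rewrite ?mem_head // => t; rewrite inE => /eqP ->.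
have [rq|qr] := leP r q.
  exists r; rewrite ?mem_head // => t; rewrite inE => /predU1P[->//|/qle].
  exact: le_trans.
exists q; first by rewrite inE qQ orbT.
by move=> t; rewrite inE => /predU1P[->|/qle//]; exact: ltW.
Qed.

Lemma left_limit_le0 (f : R -> R) (s q : R) : s < q -> {for q, continuous f} ->
  (forall t, s <= t < q -> f t <= 0) -> f q <= 0.
Proof.
move=> sq fc h; rewrite leNgt; apply/negP => fq.
have : \forall t \near q, 0 < f t by exact: (cvgr_gt (f q) fc _ fq).
move=> /nbhs_ballP[e /= e0 he].
pose t := Num.max s (q - e / 2).
have tq : t < q by rewrite gt_max sq /= ltrBlDr ltrDl divr_gt0.
have st : s <= t by rewrite le_max lexx.
have te : q - e / 2 <= t by rewrite le_max lexx orbT.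
have := h t; rewrite st tq => /(_ isT); apply/negP; rewrite -ltNge.
by apply: he; rewrite /ball /= gtr0_norm ?subr_gt0 //; lra.
Qed.

Lemma pole_after (s : R) k : exists q, [/\ s < q, q <= s + (pi *+ 2) / a k & resonant a q k].
Proof.
have ak := a_gt0 k; have p0 : 0 < (pi *+ 2 : R) by rewrite pmulrn_lgt0 // pi_gt0.
pose j := Num.floor (s * a k / (pi *+ 2)).
have fl : j%:~R <= s * a k / (pi *+ 2) by exact: Num.Theory.floor_le_tmp.
have lf : s * a k / (pi *+ 2) < (j + 1)%:~R by exact: Num.Theory.floorD1_gt.
exists ((j + 1)%:~R * (pi *+ 2) / a k); split.
- by rewrite ltr_pdivlMr // -ltr_pdivrMr.
- rewrite intrD mulrDl mulrDl mul1r lerD2r ler_pdivrMr // -ler_pdivlMr //.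
- rewrite /resonant divfK; last by rewrite gt_eqF.
  by apply/eqP/cos_eq1P; exists (j + 1).
Qed.

Lemma next_pole (s : R) k : 0 <= s -> nonresonant a s -> exists q,
  [/\ s < q, q <= s + (pi *+ 2) / a k, exists l, resonant a q l &
      forall t, s <= t < q -> nonresonant a t].
Proof.
move=> s0 ns; have [p [sp pk rp]] := pole_after s k.
have [M M0 aM] := finite_ub a.
pose J := (Num.trunc (p * M)).+1.
have JM : p * M <= J%:R by exact/ltW/truncnS_gt.
pose Q := [seq q <- poles a J | (s < q) && [exists l, resonant a q l]].
have inQ t l : s < t <= p -> resonant a t l -> t \in Q.
  move=> /andP[st tp] r; rewrite mem_filter st /=; apply/andP; split.
    by apply/existsP; exists l.
  apply: (resonant_poles a_gt0 r); apply: le_trans JM; rewrite ger0_norm; last lra.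
  by apply: ler_pM; rewrite ?aM //; [lra|exact: ltW].
have pQ : p \in Q by apply: (inQ p k) => //; rewrite sp lexx.
have [q qQ qle] := seq_has_min pQ.
move: qQ; rewrite mem_filter => /andP[/andP[sq /existsP rq] _].
have qp := qle p pQ.
exists q; split => //; first exact: le_trans pk.
move=> t /andP[st tq] l; apply/negP => r.
move: st; rewrite le_eqVlt => /predU1P[e|st]; first by move: (ns l); rewrite e r.
have : t \in Q by apply: (inQ t l) => //; rewrite st (le_trans (ltW tq)).
by move=> /qle; rewrite leNgt tq.
Qed.

Section Weights.
Variable w : 'I_m -> R.
Hypothesis w_ge0 : forall k, 0 <= w k.
Local Notation height := (height a w).

(** For y = |z|, the parameters t > 0 whose level, up to the sign of z, is nonempty. In the second
    case the level is a sphere of square radius 2 t (y - height), which explains the inequality. *)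
Definition solution (y t : R) :=
  (nonresonant a t /\ height t = y) \/
  [/\ exists k, resonant a t k, forall k, resonant a t k -> w k = 0 & height t <= y].

(* If the height stays below y up to the next pole q, it does not tend to +oo
   there, so the weights resonant at q vanish and q itself is a solution. *)
Lemma solution_after (s y : R) k : 0 < s -> nonresonant a s -> height s <= y ->
  exists t, s <= t <= s + (pi *+ 2) / a k /\ solution y t.
Proof.
move=> s0 ns hs; have [q [sq qk rq nq]] := next_pole k (ltW s0) ns.
have cont t : nonresonant a t -> {for t, continuous height}.
  by move=> nt; apply/differentiable_continuous/derivable1_diffP; have [] := is_derive_height w nt.
have [[t [st tq hy]]|none] := pselect (exists t, [/\ s <= t, t < q & y <= height t]).
  have wc : {within `[s, t], continuous height}.
    apply: derivable_within_continuous => r; rewrite in_itv /= => /andP[sr rt].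
    have nr : nonresonant a r by apply: nq; rewrite sr (le_lt_trans rt).
    by have [] := is_derive_height w nr.
  have [|r] := IVT st wc (v := y).
    by rewrite ge_min le_max hs hy orbT.
  rewrite in_itv /= => /andP[sr rt] hr; exists r; split.
    by rewrite sr (le_trans rt) // (le_trans (ltW tq)).
  by left; split=> //; apply: nq; rewrite sr (le_lt_trans rt).
have lty t : s <= t < q -> height t < y.
  by move=> /andP[st tq]; rewrite ltNge; apply/negP => hy; apply: none; exists t.
have w0 k' : resonant a q k' -> w k' = 0.
  move=> r; apply/eqP; rewrite eq_le w_ge0 andbT leNgt; apply/negP => wk.
  have ak := a_gt0 k'; have q0 := lt_trans s0 sq.
  (* The inequality height < y with the denominator of the k'-th term cleared, which makes it
     continuous at the pole; there it would read w a (q a) <= 0. *)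
  pose f t := w k' * (a k' * (t * a k' - sin (t * a k'))) - y * (4 * (1 - cos (t * a k'))).
  have fq : f q <= 0.
    apply: (left_limit_le0 sq).
      have h t : is_derive t (1 : R) f (w k' * (a k' * (a k' - a k' * cos (t * a k')))
          - y * (4 * (a k' * sin (t * a k')))).
        by apply: is_derive_eq; rewrite /GRing.scale /=; ring.
      by apply/differentiable_continuous/derivable1_diffP; have [] := h q.
    move=> t tq; have := lty t tq; rewrite /height (bigD1 k') //=.
    have t0 : 0 < t by case/andP: tq => st _; exact: lt_le_trans st.
    have : 0 <= \sum_(i < m | i != k') w i * (a i * Gfun (t * a i)).
      apply: sumr_ge0 => i _; apply: mulr_ge0 => //; apply: mulr_ge0; first exact: ltW.
      by apply: Gfun_ge0; rewrite mulr_ge0 // ltW.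
    have c1 : 0 < 4 * (1 - cos (t * a k')).
      rewrite mulr_gt0 // subr_gt0 lt_neqAle cos_le1 andbT; exact: nq.
    rewrite /Gfun mulrA mulrA => h1 h2.
    rewrite /f subr_le0 mulrA -ler_pdivrMr //; lra.
  move: fq; apply/negP; rewrite -ltNge /f.
  have -> : sin (q * a k') = 0.
    have := cos2Dsin2 (q * a k'); rewrite (eqP r) expr1n => e.
    by apply/eqP; rewrite -sqrf_eq0; apply/eqP; lra.
  by rewrite (eqP r) subrr !mulr0 !subr0 !mulr_gt0.
exists q; split; first by rewrite (ltW sq).
right; split=> //; rewrite -subr_le0.
(* The terms resonant at q have weight 0, so dropping them leaves the height unchanged and makes it
   continuous at q. *)
pose g t := \sum_k0 (if resonant a q k0 then 0 else w k0 * a k0 * Gfun (t * a k0)).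
have gE t : height t = g t.
  apply: eq_bigr => k0 _; case: ifP => [/w0 ->|_]; first by rewrite mul0r.
  by rewrite mulrA.
rewrite gE; apply: (left_limit_le0 (f := fun t => g t - y) sq).
  have h : is_derive q (1 : R) g
      (\sum_k0 (if resonant a q k0 then 0 else w k0 * a k0 * a k0 * Gfun' (q * a k0))).
    apply: is_derive_sumE => k0; case: ifP => [_|/negbT r]; first exact: is_derive_cst.
    by apply: is_derive_scaled; exact: is_derive_Gfun.
  have [dg _] := h; apply: cvgB; last exact: cvg_cst.
  exact/differentiable_continuous/derivable1_diffP.
by move=> t tq; rewrite -gE subr_le0 ltW // lty.
Qed.

End Weights.

Lemma abs_sinB (u v : R) : `|sin (u - v)| <= `|sin u| + `|sin v|.
Proof.
rewrite sinB; apply: le_trans (ler_normB _ _) _; rewrite !normrM.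
have c1 (t : R) : `|cos t| <= 1 by rewrite ler_norml cos_geN1 cos_le1.
by apply: lerD; [rewrite ler_piMr | rewrite ler_piMl].
Qed.

(* Among m + 1 points of a progression of small step, two points close to poles
   of the same index would make the sine of their difference small. *)
Lemma uniformly_nonresonant : exists D s0 : R, [/\ 0 < D, 0 < s0 &
  forall T, exists t, T <= t <= T + D /\ forall k, s0 <= `|sin (t * a k / 2)|].
Proof.
have [M M0 aM] := finite_ub a.
(* With this step all half-angles j d a_k / 2 for 1 <= j <= m are at most 1/2, where the sine is
   positive; [e] bounds these sines below. *)
pose d : R := (m.+1%:R * M)^-1.
have d0 : 0 < d by rewrite invr_gt0 mulr_gt0.
have [] := @finite_positive_lb R ('I_m * 'I_m)%type (fun p => sin (p.1.+1%:R * d * a p.2 / 2)).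
  move=> [j k] /=; apply: sin2_gt0; rewrite divr_gt0 ?mulr_gt0 //= ltr_pdivrMr //.
  apply: (@le_lt_trans _ _ 1); last lra.
  have : j.+1%:R * d * a k <= m.+1%:R * d * M.
    apply: ler_pM; [|exact: ltW| |exact: aM]; first by rewrite mulr_ge0 // ltW.
    by rewrite ler_pM2r // ler_nat ltnS ltnW.
  by move=> /le_trans; apply; rewrite mulrAC divff // gt_eqF // mulr_gt0.
move=> e e0 he; exists (m.+1%:R * d), (e / 2); split; rewrite ?mulr_gt0 ?divr_gt0 //.
move=> T; apply: contrapT => none.
have bad (i : 'I_m.+1) : exists k, `|sin ((T + i%:R * d) * a k / 2)| < e / 2.
  apply: contrapT => ok; apply: none; exists (T + i%:R * d); split.
    rewrite lerDl lerD2l ler_pM2r // ler_nat ltnW // andbT.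
    by apply: mulr_ge0 => //; exact: ltW.
  by move=> k; rewrite leNgt; apply/negP => bk; apply: ok; exists k.
have [kf hkf] := choice bad.
have : ~ injective kf by move=> /leq_card; rewrite !card_ord ltnn.
apply => i i' kk; apply/val_inj/eqP; apply/negPn/negP => /=.
wlog ii' : i i' kk / (i < i')%N => [hw ne|_].
  have [h|h|h] := ltngtP i i'; [exact: (hw i i')| |by rewrite h eqxx in ne].
  by apply: (hw i' i) => //; rewrite eq_sym.
have jm : (i' - i.+1 < m)%N by have := ltn_ord i'; lia.
have := he (Ordinal jm, kf i); rewrite /= -subSn // subSS => h.
have := abs_sinB ((T + i'%:R * d) * a (kf i) / 2) ((T + i%:R * d) * a (kf i) / 2).
have -> : (T + i'%:R * d) * a (kf i) / 2 - (T + i%:R * d) * a (kf i) / 2 =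
    (i' - i)%:R * d * a (kf i) / 2 by rewrite natrB 1?ltnW //; lra.
have := hkf i; have := hkf i'; rewrite -kk => h1 h2 h3.
by have := le_trans h (ler_norm _); lra.
Qed.

End HeightSolutions.

(** * Counting geodesics *)

Section GeodesicFibers.
Variables (R : realType) (n : nat) (G : contactCarnotGroup R n).
Local Notation N := (n.*2).
Local Notation A := (ccg_form G).
Variables (m : nat) (a : 'I_m -> R) (P : 'I_m -> 'M[R]_N).
Hypothesis a_gt0 : forall k, 0 < a k.
Hypothesis P_neq0 : forall k, P k != 0.
Hypothesis PP : forall k l, P k *m P l = if k == l then P k else 0.
Hypothesis sumP : \sum_k P k = 1%:M.
Hypothesis trP : forall k, (P k)^T = P k.
Hypothesis PA : forall k, P k *m A = A *m P k.
Hypothesis AAP : forall k, A *m A *m P k = - (a k ^+ 2) *: P k.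
Implicit Types (x xi : 'rV[R]_N) (z zeta : R).

Local Notation fcalc := (fcalc G P).
Local Notation weight := (weight P).

(** [sinc] + A [cosc] is the integral of exp(t zeta A) over [0, 1], which maps xi to x; [gain] is
    the factor by which it scales [weight], zero exactly at resonance. *)
Definition sinc zeta k := sin (zeta * a k) / (zeta * a k).
Definition cosc zeta k := (1 - cos (zeta * a k)) / (zeta * a k ^+ 2).
Definition gain zeta k := 2 * (1 - cos (zeta * a k)) / (zeta * a k) ^+ 2.

Local Notation resonant := (resonant a).

Lemma gainE zeta k : zeta != 0 ->
  sinc zeta k ^+ 2 + a k ^+ 2 * cosc zeta k ^+ 2 = gain zeta k.
Proof.
move=> z0; have ak := gt_eqF (a_gt0 k); rewrite /sinc /cosc /gain.
have -> : 2 * (1 - cos (zeta * a k)) =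
  sin (zeta * a k) ^+ 2 + (1 - cos (zeta * a k)) ^+ 2
  + (1 - (cos (zeta * a k) ^+ 2 + sin (zeta * a k) ^+ 2)) by ring.
by rewrite cos2Dsin2 subrr addr0; field; rewrite z0 ak.
Qed.

Lemma resonant_sin zeta k : resonant zeta k -> sin (zeta * a k) = 0.
Proof.
move=> /eqP c1; have := cos2Dsin2 (zeta * a k); rewrite c1 expr1n => h.
by apply/eqP; rewrite -sqrf_eq0; apply/eqP; lra.
Qed.

Lemma sinc_resonant zeta k : resonant zeta k -> sinc zeta k = 0.
Proof. by move=> r; rewrite /sinc resonant_sin // mul0r. Qed.

Lemma cosc_resonant zeta k : resonant zeta k -> cosc zeta k = 0.
Proof. by move=> /eqP r; rewrite /cosc r subrr mul0r. Qed.

Lemma gain_eq0 zeta k : zeta != 0 -> (gain zeta k == 0) = resonant zeta k.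
Proof.
move=> z0; have ak := gt_eqF (a_gt0 k); rewrite /gain /resonant.
rewrite !mulf_eq0 invr_eq0 expf_eq0 /= mulf_eq0 (negbTE z0) ak pnatr_eq0 /= orbF.
by rewrite subr_eq0 eq_sym.
Qed.

Lemma geodesics_fiberE x z xi zeta : zeta != 0 ->
  geodesics_to G (x, z) (xi, zeta) <->
  x = fcalc (sinc zeta) (cosc zeta) xi /\
  z = \sum_k weight xi k * (zeta * a k - sin (zeta * a k)) / (2 * zeta ^+ 2 * a k).
Proof.
move=> z0.
have [l [lint l0 l1]] := geodesic_curve a_gt0 PP sumP trP PA AAP xi z0.
rewrite /geodesics_to /= (exp_map_graphE _ lint l0) l1.
by split=> [[-> ->]|[-> ->]].
Qed.

Lemma geodesics_fiber0E x z xi : geodesics_to G (x, z) (xi, 0) <-> xi = x /\ z = 0.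
Proof.
have [l [lint l0 l1]] := line_curve G xi.
rewrite /geodesics_to /= (exp_map_graphE _ lint l0) l1.
by split=> [[-> ->]|[-> ->]].
Qed.

Lemma weight_eq0 xi k : weight xi k = 0 <-> xi *m P k = 0.
Proof.
rewrite /weight; split=> [/eqP|->]; last exact: sqnorm0.
by rewrite sqnorm_eq0 => /eqP.
Qed.

Lemma weights_eq0 xi : (forall k, weight xi k = 0) -> xi = 0.
Proof.
move=> h; apply/eqP; rewrite -sqnorm_eq0 -(sum_weight PP sumP trP).
by rewrite big1.
Qed.

Lemma fcalcB f g xi eta : fcalc f g (xi - eta) = fcalc f g xi - fcalc f g eta.
Proof.
rewrite /fcalc -sumrB; apply: eq_bigr => k _.
by rewrite !mulmxBl !scalerBr opprD addrACA.
Qed.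

Lemma weight_endpoint xi zeta k : zeta != 0 ->
  weight (fcalc (sinc zeta) (cosc zeta) xi) k = gain zeta k * weight xi k.
Proof. by move=> z0; rewrite (weight_fcalc PP trP PA AAP) gainE. Qed.

(** Away from resonance the weight of xi is that of the endpoint divided by [gain], which produces
    the G-term. At a resonance sin vanishes, the endpoint loses the component, and xi contributes
    its weight over 2 zeta. *)
Lemma height_endpoint xi zeta : zeta != 0 ->
  \sum_k weight xi k * (zeta * a k - sin (zeta * a k)) / (2 * zeta ^+ 2 * a k) =
  height a (weight (fcalc (sinc zeta) (cosc zeta) xi)) zeta +
  (2 * zeta)^-1 * \sum_(k | resonant zeta k) weight xi k.
Proof.
move=> z0; rewrite /height mulr_sumr [X in _ + X]big_mkcond -big_split /=.
apply: eq_bigr => k _; rewrite weight_endpoint // /gain /Gfun.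
have ak := gt_eqF (a_gt0 k); case: ifP => [r|/negbT r].
  rewrite resonant_sin //; move: (eqP r) => ->; rewrite subrr !(mulr0, mul0r, subr0, add0r).
  by field; rewrite z0 ak.
have d0 : 1 - cos (zeta * a k) != 0 by rewrite subr_eq0 eq_sym.
by rewrite addr0; field; rewrite z0 ak d0.
Qed.

(** The inverse (f - A g) / (f^2 + a^2 g^2) of f + A g; division by 0 gives 0, so this is a
    pseudo-inverse and the center has no resonant component. *)
Definition fiber_center x zeta :=
  fcalc (fun k => sinc zeta k / gain zeta k) (fun k => - cosc zeta k / gain zeta k) x.

Lemma fiber_center_endpoint x zeta : zeta != 0 ->
  (forall k, resonant zeta k -> weight x k = 0) ->
  fcalc (sinc zeta) (cosc zeta) (fiber_center x zeta) = x.
Proof.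
move=> z0 h; rewrite (fcalc_comp PP PA AAP) -[RHS](fcalc_id G sumP).
apply/eqP; rewrite -subr_eq0; apply/eqP/weights_eq0 => k; apply/weight_eq0.
rewrite mulmxBl !(fcalc_P G PP) scale1r scale0r addr0.
have [r|r] := boolP (resonant zeta k).
  have xP : x *m P k = 0 by apply/weight_eq0/h.
  by rewrite -[x *m A *m P k]mulmxA -PA mulmxA xP mul0mx !scaler0 addr0 subr0.
have q0 : gain zeta k != 0 by rewrite gain_eq0.
rewrite [X in X *: (x *m P k)](_ : _ = gain zeta k / gain zeta k); last first.
  by rewrite -[X in _ = X / _](gainE k z0); ring.
rewrite divff // scale1r [X in X *: (x *m A *m P k)](_ : _ = 0) ?scale0r ?addr0 ?subrr //.
by ring.
Qed.

Lemma fiber_center_resonant x zeta k : resonant zeta k -> fiber_center x zeta *m P k = 0.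
Proof.
move=> r; rewrite (fcalc_P G PP) sinc_resonant // cosc_resonant //.
by rewrite oppr0 !mul0r !scale0r addr0.
Qed.

Lemma geodesics_fiber_weight x z xi zeta : zeta != 0 ->
  geodesics_to G (x, z) (xi, zeta) -> forall k, resonant zeta k -> weight x k = 0.
Proof.
move=> z0 /(geodesics_fiberE _ _ _ z0)[-> _] k r; rewrite weight_endpoint //.
by move: r; rewrite -gain_eq0 // => /eqP ->; rewrite mul0r.
Qed.

(** The endpoint equation fixes xi up to the resonant eigenspaces; the height equation then
    prescribes the square length of this free part through the resonant sum of [height_endpoint]. *)
Lemma geodesics_fiber_sphereE x z xi zeta : zeta != 0 ->
  (forall k, resonant zeta k -> weight x k = 0) ->
  geodesics_to G (x, z) (xi, zeta) <->
  (forall k, ~~ resonant zeta k -> (xi - fiber_center x zeta) *m P k = 0) /\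
  sqnorm (xi - fiber_center x zeta) = 2 * zeta * (z - height a (weight x) zeta).
Proof.
move=> z0 h; set c := fiber_center x zeta.
have cE : fcalc (sinc zeta) (cosc zeta) c = x by exact: fiber_center_endpoint.
have eqV : x = fcalc (sinc zeta) (cosc zeta) xi <->
    forall k, ~~ resonant zeta k -> (xi - c) *m P k = 0.
  split=> [xE k r|hV].
    apply/weight_eq0; have : fcalc (sinc zeta) (cosc zeta) (xi - c) = 0.
      by rewrite fcalcB -xE cE subrr.
    move=> /(congr1 (weight^~ k)); rewrite weight_endpoint // /weight mul0mx sqnorm0.
    by move=> /eqP; rewrite mulf_eq0 gain_eq0 // (negbTE r) /= => /eqP.
  apply/esym/eqP; rewrite -{1}cE -subr_eq0 -fcalcB; apply/eqP/weights_eq0 => k.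
  rewrite weight_endpoint //; have [r|r] := boolP (resonant zeta k).
    by move: r; rewrite -gain_eq0 // => /eqP ->; rewrite mul0r.
  by move/weight_eq0: (hV k r) => ->; rewrite mulr0.
have eqn : (forall k, ~~ resonant zeta k -> (xi - c) *m P k = 0) ->
    \sum_(k | resonant zeta k) weight xi k = sqnorm (xi - c).
  move=> hV; rewrite -(sum_weight PP sumP trP) big_mkcond; apply: eq_bigr => k _.
  case: ifP => [r|/negbT r]; last by move/weight_eq0: (hV k r) => ->.
  by rewrite /weight mulmxBl fiber_center_resonant // subr0.
rewrite geodesics_fiberE //; split=> [[xE zE]|[hV nE]].
  have hV := eqV.1 xE; split=> //.
  rewrite {1}zE height_endpoint // -xE -eqn // addrAC subrr add0r mulrA divff ?mul1r //.
  by rewrite mulf_neq0.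
have xE := eqV.2 hV; split=> //.
rewrite height_endpoint // -xE eqn // nE mulrA mulVf ?mul1r ?mulf_neq0 //; ring.
Qed.

Lemma geodesics_sphere_fiber x z zeta : sphere_fiber (geodesics_to G (x, z)) zeta.
Proof.
have [->|z0] := eqVneq zeta 0.
  (* The fiber over 0 is the straight line to x when z = 0 and empty otherwise, encoded by -1. *)
  exists x, [set 0], (if z == 0 then 0 else -1); split.
  - by move=> s t u v -> ->; rewrite !scaler0 addr0.
  - by [].
  - move=> xi; rewrite geodesics_fiber0E; case: eqP => [->|z0]; split.
    + by case=> -> _; rewrite /= subrr sqnorm0.
    + by case=> /eqP; rewrite subr_eq0 => /eqP -> _.
    + by case=> _ /z0.
    + by case=> _ h; have := sqnorm_ge0 (xi - x); rewrite h; lra.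
have [h|h] := pselect (forall k, resonant zeta k -> weight x k = 0).
  exists (fiber_center x zeta), [set v | forall k, ~~ resonant zeta k -> v *m P k = 0].
  exists (2 * zeta * (z - height a (weight x) zeta)); split.
  - move=> s t u v hu hv k r; rewrite mulmxDl -!scalemxAl hu // hv //.
    by rewrite !scaler0 addr0.
  - by move=> k _; rewrite mul0mx.
  - by move=> xi; exact: geodesics_fiber_sphereE.
exists 0, setT, (-1); split=> // xi; split=> [hG|[_ hn]].
  by case: h; exact: geodesics_fiber_weight hG.
by have := sqnorm_ge0 (xi - 0); rewrite hn; lra.
Qed.

Lemma nonresonant_height x z xi zeta : zeta != 0 -> (forall k, ~~ resonant zeta k) ->
  geodesics_to G (x, z) (xi, zeta) -> z = height a (weight x) zeta.
Proof.
move=> z0 r hG.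
have := hG; rewrite geodesics_fiber_sphereE // => [[hV hn]|k]; last by rewrite (negbTE (r k)).
have : xi - fiber_center x zeta = 0.
  by apply: weights_eq0 => k; apply/weight_eq0/hV.
move=> e; move: hn; rewrite e sqnorm0 => /esym/eqP.
by rewrite !mulf_eq0 pnatr_eq0 (negbTE z0) /= subr_eq0 => /eqP.
Qed.

Lemma nonresonant_fiber_nonempty x zeta : zeta != 0 ->
  (forall k, ~~ resonant zeta k) ->
  exists xi, geodesics_to G (x, height a (weight x) zeta) (xi, zeta).
Proof.
move=> z0 r; exists (fiber_center x zeta).
apply/geodesics_fiber_sphereE => [//|k|]; first by rewrite (negbTE (r k)).
by rewrite !subrr mulr0 sqnorm0; split=> // k _; rewrite mul0mx.
Qed.

(** A nonzero row of P_k is a free direction; it is rescaled to the prescribed length. *)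
Lemma resonant_fiber_nonempty x z zeta k : zeta != 0 -> resonant zeta k ->
  (forall k, resonant zeta k -> weight x k = 0) -> 0 <= zeta * (z - height a (weight x) zeta) ->
  exists xi, geodesics_to G (x, z) (xi, zeta).
Proof.
move=> z0 rk h hz.
have [i ui0] : exists i, row i (P k) != 0.
  apply/existsP; rewrite -negb_forall; apply: contra (P_neq0 k) => /forallP e.
  by apply/eqP/row_matrixP => i; rewrite row0; exact/eqP.
pose u := row i (P k); pose t := Num.sqrt (2 * zeta * (z - height a (weight x) zeta) / sqnorm u).
exists (fiber_center x zeta + t *: u).
apply/geodesics_fiber_sphereE => //; rewrite addrC addKr; split.
  move=> l rl; rewrite -scalemxAl -row_mul PP ifN ?row0 ?scaler0 //.
  by apply: contraNneq rl => <-.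
rewrite sqnormZ sqr_sqrtr ?divfK ?sqnorm_eq0 //.
by rewrite divr_ge0 ?sqnorm_ge0 // -mulrA mulr_ge0.
Qed.

(** Compared term by term with th = zeta a_k: [gain] is at most 4 / th^2, as 1 - cos <= 2, and th^2
    - |th| <= th (th - sin th). The 8 is this 4 times the 2 in the height formula. *)
Lemma geodesics_fiber_bound x z xi zeta : zeta != 0 -> geodesics_to G (x, z) (xi, zeta) ->
  \sum_k weight x k * (`|zeta| * a k ^+ 2 - a k) <= 8 * `|z|.
Proof.
move=> z0 /(geodesics_fiberE _ _ _ z0)[xE zE].
have az0 : 0 < `|zeta| by rewrite normr_gt0.
rewrite -(ler_pM2l az0); apply: (@le_trans _ _ (8 * (zeta * z))); last first.
  by rewrite [leRHS]mulrCA ler_pM2l // -normrM ler_norm.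
rewrite zE !mulr_sumr; apply: ler_sum => k _; rewrite xE weight_endpoint //.
have ak := a_gt0 k; have ak0 := gt_eqF ak.
set th := zeta * a k; have th0 : th != 0 by rewrite mulf_neq0 // ak0.
have -> : 8 * (zeta * (weight xi k * (th - sin th) / (2 * zeta ^+ 2 * a k))) =
    weight xi k * (4 / th ^+ 2 * (th * (th - sin th))).
  by rewrite /th; field; rewrite z0 ak0.
have -> : `|zeta| * (gain zeta k * weight xi k * (`|zeta| * a k ^+ 2 - a k)) =
    weight xi k * (gain zeta k * (th ^+ 2 - `|th|)).
  rewrite /th normrM (gtr0_norm ak) exprMn -[zeta ^+ 2]real_normK ?num_real //; ring.
rewrite ler_wpM2l ?weight_ge0 //.
have q0 : 0 <= gain zeta k.
  by rewrite divr_ge0 ?sqr_ge0 // mulr_ge0 // subr_ge0 cos_le1.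
apply: (@le_trans _ _ (gain zeta k * (th * (th - sin th)))).
  rewrite ler_wpM2l // mulrBr -expr2 lerD2l lerN2.
  apply: le_trans (ler_norm _) _; rewrite normrM ler_piMr //.
  by rewrite ler_norml sin_geN1 sin_le1.
rewrite ler_wpM2r ?mulB_sin_ge0 // /gain -/th ler_wpM2r ?invr_ge0 ?sqr_ge0 //.
by have := cos_geN1 th; lra.
Qed.

End GeodesicFibers.

(** * Counting levels *)

Section GeodesicBetti.
Variables (R : realType) (n : nat) (G : contactCarnotGroup R n).
Local Notation N := (n.*2).
Local Notation A := (ccg_form G).
Variables (m : nat) (a : 'I_m -> R) (P : 'I_m -> 'M[R]_N).
Hypothesis N_gt0 : (0 < N)%N.
Hypothesis m_gt0 : (0 < m)%N.
Hypothesis a_gt0 : forall k, 0 < a k.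
Hypothesis P_neq0 : forall k, P k != 0.
Hypothesis PP : forall k l, P k *m P l = if k == l then P k else 0.
Hypothesis sumP : \sum_k P k = 1%:M.
Hypothesis trP : forall k, (P k)^T = P k.
Hypothesis PA : forall k, P k *m A = A *m P k.
Hypothesis AAP : forall k, A *m A *m P k = - (a k ^+ 2) *: P k.
Implicit Types (x xi : 'rV[R]_N) (z zeta : R).

Local Notation weight := (weight P).
Local Notation resonant := (resonant a).
Local Notation k0 := (Ordinal m_gt0).

Lemma weight_gt0 x : x != 0 -> exists k, 0 < weight x k.
Proof.
move=> x0; apply: contrapT => none; move/eqP: x0; apply.
apply: (weights_eq0 PP sumP trP) => k; apply/eqP; rewrite eq_le weight_ge0 andbT leNgt.
by apply/negP => wk; apply: none; exists k.
Qed.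

(** In a pole-free subinterval three points are tested; three nonempty levels would make the height
    take the value z three times. For x = 0 the height is 0, which forces z = 0. *)
Lemma geodesics_gap x z (s t : R) : (x, z) <> (0, 0) -> s < t ->
  exists c, s < c < t /\ forall xi, ~ geodesics_to G (x, z) (xi, c).
Proof.
move=> xz0 st; have [M M0 aM] := finite_ub a.
pose J := (Num.trunc (Num.max `|s| `|t| * M)).+1.
have JM : Num.max `|s| `|t| * M <= J%:R by exact/ltW/truncnS_gt.
have [s' [t' [ss' st' tt' avoid]]] := subitv_avoid (poles a J) st.
have nr u : s' <= u <= t' -> nonresonant a u.
  move=> su k; apply/negP => r; suff : u \in poles a J by move=> /avoid; rewrite su.
  apply: (resonant_poles a_gt0 r); apply: le_trans JM.
  apply: ler_pM; rewrite ?aM //; first exact: ltW.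
  move: su => /andP[s'u ut']; rewrite le_max; have [u0|u0] := leP 0 u.
    by apply/orP; right; rewrite ger0_norm // (le_trans _ (ler_norm t)) //; lra.
  apply/orP; left; rewrite ltr0_norm // -[leRHS]normrN (le_trans _ (ler_norm (- s))) //; lra.
have nz u : s' <= u <= t' -> u != 0.
  by move=> /nr/(_ k0); apply: contraNneq => ->; exact: resonant0.
have solves u xi : s' <= u <= t' -> geodesics_to G (x, z) (xi, u) -> z = height a (weight x) u.
  by move=> su; apply: (nonresonant_height a_gt0 PP sumP trP PA AAP); [exact: nz|exact: nr].
pose u := (s' + t') / 2.
have [h1|h1] := pselect (exists xi, geodesics_to G (x, z) (xi, s')); last first.
  by exists s'; split; [lra|move=> xi hx; apply: h1; exists xi].
have [h2|h2] := pselect (exists xi, geodesics_to G (x, z) (xi, u)); last first.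
  by exists u; split; [rewrite /u; lra|move=> xi hx; apply: h2; exists xi].
have [h3|h3] := pselect (exists xi, geodesics_to G (x, z) (xi, t')); last first.
  by exists t'; split; [lra|move=> xi hx; apply: h3; exists xi].
exfalso; have [xi1 /solves e1] := h1; have [xi2 /solves e2] := h2; have [xi3 /solves e3] := h3.
have {}e1 : z = height a (weight x) s' by apply: e1; lra.
have {}e2 : z = height a (weight x) u by apply: e2; rewrite /u; lra.
have {}e3 : z = height a (weight x) t' by apply: e3; lra.
have [x0|x0] := eqVneq x 0.
  apply: xz0; rewrite e1 x0 /height big1 // => k _.
  by rewrite /weight mul0mx sqnorm0 mul0r.
apply: (@height_three R m a a_gt0 (weight x) (weight_ge0 P x) s' u t') => //.
- exact: weight_gt0.
- by rewrite /u; lra.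
- by rewrite /u; lra.
- by rewrite -e1.
- by rewrite -e2.
Qed.

Lemma solution_fiber x z t : 0 < t -> solution a (weight x) `|z| t ->
  exists xi, geodesics_to G (x, z) (xi, if 0 <= z then t else - t).
Proof.
move=> t0 sol; set e := if _ then _ else _.
have e0 : e != 0 by rewrite /e; case: ifP; rewrite ?oppr_eq0 gt_eqF.
have re k : resonant e k = resonant t k by rewrite /e; case: ifP; rewrite ?resonantN.
have he : height a (weight x) e = if 0 <= z then height a (weight x) t else - height a (weight x) t.
  by rewrite /e; case: ifP; rewrite ?heightN.
case: sol => [[nt ht]|[[k rk] w0 ht]].
  have -> : z = height a (weight x) e.
    rewrite he ht; case: ifP => [/ger0_norm ->//|/negbT]; rewrite -ltNge => /ltr0_norm ->.
    by rewrite opprK.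
  apply: (nonresonant_fiber_nonempty a_gt0 PP sumP trP PA AAP) => // k.
  by rewrite re.
apply: (resonant_fiber_nonempty a_gt0 P_neq0 PP sumP trP PA AAP (k := k)); rewrite ?re //.
  by move=> l; rewrite re; exact: w0.
rewrite he /e; case: ifP ht => [z0|/negbT].
  by rewrite ger0_norm // => ht; rewrite mulr_ge0 ?subr_ge0 // ltW.
rewrite -ltNge => z0; rewrite ltr0_norm // => ht; rewrite mulNr -mulrN mulr_ge0 //.
  exact: ltW.
by lra.
Qed.

(** As 1 - cos u = 2 sin(u/2)^2, the denominator of G is at least 8 s0^2, while t a - sin(t a) is at
    most t M + 1. *)
Lemma height_le x (s0 M t : R) : 0 < s0 -> (forall k, a k <= M) -> 0 < t ->
  (forall k, s0 <= `|sin (t * a k / 2)|) ->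
  nonresonant a t /\
  height a (weight x) t <= M * (M + 1) / (8 * s0 ^+ 2) * (t + 1) * sqnorm x.
Proof.
move=> s00 aM t0 hs.
have cE k : 2 * s0 ^+ 2 <= 1 - cos (t * a k).
  have -> : t * a k = (t * a k / 2) *+ 2 by rewrite -mulr_natr divfK.
  rewrite cos_mulr2n; have := cos2Dsin2 (t * a k / 2).
  have : s0 ^+ 2 <= sin (t * a k / 2) ^+ 2.
    rewrite -[leRHS]real_normK ?num_real // ler_pXn2r // ?nnegrE ?normr_ge0 //.
    exact: ltW.
  by move=> h1 h2; rewrite mulr2n; lra.
have s2 : 0 < s0 ^+ 2 by rewrite exprn_gt0.
split=> [k|].
  by apply/negP => /eqP e; have := cE k; rewrite e subrr; lra.
rewrite -(sum_weight PP sumP trP) mulr_sumr; apply: ler_sum => k _.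
rewrite [leRHS]mulrC ler_wpM2l ?weight_ge0 //.
have ak := a_gt0 k; have ak' := aM k; have M0 : 0 < M by exact: lt_le_trans ak'.
have num : a k * (t * a k - sin (t * a k)) <= M * (M + 1) * (t + 1).
  have s1 := sin_geN1 (t * a k).
  apply: (@le_trans _ _ (M * (t * M + 1))).
    apply: ler_pM; [exact: ltW| |by []|].
      by rewrite subr_ge0 sin_le_id // mulr_ge0 // ltW.
    by have : t * a k <= t * M; [rewrite ler_pM2l|lra].
  rewrite -mulrA ler_pM2l //; nra.
have ck := cE k; rewrite /Gfun mulrA ler_pdivrMr; last lra.
have -> : M * (M + 1) / (8 * s0 ^+ 2) * (t + 1) * (4 * (1 - cos (t * a k))) =
  M * (M + 1) * (t + 1) * ((1 - cos (t * a k)) / (2 * s0 ^+ 2)).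
  by field; rewrite gt_eqF.
apply: le_trans num _; apply: ler_peMr; first by rewrite !mulr_ge0 //; lra.
by rewrite ler_pdivlMr ?mulr_gt0 // mul1r.
Qed.

Lemma beta_hat_ge : exists C S : R, [/\ 0 < C, 0 < S &
  forall x z (M : nat), (x, z) <> (0, 0) -> C * (M%:R * S + 2) * sqnorm x <= `|z| ->
    (M%:R%:E <= beta_hat G (x, z))%E].
Proof.
have [D [s0 [D0 s00 hD]]] := uniformly_nonresonant a_gt0.
have [B B0 aB] := finite_ub a.
have p0 : 0 < (pi *+ 2 : R) by rewrite pmulrn_lgt0 // pi_gt0.
have pa0 : 0 < (pi *+ 2) / a k0 by rewrite divr_gt0.
(* D to find a uniformly nonresonant point, one period to reach a solution after it, and 1 so that
   solutions of consecutive windows differ. *)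
pose S := D + (pi *+ 2) / a k0 + 1; have SE : S = D + (pi *+ 2) / a k0 + 1 by [].
have S0 : 0 < S by lra.
pose C := B * (B + 1) / (8 * s0 ^+ 2).
have C0 : 0 < C by rewrite /C divr_gt0 ?mulr_gt0 ?exprn_gt0 //; lra.
exists C, S; split=> // x z M xz0 hM.
(* Windows start at 1 to keep t positive. The nonresonant u satisfies u + 1 <= M S + 2, the factor
   in the hypothesis on |z|. *)
have sol (j : 'I_M) : exists t : R, [/\ 1 + j%:R * S <= t, t < 1 + j.+1%:R * S &
    solution a (weight x) `|z| t].
  have [u [/andP[Tu uT] hu]] := hD (1 + j%:R * S).
  have jS : 0 <= j%:R * S by rewrite mulr_ge0 // ltW.
  have u0 : 0 < u by lra.
  have [nu hhu] := height_le x s00 aB u0 hu.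
  have jM : j.+1%:R * S <= M%:R * S by rewrite ler_pM2r // ler_nat.
  have jE : j.+1%:R * S = j%:R * S + S by rewrite -natr1 mulrDl mul1r.
  have uz : height a (weight x) u <= `|z|.
    apply: le_trans hhu _; apply: le_trans hM; apply: ler_wpM2r; first exact: sqnorm_ge0.
    by rewrite -/C ler_pM2l //; lra.
  have [t [/andP[ut tu] st]] := solution_after a_gt0 (weight_ge0 P x) k0 u0 nu uz.
  by exists t; split=> //; lra.
have [tf htf] := choice sol.
have tf0 j : 0 < tf j.
  have [h _ _] := htf j; apply: lt_le_trans h.
  by rewrite ltr_pwDl // mulr_ge0 // ltW.
pose e j : R := if 0 <= z then tf j else - tf j.
have tlt (i j : 'I_M) : (i < j)%N -> tf i < tf j.
  move=> ij; have [_ h1 _] := htf i; have [h2 _ _] := htf j.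
  apply: lt_le_trans h1 (le_trans _ h2); rewrite lerD2l ler_pM2r // ler_nat //.
have einj : injective e.
  move=> i j; rewrite /e => eij; have {}eij : tf i = tf j.
    by move: eij; case: ifP => // _ /oppr_inj.
  apply/val_inj; have [h|h|//] := ltngtP i j.
    by have := tlt _ _ h; rewrite eij ltxx.
  by have := tlt _ _ h; rewrite eij ltxx.
have -> : M = size [seq e j | j <- enum 'I_M] by rewrite size_map size_enum_ord.
apply: fibers_total_betti_ge.
- by rewrite map_inj_uniq ?enum_uniq.
- move=> zeta /mapP[j _ ->]; apply: solution_fiber => //.
  by have [] := htf j.
- by move=> s t; exact: geodesics_gap.
Qed.

Lemma beta_hat_le : exists C R2 : R, 0 < C /\
  forall x z, x != 0 -> (beta_hat G (x, z) <= (C * (`|z| / sqnorm x) + R2)%:E)%E.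
Proof.
have [B B0 aB] := finite_ub a; have [e e0 ea] := finite_positive_lb a_gt0.
have e2 : 0 < e ^+ 2 by rewrite exprn_gt0.
pose K : R := (N.*2 * 2 ^ N.*2)%:R.
have K0 : 0 < K by rewrite ltr0n muln_gt0 expn_gt0 double_gt0 N_gt0.
have m0 : 0 < m%:R :> R by rewrite ltr0n.
exists (K * (6 * m%:R * B * (8 / e ^+ 2))).
exists (K * (6 * m%:R * B * (B / e ^+ 2) + 9 * m%:R + 2)); split.
  by rewrite !mulr_gt0 // invr_gt0.
move=> x z x0; pose W := sqnorm x.
have W0 : 0 < W by rewrite lt_neqAle sqnorm_ge0 andbT eq_sym sqnorm_eq0.
(* The bound on |zeta| from [geodesics_fiber_bound], with a_k^2 >= e^2 and a_k <= B. *)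
pose L := (8 * `|z| / W + B) / e ^+ 2.
have L0 : 0 <= L by rewrite divr_ge0 ?addr_ge0 ?divr_ge0 ?mulr_ge0 // ltW.
pose J := (Num.trunc (L * B)).+1.
have LJ k : L * a k <= J%:R.
  apply: (@le_trans _ _ (L * B)); first by rewrite ler_wpM2l.
  exact/ltW/truncnS_gt.
have JL : J%:R <= L * B + 1.
  by rewrite -natr1 lerD2r truncn_le // mulr_ge0 // ltW.
clearbody J; have fiberL xi zeta : zeta != 0 -> geodesics_to G (x, z) (xi, zeta) -> `|zeta| <= L.
  move=> z0 /(geodesics_fiber_bound a_gt0 PP sumP trP PA AAP z0) h.
  have {h} : (`|zeta| * e ^+ 2 - B) * W <= 8 * `|z|.
    apply: le_trans h; rewrite /W -(sum_weight PP sumP trP) mulr_sumr.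
    apply: ler_sum => k _; rewrite mulrC ler_wpM2l ?weight_ge0 //.
    apply: lerB; last exact: aB.
    rewrite ler_wpM2l // ler_pXn2r ?nnegrE //; exact: ltW.
  by rewrite -ler_pdivlMr // lerBlDr -ler_pdivlMr.
have [s1 [us1 ss1 hs1]] := @bounded_set_enum R
    [set t | [/\ `|t| <= L, nonresonant a t & height a (weight x) t = z]]
    (2 * (size (poles a J)).+1) (fun s us hs =>
      nonresonant_solutions_le a_gt0 (weight_ge0 P x) m_gt0 (weight_gt0 x0) LJ us hs).
pose zs := undup (poles a J ++ s1).
(* With p = m (2 J + 1) poles there are at most 2 (p + 1) further levels, in total 3 p + 2. The
   level 0 is among the poles. *)
have size_zs : (size zs <= 6 * m * J + 3 * m + 2)%N.
  apply: leq_trans (size_undup _) _; move: ss1; rewrite size_cat size_poles.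
  have -> : (m * J.*2.+1 = 2 * (m * J) + m)%N by rewrite mulnS -mul2n mulnCA addnC.
  by rewrite -(mulnA 6); move: (m * J)%N (size s1) => p q; clear; lia.
have cover xi zeta : geodesics_to G (x, z) (xi, zeta) -> zeta \in zs.
  move=> hG; rewrite mem_undup mem_cat; have [->|z0] := eqVneq zeta 0.
    by rewrite (@resonant_poles _ _ _ a_gt0 0 k0) ?resonant0 // normr0 mul0r.
  have zL := fiberL xi zeta z0 hG.
  have [[k rk]|none] := pselect (exists k, resonant zeta k).
    rewrite (resonant_poles a_gt0 rk) //; apply: le_trans (LJ k).
    by apply: ler_wpM2r => //; exact: ltW.
  have nz : nonresonant a zeta by move=> k; apply/negP => rk; apply: none; exists k.
  apply/orP; right; apply: hs1; split=> //.
  exact/esym/(nonresonant_height a_gt0 PP sumP trP PA AAP z0 nz hG).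
have le1 : (beta_hat G (x, z) <= (N.*2 * (size zs * 2 ^ N.*2))%:R%:E)%E.
  apply: fibers_total_betti_le => //; first exact: undup_uniq.
  move=> zeta _; exact: (geodesics_sphere_fiber a_gt0 PP sumP trP PA AAP).
apply: le_trans le1 _; rewrite lee_fin.
have -> : (N.*2 * (size zs * 2 ^ N.*2))%:R = K * (size zs)%:R :> R.
  by rewrite /K -natrM mulnA mulnAC.
have sz : (size zs)%:R <= 6 * m%:R * J%:R + 3 * m%:R + 2 :> R.
  by rewrite -!natrM -!natrD ler_nat.
have : K * (size zs)%:R <= K * (6 * m%:R * (L * B + 1) + 3 * m%:R + 2).
  rewrite ler_pM2l //; apply: le_trans sz _; rewrite !lerD2r ler_pM2l // mulr_gt0 //.
move=> /le_trans; apply; rewrite le_eqVlt; apply/orP; left; apply/eqP.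
by rewrite /L -/W; field; rewrite !gt_eqF.
Qed.

End GeodesicBetti.

Theorem theorem5 (R : realType) (n : nat) (G : contactCarnotGroup R n) :
  exists C1 C2 R1 R2 : R,
    [/\ 0 < C1, 0 < C2 &
      forall (x : 'rV[R]_(n.*2)) (z : R), (x, z) <> (0, 0) ->
        (C1%:E * height_ratio x z + R1%:E <= beta_hat G (x, z))%E /\
        (beta_hat G (x, z) <= C2%:E * height_ratio x z + R2%:E)%E].
Proof.
have N0 : (0 < n.*2)%N.
  by have [[i im] _] := ccg_form_neq0 G; apply: leq_ltn_trans im.
have [m [a [P [m0 aP [PP sumP trP] PA AAP]]]] :=
  skew_projectors N0 (ccg_form_skew G) (ccg_form_unit G).
have a0 k : 0 < a k by have [] := aP k.
have P0 k : P k != 0 by have [] := aP k.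
have [C [S [C0 S0 hge]]] := beta_hat_ge m0 a0 P0 PP sumP trP PA AAP.
have [C2 [R2 [C20 hle]]] := beta_hat_le N0 m0 a0 PP sumP trP PA AAP.
(* C1 and R1 come from solving C (M S + 2) |x|^2 = |z| for M and subtracting 1 for rounding M
   down. *)
exists (C * S)^-1, C2, (- (2 / S + 1)), R2; split=> //.
  by rewrite invr_gt0 mulr_gt0.
move=> x z xz0; rewrite /height_ratio; case: eqP => [x0|/eqP x0].
  rewrite !gt0_muley ?lte_fin ?invr_gt0 ?mulr_gt0 // !addye //; split; last exact: leey.
  have big M : (M%:R%:E <= beta_hat G (x, z))%E.
    by apply: hge => //; rewrite x0 sqnorm0 mulr0.
  move: big; case: (beta_hat G (x, z)) => [r| |] //= big; last by have := big 0%N.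
  have := big (Num.trunc `|r|).+1; rewrite lee_fin leNgt.
  by rewrite (le_lt_trans (ler_norm _) (truncnS_gt _)).
split; last by rewrite -EFinM -EFinD; exact: hle.
have W0 : 0 < sqnorm x by rewrite lt_neqAle sqnorm_ge0 andbT eq_sym sqnorm_eq0.
rewrite -EFinM -EFinD; set r := _ + _.
have rE : r = (`|z| / (C * sqnorm x) - 2) / S - 1.
  by rewrite /r; field; rewrite !gt_eqF.
have [r0|r0] := leP r 0.
  apply: (@le_trans _ _ 0%E); first by rewrite lee_fin.
  exact: le_trans (betti_ge0 _ _ _) (total_betti_ge0 _ _).
have tr : (Num.trunc (r + 1))%:R <= r + 1 by rewrite truncn_le //; lra.
apply: le_trans (hge x z (Num.trunc (r + 1)) xz0 _); last first.
  have : (Num.trunc (r + 1))%:R * S + 2 <= `|z| / (C * sqnorm x).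
    move: tr; rewrite rE subrK ler_pdivlMr // => h; lra.
  by rewrite ler_pdivlMr ?mulr_gt0 // mulrA [_ * C]mulrC.
rewrite lee_fin; have := truncnS_gt (r + 1); rewrite -natr1; lra.
Qed.
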